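(* Let $\bar q\in\mathbb Q_{ad}$ be a local minimum of $\min\{J(\mathcal Sq,q):q\in\mathbb Q_{ad}\}$ and let $\bar\eta\in\partial j(\bar q)$ be the corresponding subgradient such that $\int_\Omega(\bar p+\lambda\bar q+\mu\bar\eta)(q-\bar q)\,\mathrm dx\ge0$ for all $q\in\mathbb Q_{ad}$, where $\bar p$ is the adjoint state associated with $\bar q$. Then the following statements are equivalent: (i) $F''(\bar q)w^2>0$ for all $w\in C_{\bar q}\setminus\{0\}$. (ii) There exist $\tau,\delta>0$ such that $F''(\bar q)w^2\ge\delta\|w\|_{L^2(\Omega)}^2$ for all $w\in C_{\bar q}^\tau$.
   Context: Let $d\ge2$ be an integer, $\Omega\subset\mathbb R^d$ an open bounded domain with Lipschitz boundary, $s\in(0,1)$, $r>d/(2s)$, $\lambda>0$, $\mu>0$, $\alpha<0<\beta$. $\tilde H^s(\Omega)$ is the closure of $C_0^\infty(\Omega)$ in $H^s(\mathbb R^d)$, and $$\mathcal A(u,v)=\frac{C(d,s)}2\int_{\mathbb R^d}\int_{\mathbb R^d}\frac{(u(x)-u(y))(v(x)-v(y))}{|x-y|^{d+2s}}\,\mathrm dx\,\mathrm dy,\qquad C(d,s)=\frac{2^{2s}s\Gamma(s+\frac d2)}{\pi^{d/2}\Gamma(1-s)}.$$ Assumptions. (A1) $a:\Omega\times\mathbb R\to\mathbb R$ is Carathéodory, of class $C^2$ in the second variable, $a(\cdot,0)\in L^2(\Omega)\cap L^r(\Omega)$. (A2) $\frac{\partial a}{\partial u}(x,u)\ge0$ for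 a.e. $x\in\Omega$ and all $u\in\mathbb R$. (A3) For all $\mathfrak m>0$ there is $C_{\mathfrak m}>0$ with $\sum_{i=1}^2|\frac{\partial^ia}{\partial u^i}(x,u)|\le C_{\mathfrak m}$ and $|\frac{\partial^2a}{\partial u^2}(x,u)-\frac{\partial^2a}{\partial u^2}(x,v)|\le C_{\mathfrak m}|u-v|$ for a.e. $x\in\Omega$ and $|u|,|v|\le\mathfrak m$. (B1) $L:\Omega\times\mathbb R\to\mathbb R$ is Carathéodory, of class $C^2$ in the second variable, $L(\cdot,0)\in L^1(\Omega)$. (B2) For all $\mathfrak m>0$ there are $\psi_{\mathfrak m},\phi_{\mathfrak m}\in L^r(\Omega)$ with $|\frac{\partial L}{\partial u}(x,u)|\le\psi_{\mathfrak m}(x)$ and $|\frac{\partial^2L}{\partial u^2}(x,u)|\le\phi_{\mathfrak m}(x)$ for a.e. $x\in\Omega$ and $|u|\le\mathfrak m$. For $q\in L^r(\Omega)$, $\mathcal Sq=u\in\tilde H^s(\Omega)\cap L^\infty(\Omega)$ is the unique solution of $\mathcal A(u,v)+\int_\Omega a(x,u)v\,\mathrm dx=\int_\Omega qv\,\mathrm dx$ for all $v\in\tilde H^s(\Omega)$. The cost is $J(u,q)=\int_\Omega L(x,u)\,\mathrm dx+\frac\lambda2\|q\|_{L^2(\Omega)}^2+\mu\|q\|_{L^1(\Omega)}$, and $\mathbb Q_{ad}=\{v\in L^2(\Omega):\alpha\le v\le\beta\text{ a.e. in }\Omega\}$. $\bar q\in\mathbb Q_{ad}$ is a local minimum (local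 solution) if there is $\varepsilon>0$ with $J(\mathcal S\bar q,\bar q)\le J(\mathcal Sq,q)$ for all $q\in\mathbb Q_{ad}$ with $\|q-\bar q\|_{L^2(\Omega)}\le\varepsilon$. $F(q)=\int_\Omega L(x,\mathcal Sq)\,\mathrm dx+\frac\lambda2\|q\|_{L^2(\Omega)}^2$ and $j(q)=\|q\|_{L^1(\Omega)}$. $\zeta\in\partial j(q)\subset L^\infty(\Omega)$ iff for a.e. $x$, $\zeta(x)=1$ if $q(x)>0$, $\zeta(x)=-1$ if $q(x)<0$, $\zeta(x)\in[-1,1]$ if $q(x)=0$. The directional derivative is $j'(q;w)=\int_{\{q>0\}}w\,\mathrm dx-\int_{\{q<0\}}w\,\mathrm dx+\int_{\{q=0\}}|w|\,\mathrm dx$. With $\bar u=\mathcal S\bar q$, the adjoint state $\bar p\in\tilde H^s(\Omega)\cap L^\infty(\Omega)$ solves $\mathcal A(v,\bar p)+\int_\Omega\frac{\partial a}{\partial u}(x,\bar u)\bar pv\,\mathrm dx=\int_\Omega\frac{\partial L}{\partial u}(x,\bar u)v\,\mathrm dx$ for all $v\in\tilde H^s(\Omega)$. For $w\in L^2(\Omega)$, $F'(\bar q)w=\int_\Omega(\bar p+\lambda\bar q)w\,\mathrm dx$ and $$F''(\bar q)w^2=\int_\Omega\left(\frac{\partial^2L}{\partial u^2}(x,\bar u)\phi_w^2+\lambda w^2-\bar p\,\frac{\partial^2a}{\partial u^2}(x,\bar u)\phi_w^2\right)\mathrm dx,$$ where $\phi_w\in\tilde H^s(\Omega)$ solves $\mathcal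 A(\phi_w,v)+\int_\Omega\frac{\partial a}{\partial u}(x,\bar u)\phi_wv\,\mathrm dx=\int_\Omega wv\,\mathrm dx$ for all $v\in\tilde H^s(\Omega)$. Sign conditions on $w\in L^2(\Omega)$: $w(x)\ge0$ if $\bar q(x)=\alpha$ and $w(x)\le0$ if $\bar q(x)=\beta$. The cones are $C_{\bar q}=\{w\in L^2(\Omega):w$ satisfies the sign conditions and $F'(\bar q)w+\mu j'(\bar q;w)=0\}$ and, for $\tau>0$, $C_{\bar q}^\tau=\{w\in L^2(\Omega):w$ satisfies the sign conditions and $F'(\bar q)w+\mu j'(\bar q;w)\le\tau\|w\|_{L^2(\Omega)}\}$. *)

(* Defs.v *)
From HB Require Import structures.
From mathcomp Require Import all_boot all_order all_algebra.
From mathcomp Require Import all_classical all_reals all_analysis.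

Set Implicit Arguments.
Unset Strict Implicit.
Unset Printing Implicit Defensive.
Import Order.TTheory GRing.Theory Num.Theory.
Import numFieldNormedType.Exports.

Local Open Scope classical_set_scope.
Local Open Scope ring_scope.

Lemma sigma_finite_product d1 d2 (T1 : measurableType d1)
    (T2 : measurableType d2) (R : realType)
    (m1 : {sigma_finite_measure set T1 -> \bar R})
    (m2 : {sigma_finite_measure set T2 -> \bar R}) :
  sigma_finite setT (m1 \x m2)%E.
Proof.
have /sigma_finiteP[F [TF ndF Foo]] := sigma_finiteT m1.
have /sigma_finiteP[G [TG ndG Goo]] := sigma_finiteT m2.
exists (fun n => F n `*` G n).
  rewrite -setXTT TF TG predeqE => -[x y]; split.
    move=> [/= [n _ Fnx] [k _ Gky]]; exists (maxn n k) => //; split.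
    - by move: x Fnx; exact/subsetPset/ndF/leq_maxl.
    - by move: y Gky; exact/subsetPset/ndG/leq_maxr.
  by move=> [n _ []/= ? ?]; split; exists n.
move=> k; have [? ?] := Foo k; have [? ?] := Goo k.
split; first exact: measurableX.
by rewrite product_measure1E// lte_mul_pinfty// ge0_fin_numE.
Qed.

(* The Borel sigma-algebra of R^d is generated by the coordinates, as the
   library does for [n.-tuple T]. *)
Section measurable_rV.
Context (R : realType) (d : nat).

Definition coord_rV (i : 'I_d) (x : 'rV[R]_d) : measurableTypeR R := x ord0 i.

Let rV_set0 : g_sigma_preimage coord_rV set0.
Proof. exact: sigma_algebra0. Qed.

Let rV_setC A : g_sigma_preimage coord_rV A -> g_sigma_preimage coord_rV (~` A).
Proof. exact: sigma_algebraC. Qed.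

Let rV_bigcup (F : (set _)^nat) : (forall i, g_sigma_preimage coord_rV (F i)) ->
  g_sigma_preimage coord_rV (\bigcup_i (F i)).
Proof. exact: sigma_algebra_bigcup. Qed.

HB.instance Definition _ :=
  @isMeasurable.Build default_measure_display 'rV[R]_d
    (g_sigma_preimage coord_rV) rV_set0 rV_setC rV_bigcup.

Lemma measurable_coord_rV (i : 'I_d) : measurable_fun setT (coord_rV i).
Proof.
move=> _ Y mY; rewrite setTI; apply: sub_sigma_algebra.
rewrite -bigcup_seq/=; exists i => /=; first by rewrite mem_index_enum.
by exists Y => //; rewrite setTI.
Qed.

Lemma measurable_to_rV d' (T : measurableType d') (f : T -> 'rV[R]_d) :
  (forall i, measurable_fun setT (coord_rV i \o f)) -> measurable_fun setT f.
Proof.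
move=> mf _ Y mY; rewrite setTI.
have : preimage_set_system setT f (g_sigma_preimage coord_rV) `<=` measurable.
  rewrite -g_sigma_preimage_comp; apply: smallest_sub.
    exact: sigma_algebra_measurable.
  rewrite -bigcup_seq => A [i _] [B mB <-].
  exact: mf.
by apply; exists Y => //; rewrite setTI.
Qed.

End measurable_rV.

Section lebesgue_rV.
Context (R : realType).

Definition cons_rV n (z : measurableTypeR R * 'rV[R]_n) : 'rV[R]_n.+1 :=
  \row_i (if unlift ord0 i is Some j then z.2 ord0 j else z.1).

Definition uncons_rV n (x : 'rV[R]_n.+1) : measurableTypeR R * 'rV[R]_n :=
  (x ord0 ord0, \row_j x ord0 (lift ord0 j)).

Lemma cons_rVK n : cancel (@cons_rV n) (@uncons_rV n).
Proof.
move=> [t v]; rewrite /uncons_rV /cons_rV; congr (_, _).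
  by rewrite mxE unlift_none.
by apply/rowP => j; rewrite !mxE liftK.
Qed.

Lemma measurable_cons_rV n : measurable_fun setT (@cons_rV n).
Proof.
apply: measurable_to_rV => i.
case: (unliftP ord0 i) => [j|] ->.
  rewrite (_ : _ \o _ = coord_rV j \o snd); last first.
    by apply/funext => z; rewrite /coord_rV /cons_rV/= mxE liftK.
  exact: measurableT_comp (measurable_coord_rV j) _.
rewrite (_ : _ \o _ = fst); first exact: measurable_fst.
by apply/funext => z; rewrite /coord_rV /cons_rV/= mxE unlift_none.
Qed.

Lemma measurable_uncons_rV n : measurable_fun setT (@uncons_rV n).
Proof.
apply/measurable_fun_pairP; split.
  exact: (measurable_coord_rV (ord0 : 'I_n.+1)).
apply: measurable_to_rV => j.
rewrite (_ : _ \o _ = coord_rV (lift ord0 j)); first exact: measurable_coord_rV.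
by apply/funext => x; rewrite /coord_rV/= mxE.
Qed.

Section step.
Context n (m : {sigma_finite_measure set 'rV[R]_n -> \bar R}).

Definition borel_lebesgueS : set 'rV[R]_n.+1 -> \bar R :=
  pushforward (lebesgue_measure \x m)%E (@cons_rV n).

HB.instance Definition _ :=
  Measure.copy borel_lebesgueS
    (measure_function_pushforward__canonical__measure_function_Measure
      (lebesgue_measure \x m)%E (@measurable_cons_rV n)).

Let borel_lebesgueS_sigma_finite : sigma_finite setT borel_lebesgueS.
Proof.
have [F FT Foo] := sigma_finite_product lebesgue_measure m.
exists (fun k => @uncons_rV n @^-1` F k).
  by rewrite -preimage_bigcup -FT preimage_setT.
move=> k; have [mF Fk] := Foo k; split.
  by rewrite -[X in measurable X]setTI; exact: measurable_uncons_rV.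
rewrite /borel_lebesgueS /pushforward -comp_preimage (_ : _ \o _ = id)//.
by apply/funext => z/=; rewrite cons_rVK.
Qed.

HB.instance Definition _ := @Measure_isSigmaFinite.Build _ _ _ borel_lebesgueS
  borel_lebesgueS_sigma_finite.

End step.

Fixpoint borel_lebesgue n : {sigma_finite_measure set 'rV[R]_n -> \bar R} :=
  if n is m.+1 then borel_lebesgueS (borel_lebesgue m) else \d_(0 : 'rV[R]_0).

(* The domain of [lebesgue_rV] is R^d with the sigma-algebra of Lebesgue
   (Caratheodory) measurable sets; the carrier type unfolds to ['rV[R]_d]. *)
Definition lebesgue_rV d :=
  @completed_measure_extension _ _ _ (borel_lebesgue d).
Arguments lebesgue_rV : clear implicits.

HB.instance Definition _ d := Measure.on (lebesgue_rV d).

Let lebesgue_rV_sigma_finite d : sigma_finite setT (lebesgue_rV d).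
Proof. exact/completed_measure_extension_sigma_finite/sigma_finiteT. Qed.

HB.instance Definition _ d := @Measure_isSigmaFinite.Build _ _ _ (lebesgue_rV d)
  (@lebesgue_rV_sigma_finite d).

End lebesgue_rV.
Arguments lebesgue_rV : clear implicits.

Section geometry.
Context (R : realType) (d : nat).

(* The library norm on ['rV[R]_d] is the max norm. *)
Definition enorm n (x : 'rV[R]_n) : R := Num.sqrt (\sum_i x ord0 i ^+ 2).

(* Near each boundary point, and up to a change of orthonormal coordinates
   [O], Omega is the epigraph, over the k-th axis, of a Lipschitz function of
   the other d-1 coordinates. *)
Definition lipschitz_boundary (Omega : set 'rV[R]_d) :=
  forall x0, (closure Omega `\` Omega) x0 ->
  exists (O : 'M[R]_d) (k : 'I_d) (g : 'rV[R]_d.-1 -> R) (K rho : R),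
    [/\ O *m O^T = 1%:M,
        forall y z, `|g y - g z| <= K * enorm (y - z),
        0 < rho &
        forall x, enorm (x - x0) < rho ->
          (Omega x <-> g (col' k (x *m O)) < (x *m O) ord0 k)].

Definition lipschitz_domain (Omega : set 'rV[R]_d) :=
  [/\ Omega !=set0, open Omega, connected Omega, bounded_set Omega &
      lipschitz_boundary Omega].

Fixpoint Ck (k : nat) (f : 'rV[R]_d -> R) : Prop :=
  continuous f /\
  if k is k'.+1 then
    forall i : 'I_d, (forall x, derivable f x (delta_mx ord0 i)) /\
                     Ck k' ('D_(delta_mx ord0 i) f)
  else True.

Definition test_function (Omega : set 'rV[R]_d) (f : 'rV[R]_d -> R) :=
  let supp := closure [set x | f x != 0] in
  [/\ forall k, Ck k f, compact supp & supp `<=` Omega].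

End geometry.

Section fractional_sobolev.
Context (R : realType) (d : nat) (s : R).
Local Notation leb := (@lebesgue_rV R d).

Definition gamma_fun (z : R) : R :=
  \int[lebesgue_measure]_(t in `]0, +oo[) (t `^ (z - 1) * expR (- t)).

Definition cds : R :=
  2 `^ (2 * s) * s * gamma_fun (s + d%:R / 2) /
  (pi `^ (d%:R / 2) * gamma_fun (1 - s)).

(* On the diagonal this is [0^-1 = 0]. *)
Definition frac_kernel (x y : 'rV[R]_d) : R :=
  (enorm (x - y) `^ (d%:R + 2 * s))^-1.

Definition Hs_norm (u : 'rV[R]_d -> R) : \bar R :=
  (((\int[leb]_x (u x ^+ 2)%:E) +
    \int[leb \x leb]_z
      ((u z.1 - u z.2) ^+ 2 * frac_kernel z.1 z.2)%:E) `^ 2^-1)%E.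

Definition Hs (u : 'rV[R]_d -> R) :=
  u \in Lfun leb 2%:E /\ (Hs_norm u < +oo)%E.

Definition tildeHs (Omega : set 'rV[R]_d) (u : 'rV[R]_d -> R) :=
  Hs u /\
  forall e : R, 0 < e ->
    exists2 f, test_function Omega f & (Hs_norm (u \- f)%R < e%:E)%E.

Definition calA (u v : 'rV[R]_d -> R) : R :=
  cds / 2 * \int[(leb \x leb)%E]_z
    ((u z.1 - u z.2) * (v z.1 - v z.2) * frac_kernel z.1 z.2).

End fractional_sobolev.

(* Functions on Omega are represented by functions on R^d whose values outside
   Omega are irrelevant. *)
Section Lp_domain.
Context (R : realType) (d : nat) (Omega : set 'rV[R]_d).
Local Notation leb := (@lebesgue_rV R d).
Local Notation lebT := (caratheodory_type (borel_lebesgue R d)^*%mu).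

Definition aeO (P : 'rV[R]_d -> Prop) := {ae leb, forall x, Omega x -> P x}.

Definition LpO (p : \bar R) (f : 'rV[R]_d -> R) := f \_ Omega \in Lfun leb p.

Definition LpO_norm (p : \bar R) (f : 'rV[R]_d -> R) : R :=
  fine ('N[leb]_p[EFin \o f \_ Omega])%E.

Definition intO (f : 'rV[R]_d -> R) : R := \int[leb]_(x in Omega) f x.

Definition caratheodory (f : 'rV[R]_d -> R -> R) :=
  (forall u, measurable_fun (Omega : set lebT) (f ^~ u)) /\
  aeO (fun x => continuous (f x)).

End Lp_domain.

Section control_problem.
Context (R : realType) (d : nat) (Omega : set 'rV[R]_d) (s r : R).
Local Notation leb := (@lebesgue_rV R d).
Implicit Types (a L : 'rV[R]_d -> R -> R) (u v q w p phi zeta : 'rV[R]_d -> R).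

Definition C2 (f : R -> R) :=
  [/\ forall t, derivable f t 1, forall t, derivable (derive1 f) t 1 &
      continuous (derive1n 2 f)].

Definition assumption_A1 a :=
  [/\ caratheodory Omega a, aeO Omega (fun x => C2 (a x)),
      LpO Omega 2%:E (a ^~ 0) & LpO Omega r%:E (a ^~ 0)].

Definition assumption_A2 a :=
  aeO Omega (fun x => forall u : R, 0 <= derive1 (a x) u).

Definition assumption_A3 a :=
  forall m : R, 0 < m -> exists2 C : R, 0 < C &
    aeO Omega (fun x =>
      (forall t : R, `|t| <= m -> `|derive1 (a x) t| + `|derive1n 2 (a x) t| <= C) /\
      (forall t t' : R, `|t| <= m -> `|t'| <= m ->
        `|derive1n 2 (a x) t - derive1n 2 (a x) t'| <= C * `|t - t'|)).

Definition assumption_B1 L :=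
  [/\ caratheodory Omega L, aeO Omega (fun x => C2 (L x)) &
      LpO Omega 1%:E (L ^~ 0)].

Definition assumption_B2 L :=
  forall m : R, 0 < m -> exists psi phi : 'rV[R]_d -> R,
    [/\ LpO Omega r%:E psi, LpO Omega r%:E phi &
        aeO Omega (fun x => forall t : R, `|t| <= m ->
          `|derive1 (L x) t| <= psi x /\ `|derive1n 2 (L x) t| <= phi x)].

(* [is_state a q u] says that u = S q, the solution operator being used through
   its graph. *)
Definition is_state a q u :=
  [/\ tildeHs s Omega u, LpO Omega +oo u &
      forall v, tildeHs s Omega v ->
        calA s u v + intO Omega (fun x => a x (u x) * v x) =
        intO Omega (fun x => q x * v x)].

Definition is_adjoint_state a L u p :=
  [/\ tildeHs s Omega p, LpO Omega +oo p &
      forall v, tildeHs s Omega v ->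
        calA s v p + intO Omega (fun x => derive1 (a x) (u x) * p x * v x) =
        intO Omega (fun x => derive1 (L x) (u x) * v x)].

(* [is_linearized_state a u w phi] says that phi = phi_w. *)
Definition is_linearized_state a u w phi :=
  tildeHs s Omega phi /\
  forall v, tildeHs s Omega v ->
    calA s phi v + intO Omega (fun x => derive1 (a x) (u x) * phi x * v x) =
    intO Omega (fun x => w x * v x).

Section cost.
Context (lambda mu alpha beta : R).

Definition cost L u q : R :=
  intO Omega (fun x => L x (u x)) + lambda / 2 * LpO_norm Omega 2%:E q ^+ 2 +
  mu * LpO_norm Omega 1%:E q.

Definition Qad q :=
  LpO Omega 2%:E q /\ aeO Omega (fun x => alpha <= q x <= beta).

(* [qbar], with state [ubar], is a local minimum of q |-> J(S q, q) on Q_ad. *)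
Definition local_minimum a L qbar ubar :=
  [/\ Qad qbar, is_state a qbar ubar &
      exists2 eps : R, 0 < eps &
        forall q u, Qad q -> is_state a q u ->
          LpO_norm Omega 2%:E (q \- qbar) <= eps -> cost L ubar qbar <= cost L u q].

Definition subdiff_j q zeta :=
  LpO Omega +oo zeta /\
  aeO Omega (fun x => [/\ 0 < q x -> zeta x = 1, q x < 0 -> zeta x = -1 &
                          q x = 0 -> -1 <= zeta x <= 1]).

Definition dj q w : R :=
  \int[leb]_(x in Omega `&` [set x | 0 < q x]) w x -
  \int[leb]_(x in Omega `&` [set x | q x < 0]) w x +
  \int[leb]_(x in Omega `&` [set x | q x = 0]) `|w x|.

Definition dF p q w : R := intO Omega (fun x => (p x + lambda * q x) * w x).

(* F''(q) w^2, for u, p and phi the state, adjoint state and linearized state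
   associated with q and w. *)
Definition d2F a L u p w phi : R :=
  intO Omega (fun x =>
    derive1n 2 (L x) (u x) * phi x ^+ 2 + lambda * w x ^+ 2 -
    p x * derive1n 2 (a x) (u x) * phi x ^+ 2).

Definition sign_conditions q w :=
  aeO Omega (fun x => (q x = alpha -> 0 <= w x) /\ (q x = beta -> w x <= 0)).

Definition critical_cone p q w :=
  [/\ LpO Omega 2%:E w, sign_conditions q w & dF p q w + mu * dj q w = 0].

Definition critical_cone_tau (tau : R) p q w :=
  [/\ LpO Omega 2%:E w, sign_conditions q w &
      dF p q w + mu * dj q w <= tau * LpO_norm Omega 2%:E w].

End cost.

End control_problem.

(* Main.v *)
Require Import Defs.
From HB Require Import structures.
From mathcomp Require Import all_boot all_order all_algebra.
From mathcomp Require Import all_classical all_reals all_analysis.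
From mathcomp Require Import measurable_realfun ess_sup_inf exponential_distribution.
From mathcomp Require Import ring lra.

(** The second variation is the form [lam * n(w) + b(phi)] of the pairs
    (control w, linearized state phi), where n is the squared L^2 norm and |b|
    is bounded by a weighted square N(phi) = \int G phi^2 with G in L^r.  If (ii)
    fails there are x_k in the sign cone with n(x_k) = 1, first variation
    j(x_k) -> 0 and lam + b(x_k) -> 0.  Two facts about N suffice to contradict
    (i): N <= c n, and a sequence bounded in n has an N-Cauchy subsequence.
    Instead of a weak limit, take elements of almost minimal n in the decreasing
    convex sets of those x in the cone with n(x) <= 1, j(x) <= 1/m and x close to
    x_1, ..., x_m for N: by the parallelogram law they form an n-Cauchy sequence.
    Its limit x satisfies j(x) = 0, n(x) <= 1 and N(x - x_k) -> 0, hence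
    lam * n(x) + b(x) <= 0; so n(x) = 0 by (i), hence b(x_k) -> 0 and lam <= 0.

    The compactness for N needs neither Rellich nor Sobolev embeddings.  Let P_k be
    the averaging operator over the dyadic cells of side 2^-k.  Jensen's
    inequality gives |u - P_k u|_2^2 <= C 2^(-2sk) [u]^2, and since P_(k+1) u - P_k u
    is constant on cells, its weighted square is at most
    sup (P_(k+1) G) <= C 2^(kd/r) times its squared L^2 norm.  As 2s > d/r, the
    weighted distance from u to P_k u decays geometrically, and on a bounded set
    P_k u lives in a finite-dimensional space.

    The first variation is nonnegative on the cone because the variational
    inequality forces qbar = alpha where pbar + lambda qbar + mu etabar > 0 and
    qbar = beta where it is < 0. *)

Set Implicit Arguments.
Unset Strict Implicit.
Unset Printing Implicit Defensive.
Import Order.TTheory GRing.Theory Num.Theory.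
Import numFieldNormedType.Exports.

Local Open Scope classical_set_scope.
Local Open Scope ring_scope.

(** * Uniform positivity of quadratic forms on convex cones *)

(** A linearized state is known only through its equation, so the argument runs on pairs (w, phi)
    and a limit is constructed for both components. Testing the equation with phi gives an energy
    estimate that turns Cauchy sequences of controls into Cauchy sequences of states. The weight G
    is the bound on the second derivative of L plus a constant bounding pbar times the second
    derivative of a. Its first part lies merely in L^r, so N is not controlled by the L^2 norm of
    phi alone. By a Hölder type bound the average of G over a cell of volume v is of order v^(-1/r),
    which is the growth that the fractional seminorm has to beat. Square roots and limits are mostly
    avoided: the triangle and Cauchy-Schwarz inequalities appear as Young inequalities with a free
    parameter e, and limits as bounds valid for every e > 0. Coercivity rests on C(d, s) > 0. As a
    real integral takes the value 0 when it is infinite, positivity of the Gamma factors includes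
    the convergence of Euler's integral. *)

Lemma le_eps_mul (R : realType) (x c : R) :
  (forall e, 0 < e -> x <= c * e) -> x <= 0.
Proof.
move=> H; rewrite leNgt; apply/negP => x0.
have [c0|c0] := leP c 0.
  by have := H 1 ltr01; rewrite mulr1; lra.
have := H (x / (2 * c)) _; rewrite divr_gt0 ?mulr_gt0// => /(_ isT).
have -> : c * (x / (2 * c)) = x / 2 by field; rewrite gt_eqF.
lra.
Qed.

Lemma geometric_small (R : realType) (q e : R) : 0 <= q < 1 -> 0 < e ->
  exists k, q ^+ k < e.
Proof.
move=> /andP[q0 q1] e0.
have H := @cvg_expr R q _; rewrite ger0_norm// in H.
have /H/cvgr0Pnorm_lt/(_ e e0)[k _ /(_ k (leqnn _))] := q1.
by rewrite /= ger0_norm ?exprn_ge0//; exists k.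
Qed.

Lemma exp_half_small (R : realType) (e : R) : 0 < e ->
  exists k, (2^-1 : R) ^+ k < e.
Proof. by apply: geometric_small; rewrite invr_ge0 ler0n/=; lra. Qed.

Lemma invS_small (R : realType) (e : R) : 0 < e -> exists k : nat, (k.+1%:R : R)^-1 < e.
Proof.
move=> e0.
by have [k _ /(_ k (leqnn _))] := near_infty_natSinv_lt (PosNum e0); exists k.
Qed.

(** [S] becomes the space of pairs (control, state) solving the linearized equation, [C] the convex
    cone of those pairs whose control satisfies the sign conditions. [n] and [N] are squares of
    seminorms and enter only through homogeneity and parallelogram or Young inequalities. In
    [j_cont] the free [e] encodes Lipschitz continuity for the square root of [n], the infimum of e
    + n / e being twice that root. In [n_complete], the bound 4^-i on squares means distances
    2^-i. *)
Section strict_positivity_is_uniform.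
Context (R : realType) (X : lmodType R) (S C : set X) (n N b j : X -> R).
Context (lam c1 c2 : R).
Hypothesis lam0 : 0 < lam.
Hypothesis SB : forall x y, S x -> S y -> S (x - y).
Hypothesis CS : C `<=` S.
Hypothesis CD : forall x y, C x -> C y -> C (x + y).
Hypothesis CZ : forall c x, 0 <= c -> C x -> C (c *: x).
Hypothesis n_ge0 : forall x, 0 <= n x.
Hypothesis nZ : forall c x, S x -> n (c *: x) = c ^+ 2 * n x.
Hypothesis n_para : forall x y, S x -> S y ->
  n (x - y) + n (x + y) <= 2 * n x + 2 * n y.
Hypothesis n_young : forall e x y, 0 < e -> S x -> S y ->
  n (x + y) <= (1 + e) * n x + (1 + e^-1) * n y.
Hypothesis N_ge0 : forall x, 0 <= N x.
Hypothesis NZ : forall c x, S x -> N (c *: x) = c ^+ 2 * N x.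
Hypothesis N_young : forall x y, S x -> S y -> N (x + y) <= 2 * N x + 2 * N y.
Hypothesis N_le : forall x, S x -> N x <= c1 * n x.
Hypothesis bZ : forall c x, S x -> b (c *: x) = c ^+ 2 * b x.
Hypothesis b_cont : forall e x y, 0 < e -> S x -> S y ->
  `|b x - b y| <= e * (N x + N y) + e^-1 * N (x - y).
Hypothesis jZ : forall c x, 0 <= c -> S x -> j (c *: x) = c * j x.
Hypothesis jD : forall x y, S x -> S y -> j (x + y) <= j x + j y.
Hypothesis j_cont : forall e x y, 0 < e -> S x -> S y ->
  j x - j y <= c2 * (e + e^-1 * n (x - y)).
Hypothesis j_ge0 : forall x, C x -> 0 <= j x.
Hypothesis n_complete : forall x_ : nat -> X, (forall i, C (x_ i)) ->
  (forall i, n (x_ i - x_ i.+1) <= 4^-1 ^+ i) ->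
  exists2 x, C x & forall e, 0 < e -> exists k, forall i, (k <= i)%N -> n (x_ i - x) <= e.
Hypothesis N_compact : forall x_ : nat -> X, (forall i, S (x_ i)) ->
  (forall i, n (x_ i) <= 1) ->
  exists2 f : nat -> nat, (forall i, (i <= f i)%N) &
    forall i k, (i <= k)%N -> N (x_ (f k) - x_ (f i)) <= 2^-1 ^+ i.

Let NC x y : S x -> S y -> N (x - y) = N (y - x).
Proof.
by move=> Sx Sy; rewrite -opprB -(scaleN1r (y - x)) NZ ?sqrrN ?expr1n ?mul1r//; exact: SB.
Qed.

Let nC x y : S x -> S y -> n (x - y) = n (y - x).
Proof.
by move=> Sx Sy; rewrite -opprB -(scaleN1r (y - x)) nZ ?sqrrN ?expr1n ?mul1r//; exact: SB.
Qed.

Let b_le x : S x -> `|b x| <= 2 * N x.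
Proof.
move=> Sx.
have S0 : S 0 by rewrite -(subrr x); exact: SB.
have b0 : b 0 = 0 by rewrite -(scale0r x) bZ// expr0n/= mul0r.
have N0 : N 0 = 0 by rewrite -(scale0r x) NZ// expr0n/= mul0r.
have := b_cont ltr01 Sx S0; rewrite b0 !subr0 N0 addr0 invr1 !mul1r.
by rewrite mulr_natl mulr2n.
Qed.

Let half_le (v : X -> R) x y :
  (forall x, S x -> v (2^-1 *: x) = 2^-1 ^+ 2 * v x) ->
  (v (x + y) <= 2 * v x + 2 * v y) ->
  S (x + y) -> v (2^-1 *: (x + y)) <= (v x + v y) / 2.
Proof. by move=> vZ vD Sxy; rewrite vZ// expr2; lra. Qed.

Let SD x y : S x -> S y -> S (x + y).
Proof.
move=> Sx Sy; have S0 : S 0 by rewrite -(subrr x); exact: SB.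
by rewrite -[y]opprK -(sub0r y); apply: SB => //; exact: SB.
Qed.

Let D (x_ : nat -> X) m := [set x | [/\ C x, j x <= m.+1%:R^-1, n x <= 1 &
  forall l, (l <= m)%N -> N (x - x_ l) <= 2^-1 ^+ l]].

(** The parallelogram argument uses convexity at midpoints only. For [n] and [N] it combines the
    factor 2 of the Young inequality with the factor 1/4 of homogeneity. *)
Let D_mid x_ m x y : (forall l, S (x_ l)) -> D x_ m x -> D x_ m y ->
  D x_ m (2^-1 *: (x + y)).
Proof.
move=> Sx_ [Cx jx nx Nx] [Cy jy ny Ny].
have Sx := CS Cx; have Sy := CS Cy; have Sxy := SD Sx Sy.
split.
- by apply: CZ => //; exact: CD.
- rewrite jZ ?invr_ge0//; move: (jD Sx Sy) jx jy.
  by move: (m.+1%:R^-1) => q; lra.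
- have h : n (x + y) <= 2 * n x + 2 * n y.
    by have := n_young ltr01 Sx Sy; rewrite invr1; lra.
  have := half_le (fun x => @nZ _ x) h Sxy; lra.
- move=> l lm.
  have := Nx _ lm; have := Ny _ lm.
  have Sxl := SB Sx (Sx_ l); have Syl := SB Sy (Sx_ l).
  have := half_le (fun x => @NZ _ x) (N_young Sxl Syl) (SD Sxl Syl).
  have -> : 2^-1 *: (x - x_ l + (y - x_ l)) = 2^-1 *: (x + y) - x_ l.
    rewrite addrACA -opprD scalerDr scalerN; congr (_ - _).
    by rewrite -mulr2n -(scaler_nat 2 (x_ l)) scalerA mulVf ?scale1r.
  lra.
Qed.

Let D_le x_ m k : (m <= k)%N -> D x_ k `<=` D x_ m.
Proof.
move=> mk x [Cx jx nx Nx]; split => //.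
- by rewrite (le_trans jx)// lef_pV2 ?posrE// ler_nat.
- by move=> l lm; apply: Nx; rewrite (leq_trans lm).
Qed.

(* The elements of almost minimal [n] of the decreasing convex sets [D m] form a
   Cauchy sequence by the parallelogram law; it replaces a weak limit. *)
Let D_cauchy x_ : (forall l, S (x_ l)) -> (forall m, D x_ m !=set0) ->
  exists2 v_ : nat -> X, (forall m, D x_ m (v_ m)) &
    forall i, n (v_ i - v_ i.+1) <= 4^-1 ^+ i.
Proof.
move=> Sx_ D0.
pose io m := inf (n @` D x_ m).
have infD m : has_inf (n @` D x_ m).
  split; first by have [x Dx] := D0 m; exists (n x), x.
  by exists 0 => _ [x _ <-].
have io_le1 m : io m <= 1.
  have [x Dx] := D0 m; apply: (@le_trans _ _ (n x)); last by case: Dx.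
  by apply: inf_lbound; [case: (infD m)|exists x].
have io_mono m k : (m <= k)%N -> io m <= io k.
  move=> mk; apply: lb_le_inf; first by case: (infD k).
  move=> _ [x Dx <-]; apply: inf_lbound; first by case: (infD m).
  by exists x => //; exact: D_le Dx.
have sup_io : has_sup (range io).
  by split; [exists (io 0%N), 0%N|exists 1 => _ [m _ <-]].
(* The infima [io m] increase and stay below 1, hence approach their supremum. Once [io (m_ i)] is
   within [eps i] of it, the parallelogram law bounds [n (v i - v i.+1)] by 6 times [eps i], and 8
   times [eps i] is 4^-i. *)
pose eps k : R := 4^-1 ^+ k / 8.
have eps0 k : 0 < eps k by rewrite divr_gt0// exprn_gt0.
have /choice[f Hf] : forall k, exists m, sup (range io) - eps k < io m.
  by move=> k; have [_ [m _ <-] ?] := sup_adherent (eps0 k) sup_io; exists m.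
(* The sum makes [m_] nondecreasing and at least [f k]; the added [k] makes it at least [k], so that
   [v k] lies in [D x_ k]. *)
pose m_ k := (\sum_(i < k.+1) f i + k)%N.
have m_mono k : (m_ k <= m_ k.+1)%N.
  by rewrite /m_ (big_ord_recr k.+1)/= leq_add// leq_addr.
have Hm k : sup (range io) - eps k < io (m_ k).
  apply: (lt_le_trans (Hf k)); apply: io_mono.
  by rewrite /m_ big_ord_recr/= addnAC leq_addl.
have /choice[v Hv] : forall k, exists v, D x_ (m_ k) v /\ n v < io (m_ k) + eps k.
  by move=> k; have [_ [x Dx <-] ?] := inf_adherent (eps0 k) (infD (m_ k)); exists x.
exists v => [k|i].
  by apply: D_le (proj1 (Hv k)); rewrite /m_ leq_addl.
have [Dv nv] := Hv i; have [Dv' nv'] := Hv i.+1.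
have Dv2 := D_le (m_mono i) Dv'.
have io_sup k : io k <= sup (range io) by apply: ub_le_sup; [case: sup_io|exists k].
have mid : io (m_ i) <= n (2^-1 *: (v i + v i.+1)).
  by apply: inf_lbound; [case: (infD (m_ i))|exists (2^-1 *: (v i + v i.+1)) => //; exact: D_mid].
have Sv : S (v i) by case: Dv => /CS.
have Sv' : S (v i.+1) by case: Dv' => /CS.
have := n_para Sv Sv'; move: mid; rewrite nZ ?expr2; last exact: SD.
have := Hm i; have := io_sup (m_ i); have := io_sup (m_ i.+1).
have : eps i.+1 <= eps i.
  rewrite /eps ler_pM2r ?invr_gt0// exprS ler_piMl ?exprn_ge0 ?invr_ge0//; lra.
have -> : 4^-1 ^+ i = 8 * eps i :> R by rewrite /eps mulrC divfK.
move: nv nv'; lra.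
Qed.

Lemma strict_positivity_is_uniform :
  (forall x, C x -> j x = 0 -> n x <> 0 -> 0 < lam * n x + b x) ->
  exists tau delta : R, [/\ 0 < tau, 0 < delta &
    forall x, C x -> j x <= tau * Num.sqrt (n x) -> delta * n x <= lam * n x + b x].
Proof.
move=> pos; apply: contrapT => nunif.
have /choice[y Hy] : forall k : nat, exists y, [/\ C y,
    j y <= k.+1%:R^-1 * Num.sqrt (n y) & lam * n y + b y < k.+1%:R^-1 * n y].
  move=> k; apply: contrapT => ny; apply: nunif.
  exists (k.+1%:R^-1), (k.+1%:R^-1); split; rewrite ?invr_gt0//.
  by move=> x Cx jx; rewrite leNgt; apply/negP => lt; apply: ny; exists x.
(* If [n] vanished at [y k], so would [N] and then [b], and the strict inequality would read 0 <
   0. *)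
have ny0 k : 0 < n (y k).
  have [Cy jy by_] := Hy k; rewrite lt_neqAle n_ge0 andbT eq_sym.
  apply/eqP => n0; have := N_le (CS Cy); have := b_le (CS Cy).
  rewrite n0 mulr0 => by0 N0.
  have Ny0 : N (y k) = 0 by apply/eqP; rewrite eq_le N0 N_ge0.
  by move: by_ by0; rewrite n0 Ny0 !mulr0 normr_le0 add0r => by_ /eqP b0; move: by_; rewrite b0 ltxx.
pose z k := (Num.sqrt (n (y k)))^-1 *: y k.
have Cy k : C (y k) by have [] := Hy k.
have Cz k : C (z k) by apply: CZ => //; rewrite invr_ge0 sqrtr_ge0.
have Sz k : S (z k) by exact: CS.
have sq k : (Num.sqrt (n (y k)))^-1 ^+ 2 = (n (y k))^-1.
  by rewrite exprVn sqr_sqrtr// ltW.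
have nz1 k : n (z k) <= 1.
  by rewrite nZ ?sq ?mulVf// ?gt_eqF//; exact: CS.
have nz k : n (z k) = 1 by rewrite nZ ?sq ?mulVf// ?gt_eqF//; exact: CS.
have jz k : j (z k) <= k.+1%:R^-1.
  rewrite jZ ?invr_ge0 ?sqrtr_ge0//; last exact: CS.
  by rewrite mulrC ler_pdivrMr ?sqrtr_gt0//; have [] := Hy k.
have bz k : lam + b (z k) < k.+1%:R^-1.
  have [_ _] := Hy k; rewrite bZ ?sq; last exact: CS.
  by rewrite -ltr_pdivrMr// mulrDl mulfK ?gt_eqF// (mulrC (b _)).
have [f fge Nf] := N_compact Sz nz1.
pose x_ k := z (f k).
have inv_le k : (f k).+1%:R^-1 <= k.+1%:R^-1 :> R.
  by rewrite lef_pV2 ?posrE// ler_nat ltnS.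
(* Every [D x_ m] is nonempty: [N_compact] places [x_ m] near all earlier [x_ l] at once, and
   [i <= f i] keeps [j] small. *)
have Dx_ m : D x_ m (x_ m).
  split; [exact: Cz|exact: le_trans (jz _) (inv_le _)|by rewrite nz|].
  by move=> l lm; exact: Nf.
have [v Dv vcau] := D_cauchy (fun l => Sz (f l)) (fun m => ex_intro _ _ (Dx_ m)).
have Cv i : C (v i) by case: (Dv i).
have Sv i : S (v i) by exact: CS.
have [x Cx vx] := n_complete Cv vcau.
have Sx := CS Cx.
have c2_small e : 0 < e -> forall i, n (v i - x) <= e ^+ 2 -> j x - j (v i) <= `|c2| * (2 * e).
  move=> e0 i ve; apply: (le_trans (j_cont e0 Sx (Sv i))).
  rewrite nC//; apply: (@le_trans _ _ (`|c2| * (e + e^-1 * n (v i - x)))).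
    rewrite ler_wpM2r ?ler_norm// addr_ge0 ?(ltW e0)//.
    by rewrite mulr_ge0// ?invr_ge0 ?(ltW e0).
  by rewrite ler_wpM2l// mulr_natl mulr2n lerD2l ler_pdivrMl//.
have jx0 : j x = 0.
  apply/eqP; rewrite eq_le j_ge0// andbT.
  apply: (@le_eps_mul _ _ (1 + `|c2| * 2)) => e e0.
  have [k Hk] := vx (e ^+ 2) (exprn_gt0 _ e0).
  have [m Hm] := invS_small e0.
  have := c2_small _ e0 _ (Hk _ (leq_addr m k)).
  have [_ jv _ _] := Dv (k + m)%N.
  have : ((k + m).+1%:R)^-1 <= m.+1%:R^-1 :> R.
    by rewrite lef_pV2 ?posrE// ler_nat ltnS leq_addl.
  move: jv Hm; move: ((k + m).+1%:R^-1) (m.+1%:R^-1) => p q; lra.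
have nx1 : n x <= 1.
  rewrite -subr_le0; apply: (@le_eps_mul _ _ 3) => e e0.
  (* Below 1 the square of [e'] is at most [e'], so the Young inequality yields at most 1 + 3
     [e']. *)
  pose e' := Num.min e 1.
  have e'0 : 0 < e' by rewrite lt_min e0 ltr01.
  have e'1 : e' <= 1 by rewrite ge_min lexx orbT.
  have e'e : e' <= e by rewrite ge_min lexx.
  have [k Hk] := vx (e' ^+ 2) (exprn_gt0 _ e'0).
  have nvk := Hk k (leqnn _).
  have := n_young e'0 (Sv k) (SB Sx (Sv k)); rewrite subrKC nC// => nyk.
  have [_ _ nv1 _] := Dv k.
  have h : (1 + e'^-1) * n (v k - x) <= e' ^+ 2 + e'.
    apply: (@le_trans _ _ ((1 + e'^-1) * e' ^+ 2)).
      by rewrite ler_wpM2l// addr_ge0// invr_ge0 ltW.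
    by rewrite mulrDl mul1r expr2 mulKf ?gt_eqF.
  have h2 : (1 + e') * n (v k) <= 1 + e'.
    by rewrite -[leRHS]mulr1 ler_wpM2l// addr_ge0// ltW.
  have h3 : e' ^+ 2 <= e' by rewrite expr2 ler_piMl// ltW.
  lra.
(* Compare through [v (k + l)], which satisfies the constraint of index [l] and tends to [x] for
   [n], hence for [N]. The factor 2 comes from [N_young]. *)
have Nxl l : N (x - x_ l) <= 2 * 2^-1 ^+ l.
  rewrite -subr_le0; apply: (@le_eps_mul _ _ (2 * `|c1|)) => e e0.
  have [k Hk] := vx e e0.
  have nvk := Hk (k + l)%N (leq_addr _ _).
  have [_ _ _ /(_ l (leq_addl _ _)) Nv] := Dv (k + l)%N.
  have := N_young (SB Sx (Sv (k + l)%N)) (SB (Sv (k + l)%N) (Sz (f l))).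
  rewrite addrA subrK (NC Sx)// -/(x_ l) => Nt.
  have Nn := N_le (SB (Sv (k + l)%N) Sx).
  have : c1 * n (v (k + l)%N - x) <= `|c1| * e.
    apply: (@le_trans _ _ (`|c1| * n (v (k + l)%N - x))).
      by rewrite ler_wpM2r// ler_norm.
    by rewrite ler_wpM2l.
  lra.
have c1_ge0 : 0 <= c1.
  by have := le_trans (N_ge0 _) (N_le (Sz 0%N)); rewrite nz mulr1.
have c1N u : S u -> n u <= 1 -> N u <= c1.
  move=> Su nu; apply: (le_trans (N_le Su)).
  by rewrite -[leRHS]mulr1 ler_wpM2l.
have Qx0 : lam * n x + b x <= 0.
  (* The three terms are [lam + b (x_ l)], then e times two values of [N] that are each at most
     [c1], then [N (x - x_ l)] divided by e. Because of this division 2^-l is taken below e^2. *)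
  apply: (@le_eps_mul _ _ (1 + 2 * c1 + 2)) => e e0.
  have [l1 Hl1] := invS_small e0.
  have [l2 Hl2] := exp_half_small (exprn_gt0 2 e0).
  pose l := (l1 + l2)%N.
  have hl1 : l.+1%:R^-1 <= l1.+1%:R^-1 :> R.
    by rewrite lef_pV2 ?posrE// ler_nat ltnS leq_addr.
  have hl2 : 2^-1 ^+ l <= 2^-1 ^+ l2 :> R.
    rewrite /l exprD ler_piMl ?exprn_ge0 ?invr_ge0// exprn_ile1 ?invr_ge0//; lra.
  have bxl := bz (f l); have := inv_le l.
  have := le_trans (ler_norm _) (b_cont e0 Sx (Sz (f l))).
  rewrite -/(x_ l) => hb.
  have h1 : e * (N x + N (x_ l)) <= e * (2 * c1).
    rewrite ler_wpM2l ?(ltW e0)//.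
    have := c1N _ Sx nx1; have := c1N _ (Sz (f l)) (nz1 _); rewrite -/(x_ l); lra.
  have h2 : e^-1 * N (x - x_ l) <= 2 * e.
    rewrite ler_pdivrMl// mulrCA -expr2; apply: (le_trans (Nxl l)).
    by rewrite ler_wpM2l// (le_trans hl2)// ltW.
  have : lam * n x <= lam * 1 by rewrite ler_wpM2l// ltW.
  move: bxl hl1 Hl1; rewrite -/(x_ l).
  move: ((f l).+1%:R^-1) (l.+1%:R^-1) (l1.+1%:R^-1) => p q t; lra.
have nx0 : n x = 0.
  by apply: contrapT => /(pos _ Cx jx0); rewrite ltNge Qx0.
have Nx0 : N x = 0.
  by apply/eqP; rewrite eq_le N_ge0 andbT; have := N_le Sx; rewrite nx0 mulr0.
suff : lam <= 0 by rewrite leNgt lam0.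
(* As [N x] is 0, [N (x_ l)] is at most 4 times 2^-l, and [b_le] doubles this to 8 times 2^-l. *)
apply: (@le_eps_mul _ _ (1 + 8)) => e e0.
have [l1 Hl1] := invS_small e0.
have [l2 Hl2] := exp_half_small e0.
pose l := (l1 + l2)%N.
have hl1 : l.+1%:R^-1 <= l1.+1%:R^-1 :> R.
  by rewrite lef_pV2 ?posrE// ler_nat ltnS leq_addr.
have hl2 : 2^-1 ^+ l <= 2^-1 ^+ l2 :> R.
  rewrite /l exprD ler_piMl ?exprn_ge0 ?invr_ge0// exprn_ile1 ?invr_ge0//; lra.
have := bz (f l); have := inv_le l; have := b_le (Sz (f l)).
rewrite ler_norml => /andP[+ _].
have := N_young Sx (SB (Sz (f l)) Sx); rewrite subrKC Nx0 NC//.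
have := Nxl l; move: hl1 Hl1; rewrite -/(x_ l).
move: ((f l).+1%:R^-1) (l.+1%:R^-1) (l1.+1%:R^-1) => p q t; lra.
Qed.

End strict_positivity_is_uniform.

(** * Weighted square integrals *)

(** One notion serves four times: weight 1 for the squared L^2 norm, the kernel on the product space
    for the Gagliardo seminorm, [A] for the zero order term and [G] for the second variation. Values
    are extended reals, so inequalities can be stated before finiteness is known. *)
Definition wsq d (T : measurableType d) (R : realType)
    (mu : {measure set T -> \bar R}) (D : set T) (W f : T -> R) : \bar R :=
  (\int[mu]_(x in D) (f x ^+ 2 * W x)%:E)%E.

Lemma young_sqr (R : realFieldType) (e x y : R) : 0 < e ->
  (x + y) ^+ 2 <= (1 + e) * x ^+ 2 + (1 + e^-1) * y ^+ 2.
Proof.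
move=> e0; rewrite -subr_ge0.
have -> : (1 + e) * x ^+ 2 + (1 + e^-1) * y ^+ 2 - (x + y) ^+ 2 =
  e^-1 * (e * x - y) ^+ 2 by field; rewrite gt_eqF.
by rewrite mulr_ge0 ?invr_ge0 ?sqr_ge0// ltW.
Qed.

Lemma young_mul (R : realFieldType) (e x y : R) : 0 < e ->
  `|x * y| <= (e * x ^+ 2 + e^-1 * y ^+ 2) / 2.
Proof.
move=> e0; have ie0 : 0 < e^-1 by rewrite invr_gt0.
have e1 : e * e^-1 = 1 by rewrite divff ?gt_eqF.
have H1 : 0 <= e^-1 * (e * x - y) ^+ 2 by rewrite mulr_ge0 ?sqr_ge0// ltW.
have H2 : 0 <= e^-1 * (e * x + y) ^+ 2 by rewrite mulr_ge0 ?sqr_ge0// ltW.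
have E1 : e^-1 * (e * x - y) ^+ 2 = e * x ^+ 2 - 2 * (x * y) + e^-1 * y ^+ 2.
  by field; rewrite gt_eqF.
have E2 : e^-1 * (e * x + y) ^+ 2 = e * x ^+ 2 + 2 * (x * y) + e^-1 * y ^+ 2.
  by field; rewrite gt_eqF.
rewrite ler_norml; apply/andP; split; lra.
Qed.

Section integral_le_of_cvg.
Context d (T : measurableType d) (R : realType) (mu : {measure set T -> \bar R}).
Local Open Scope ereal_scope.

Lemma fatou_le (D : set T) (f_ : (T -> \bar R)^nat) (f : T -> \bar R) (c : \bar R) k :
  measurable D -> (forall i, measurable_fun D (f_ i)) ->
  (forall i x, D x -> 0 <= f_ i x) ->
  (forall x, D x -> f_ ^~ x @ \oo --> f x) ->
  (forall i, (k <= i)%N -> \int[mu]_(x in D) f_ i x <= c) ->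
  \int[mu]_(x in D) f x <= c.
Proof.
move=> mD mf f0 ff fc.
have -> : \int[mu]_(x in D) f x = \int[mu]_(x in D) limn_einf (f_ ^~ x).
  apply: eq_integral => x /set_mem Dx.
  by rewrite is_cvg_limn_einfE; [apply/esym/cvg_lim => //; exact: ff|apply/cvg_ex; exists (f x); exact: ff].
apply: (le_trans (fatou mu mD mf f0)).
rewrite limn_einf_lim lime_le//; first exact: is_cvg_einfs.
near=> n.
have kn : (k <= n)%N by near: n; exists k.
apply: (le_trans _ (fc n kn)).
rewrite /einfs/=; apply: ereal_inf_lbound; exists n => //=.
Unshelve. all: by end_near.
Qed.

End integral_le_of_cvg.

Section weighted_square.
Context d (T : measurableType d) (R : realType) (mu : {measure set T -> \bar R}).
Context (D : set T) (mD : measurable D) (W : T -> R).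
Hypothesis mW : measurable_fun D W.
Hypothesis W0 : forall x, D x -> 0 <= W x.
Implicit Types f g : T -> R.
Local Notation q := (wsq mu D W).

Lemma measurable_wsq f : measurable_fun D f ->
  measurable_fun D (fun x => (f x ^+ 2 * W x)%:E).
Proof.
move=> mf; apply/measurable_EFinP/measurable_funM => //.
exact: measurable_funX.
Qed.

Lemma wsq_integrand_ge0 f x : D x -> (0 <= (f x ^+ 2 * W x)%:E)%E.
Proof. by move=> Dx; rewrite lee_fin mulr_ge0 ?sqr_ge0 ?W0. Qed.

Lemma wsq_ge0 f : (0 <= q f)%E.
Proof. by apply: integral_ge0 => x; exact: wsq_integrand_ge0. Qed.

Lemma wsqZ c f : measurable_fun D f -> q (fun x => c * f x) = ((c ^+ 2)%:E * q f)%E.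
Proof.
move=> mf; rewrite /wsq -ge0_integralZl_EFin ?sqr_ge0//.
- by apply: eq_integral => x _; rewrite -EFinM exprMn -mulrA.
- by move=> x; exact: wsq_integrand_ge0.
- exact: measurable_wsq.
Qed.

Lemma wsq_young (e : R) f g : 0 < e -> measurable_fun D f -> measurable_fun D g ->
  (q (f \+ g)%R <= (1 + e)%:E * q f + (1 + e^-1)%:E * q g)%E.
Proof.
move=> e0 mf mg; rewrite /wsq.
have e1 : 0 <= 1 + e by rewrite addr_ge0// ltW.
have e2 : 0 <= 1 + e^-1 by rewrite addr_ge0// invr_ge0 ltW.
rewrite -!ge0_integralZl_EFin//; try by [exact: measurable_wsq | move=> x; exact: wsq_integrand_ge0].
have mM (h : T -> R) (c : R) : measurable_fun D h -> measurable_fun D (fun x => (c%:E * (h x ^+ 2 * W x)%:E)%E).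
  by move=> mh; apply: measurable_funeM; exact: measurable_wsq.
have M0 (h : T -> R) (c : R) : 0 <= c -> forall x, D x -> (0 <= c%:E * (h x ^+ 2 * W x)%:E)%E.
  by move=> c0 x Dx; apply: mule_ge0 => //; exact: wsq_integrand_ge0.
rewrite -ge0_integralD//; [|exact: M0|exact: mM|exact: M0|exact: mM].
apply: ge0_le_integral => //.
- by move=> x; exact: wsq_integrand_ge0.
- by apply: measurable_wsq; exact: measurable_funD.
- by apply: emeasurable_funD; exact: mM.
- move=> x Dx; rewrite -!EFinM -EFinD lee_fin (mulrA (1 + e)) (mulrA (1 + e^-1)) -mulrDl ler_wpM2r ?W0//.
  exact: young_sqr.
Qed.

Lemma wsqD_le f g : measurable_fun D f -> measurable_fun D g ->
  (q (f \+ g)%R <= 2%:E * q f + 2%:E * q g)%E.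
Proof.
move=> mf mg; have := wsq_young ltr01 mf mg.
by rewrite invr1 -(natrD _ 1 1).
Qed.

Lemma wsqN f : q (\- f)%R = q f.
Proof. by apply: eq_integral => x _; rewrite sqrrN. Qed.

Lemma wsqB_le f g : measurable_fun D f -> measurable_fun D g ->
  (q (f \- g)%R <= 2%:E * q f + 2%:E * q g)%E.
Proof.
move=> mf mg; rewrite -(wsqN g); apply: wsqD_le => //.
exact: measurableT_comp.
Qed.

Lemma wsqC f g : q (f \- g)%R = q (g \- f)%R.
Proof. by apply: eq_integral => x _/=; rewrite -opprB sqrrN. Qed.

Lemma wsqD_lty f g : measurable_fun D f -> measurable_fun D g ->
  (q f < +oo -> q g < +oo -> q (f \+ g)%R < +oo)%E.
Proof.
move=> mf mg qf qg; apply: (le_lt_trans (wsqD_le mf mg)).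
by rewrite lte_add_pinfty// lte_mul_pinfty.
Qed.

Lemma wsqB_lty f g : measurable_fun D f -> measurable_fun D g ->
  (q f < +oo -> q g < +oo -> q (f \- g)%R < +oo)%E.
Proof.
move=> mf mg qf qg; apply: (le_lt_trans (wsqB_le mf mg)).
by rewrite lte_add_pinfty// lte_mul_pinfty.
Qed.

Lemma wsqZ_lty (c : R) f : measurable_fun D f -> (q f < +oo -> q (fun x => (c * f x)%R) < +oo)%E.
Proof. by move=> mf qf; rewrite wsqZ// lte_mul_pinfty// lee_fin sqr_ge0. Qed.

Lemma wsq_parallelogram f g : measurable_fun D f -> measurable_fun D g ->
  (q (f \- g)%R + q (f \+ g)%R = 2%:E * q f + 2%:E * q g)%E.
Proof.
move=> mf mg; rewrite /wsq.
rewrite -!ge0_integralZl_EFin//; try by [exact: measurable_wsq | move=> x; exact: wsq_integrand_ge0].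
have mM (h : T -> R) (c : R) : measurable_fun D h -> measurable_fun D (fun x => (c%:E * (h x ^+ 2 * W x)%:E)%E).
  by move=> mh; apply: measurable_funeM; exact: measurable_wsq.
have M0 (h : T -> R) (c : R) : 0 <= c -> forall x, D x -> (0 <= c%:E * (h x ^+ 2 * W x)%:E)%E.
  by move=> c0 x Dx; apply: mule_ge0 => //; exact: wsq_integrand_ge0.
rewrite -!ge0_integralD//; try by [exact: M0|exact: mM|apply: measurable_wsq; exact: measurable_funB|
   apply: measurable_wsq; exact: measurable_funD| move=> x; exact: wsq_integrand_ge0].
apply: eq_integral => x _; rewrite -!EFinM -!EFinD; congr EFin => /=; ring.
Qed.

Lemma wsq_fatou (f_ : (T -> R)^nat) f c k :
  (forall i, measurable_fun D (f_ i)) ->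
  (forall x, D x -> f_ ^~ x @ \oo --> f x) ->
  (forall i, (k <= i)%N -> q (f_ i) <= c)%E -> (q f <= c)%E.
Proof.
move=> mf ff fc.
apply: (@fatou_le _ _ _ mu D (fun i x => (f_ i x ^+ 2 * W x)%:E) _ c k) => //.
- by move=> i; exact: measurable_wsq.
- by move=> i x; exact: wsq_integrand_ge0.
- move=> x Dx; apply/cvg_EFin; first exact: nearW.
  rewrite /comp/=; apply: cvgM; last exact: cvg_cst.
  under eq_fun do rewrite expr2.
  by rewrite expr2; apply: cvgM; exact: ff.
Qed.

Lemma wsq_ae f g : measurable_fun D f -> measurable_fun D g ->
  {ae mu, forall x, D x -> f x = g x} -> q f = q g.
Proof.
move=> mf mg fg; apply: ge0_ae_eq_integral => //; try by
  [exact: measurable_wsq | move=> x; exact: wsq_integrand_ge0].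
by apply: filterS fg => x + Dx => /(_ Dx) ->.
Qed.

Lemma wsq_mul_integrable f g : measurable_fun D f -> measurable_fun D g ->
  (q f < +oo -> q g < +oo ->
  mu.-integrable D (fun x => (f x * g x * W x)%:E))%E.
Proof.
move=> mf mg qf qg.
have I (h : T -> R) : measurable_fun D h -> (q h < +oo)%E -> mu.-integrable D (fun x => (h x ^+ 2 * W x)%:E).
  move=> mh qh; apply/integrableP; split; first exact: measurable_wsq.
  under eq_integral => x /set_mem Dx do rewrite gee0_abs ?wsq_integrand_ge0//.
  exact: qh.
apply: (le_integrable mD _ _ (integrableD mD (I _ mf qf) (I _ mg qg))).
  by apply/measurable_EFinP/measurable_funM => //; exact: measurable_funM.
move=> x Dx; rewrite /= lee_fin -mulrDl normrM (ger0_norm (W0 Dx)).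
rewrite [leRHS]ger0_norm ?mulr_ge0 ?W0 ?addr_ge0 ?sqr_ge0// ler_wpM2r ?W0//.
have := young_mul (f x) (g x) (@ltr01 R).
by have := sqr_ge0 (f x); have := sqr_ge0 (g x); rewrite invr1; lra.
Qed.

Lemma wsq_integrable f : measurable_fun D f -> (q f < +oo)%E ->
  mu.-integrable D (fun x => (f x ^+ 2 * W x)%:E).
Proof. by move=> mf qf; apply: wsq_mul_integrable. Qed.

Lemma wsq_fin f : (q f < +oo)%E -> q f \is a fin_num.
Proof. by move=> qf; rewrite ge0_fin_numE// wsq_ge0. Qed.

Lemma wsq_subset (A : set T) f : measurable A -> A `<=` D -> measurable_fun D f ->
  (wsq mu A W f <= q f)%E.
Proof.
move=> mA AD mf; apply: ge0_subset_integral => //; first exact: measurable_wsq.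
by move=> x; exact: wsq_integrand_ge0.
Qed.

Lemma wsq_weight_le (c : R) f : 0 <= c -> (forall x, D x -> W x <= c) ->
  measurable_fun D f -> (q f <= c%:E * wsq mu D (cst 1%R) f)%E.
Proof.
move=> c0 Wc mf.
have m1 : measurable_fun D (fun x => (f x ^+ 2 * 1)%:E).
  apply/measurable_EFinP; apply: measurable_funM => //; exact: measurable_funX.
have p1 x : D x -> (0 <= (f x ^+ 2 * 1)%:E)%E by move=> _; rewrite lee_fin mulr1 sqr_ge0.
rewrite /wsq -ge0_integralZl_EFin//; apply: ge0_le_integral => //.
- by move=> x; exact: wsq_integrand_ge0.
- exact: measurable_wsq.
- exact: measurable_funeM.
- by move=> x Dx; rewrite -EFinM lee_fin mulr1 mulrC ler_wpM2r ?sqr_ge0// Wc.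
Qed.

End weighted_square.

(** * Almost everywhere limits obtained from square integrals *)

Section square_integrable.
Context d (T : measurableType d) (R : realType) (mu : {measure set T -> \bar R}).

Lemma wsq1_eq0 (D : set T) (W f : T -> R) : measurable D -> measurable_fun D W ->
  (forall x, D x -> 0 < W x) -> measurable_fun D f ->
  wsq mu D W f = 0%E -> {ae mu, forall x, D x -> f x = 0}.
Proof.
move=> mD mW W0 mf f0.
have : ae_eq mu D (fun x => (f x ^+ 2 * W x)%:E) (cst 0%E).
  apply/(ae_eq_integral_abs mu mD (measurable_wsq mW mf)).
  under eq_integral => x /set_mem Dx.
    rewrite gee0_abs; last by rewrite lee_fin mulr_ge0 ?sqr_ge0// ltW// W0.
    over.
  exact: f0.
apply: filterS => x + Dx => /(_ Dx) [] /eqP.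
by rewrite mulf_eq0 sqrf_eq0 (gt_eqF (W0 _ Dx)) orbF => /eqP.
Qed.

(** By monotone convergence the sum of the series has finite integral, so it is finite almost
    everywhere. *)
Lemma ae_cvg_series_of_integral_le (g : nat -> T -> R) (c theta : R) :
  0 <= theta < 1 -> (forall i, measurable_fun setT (g i)) ->
  (forall i x, 0 <= g i x) ->
  (forall i, (\int[mu]_x (g i x)%:E <= (c * theta ^+ i)%:E)%E) ->
  {ae mu, forall x, cvgn (series (g ^~ x))}.
Proof.
move=> /andP[th0 th1] mg g0 Ig.
have eg0 i x : (0 <= (g i x)%:E)%E by rewrite lee_fin.
have meg i : measurable_fun setT (EFin \o g i) by exact/measurable_EFinP.
have gfin : (\int[mu]_x (\sum_(i <oo) (g i x)%:E) < +oo)%E.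
  rewrite integral_nneseries//.
  apply: (@le_lt_trans _ _ (\sum_(i <oo) (c * theta ^+ i)%:E)%E).
    by apply: lee_nneseries => // i _ _; exact: integral_ge0.
  have := @cvg_geometric_series R c theta; rewrite ger0_norm// => /(_ th1) cg.
  suff -> : (\sum_(i <oo) (c * theta ^+ i)%:E)%E = (c * (1 - theta)^-1)%:E by rewrite ltry.
  apply: cvg_lim => //.
  rewrite (_ : (fun n => _) = EFin \o series (geometric c theta)); last first.
    by apply/funext => n; rewrite /= sumEFin.
  by apply: cvg_EFin => //; exact: nearW.
have : {ae mu, forall x, setT x -> (\sum_(i <oo) (g i x)%:E)%E \is a fin_num}.
  apply: integrable_ae => //; apply/integrableP; split.
    by apply: (ge0_emeasurable_sum (P := xpredT)) => // k _; exact: meg.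
  under eq_integral do rewrite gee0_abs ?nneseries_ge0//.
  exact: gfin.
apply: filterS => x /(_ I) fin.
apply/cvg_ex; exists (fine (\sum_(i <oo) (g i x)%:E)%E).
have := @is_cvg_nneseries _ (fun i => (g i x)%:E) xpredT 0 (fun i _ _ => eg0 i x).
move=> /cvg_ex[l gl]; have := cvg_lim _ gl => /(_ (@ereal_hausdorff R)) gE.
rewrite gE; move: fin; rewrite gE => lfin.
rewrite -(fineK lfin) in gl; have := fine_cvg gl.
rewrite (_ : fine \o _ = series (g ^~ x)); first by apply.
by apply/funext => n; rewrite /= /series/= sumEFin.
Qed.

Lemma fast_cauchy_ae_cvg (f_ : (T -> R)^nat) (c : R) :
  (forall i, measurable_fun setT (f_ i)) ->
  (forall i, (wsq mu setT (cst 1%R) (f_ i \- f_ i.+1)%R <= (c * 4^-1 ^+ i)%:E)%E) ->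
  {ae mu, forall x, cvgn (f_ ^~ x)}.
Proof.
move=> mf fc.
(* The measure may be infinite, so the increments themselves need not be integrable. Their squares
   weighted by 2^i still have integrals of order 2^-i, and Young's inequality with parameter 2^i
   bounds an increment by half of [g i x] plus 2^-i, which is summable. *)
pose g i x : R := 2 ^+ i * (f_ i x - f_ i.+1 x) ^+ 2.
have g0 i x : 0 <= g i x by rewrite /g mulr_ge0 ?sqr_ge0 ?exprn_ge0.
have mg i : measurable_fun setT (g i).
  by apply: measurable_funM => //; apply: measurable_funX; exact: measurable_funB.
have Ig i : (\int[mu]_x (g i x)%:E <= (c * 2^-1 ^+ i)%:E)%E.
  have -> : (c * 2^-1 ^+ i)%:E = ((2 ^+ i)%:E * (c * 4^-1 ^+ i)%:E)%E.
    rewrite -EFinM; congr EFin.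
    have -> : (4^-1 : R) = 2^-1 * 2^-1 by rewrite -invfM -natrM.
    have ba : 2 ^+ i * 2^-1 ^+ i = 1 :> R by rewrite -exprMn divff// expr1n.
    by rewrite exprMn [RHS]mulrCA (mulrA (2 ^+ i)) ba mul1r.
  apply: (@le_trans _ _ ((2 ^+ i)%:E * wsq mu setT (cst 1%R) (f_ i \- f_ i.+1)%R)%E); last first.
    by apply: lee_wpmul2l => //; rewrite lee_fin exprn_ge0.
  rewrite /wsq -ge0_integralZl_EFin ?exprn_ge0//.
  - by under [leRHS]eq_integral do rewrite -EFinM mulr1.
  - by move=> x _; rewrite lee_fin mulr1 sqr_ge0.
  - apply/measurable_EFinP; apply: measurable_funM => //; apply: measurable_funX.
    exact: measurable_funB.
have h2 : 0 <= (2^-1 : R) < 1 by rewrite invr_ge0 ler0n/=; lra.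
have := ae_cvg_series_of_integral_le h2 mg g0 Ig.
apply: filterS => x cgx.
pose u i := `|f_ i.+1 x - f_ i x|.
have cu : cvgn (series u).
  pose v i : R := g i x + 2^-1 ^+ i.
  have p0 i : (0 : R) <= 2^-1 ^+ i by rewrite exprn_ge0 ?invr_ge0.
  apply: (@series_le_cvg _ u v) => //.
  - by move=> i; rewrite /u normr_ge0.
  - by move=> i; rewrite /v addr_ge0.
  - move=> i; rewrite /u /v distrC.
    have /(young_mul (f_ i x - f_ i.+1 x) 1) : (0 : R) < 2 ^+ i by rewrite exprn_gt0.
    rewrite mulr1 expr1n mulr1 -exprVn -/(g i x) => h.
    have := g0 i x; have := p0 i; lra.
  rewrite /v; rewrite (_ : series _ = series (g ^~ x) + series (geometric 1 2^-1)).
    apply: is_cvgD => //.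
    by apply: is_cvg_geometric_series; rewrite ger0_norm ?invr_ge0//; lra.
  apply/funext => n; rewrite fctE /series/= -big_split/=; apply: eq_bigr => i _.
  by rewrite /= mul1r.
have : cvgn (series (telescope (f_ ^~ x))) by exact: normed_cvg.
move=> cs; rewrite (_ : f_ ^~ x = cst (f_ 0%N x) + series (telescope (f_ ^~ x))); last first.
  by apply/funext => n; rewrite [LHS](eq_sum_telescope (f_ ^~ x)).
by apply: is_cvgD => //; exact: is_cvg_cst.
Qed.

Lemma ae_cvg0_of_wsq_le (f_ : (T -> R)^nat) (c theta : R) :
  0 <= theta < 1 -> (forall i, measurable_fun setT (f_ i)) ->
  (forall i, (wsq mu setT (cst 1%R) (f_ i) <= (c * theta ^+ i)%:E)%E) ->
  {ae mu, forall x, f_ ^~ x @ \oo --> 0}.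
Proof.
move=> th mf fc.
have := @ae_cvg_series_of_integral_le (fun i x => f_ i x ^+ 2) c theta th.
have Ig i : (\int[mu]_x (f_ i x ^+ 2)%:E <= (c * theta ^+ i)%:E)%E.
  apply: le_trans (fc i); rewrite /wsq.
  by under [leRHS]eq_integral do rewrite mulr1.
move=> /(_ (fun i => measurable_funX 2 (mf i)) (fun i x => sqr_ge0 _) Ig).
apply: filterS => x /cvg_series_cvg_0 f0.
apply: norm_cvg0.
have : Num.sqrt (f_ i x ^+ 2) @[i --> \oo] --> Num.sqrt (0 : R).
  by apply: continuous_cvg => //; exact: sqrt_continuous.
by rewrite sqrtr0; under eq_fun do rewrite sqrtr_sqr.
Qed.

End square_integrable.

Lemma measurable_fun_if_mem d d' (T : measurableType d) (U : measurableType d')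
    (D N : set T) (f g : T -> U) : measurable D -> measurable N ->
  measurable_fun D f -> measurable_fun D g ->
  measurable_fun D (fun x => if x \in N then f x else g x).
Proof.
move=> mD mN mf mg; apply: measurable_fun_if => //.
- by apply: (measurable_fun_bool true); rewrite preimage_mem_true; exact: measurableI.
- by apply: measurable_funS mf => // x [].
- by apply: measurable_funS mg => // x [].
Qed.

Section weighted_square_limits.
Context d (T : measurableType d) (R : realType) (mu : {measure set T -> \bar R}).
Context (D : set T) (mD : measurable D) (W : T -> R).
Hypothesis mW : measurable_fun D W.
Hypothesis W0 : forall x, D x -> 0 <= W x.
Local Notation q := (wsq mu D W).

(* The factor comes from splitting [f_ i - f_ (i + n).+1] with Young's parameter
   [2 * theta / (1 - theta)]. *)
Lemma wsq_geometric_tail (f_ : (T -> R)^nat) (c theta : R) :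
  0 < theta < 1 -> (forall i, measurable_fun D (f_ i)) ->
  (forall i, (q (f_ i \- f_ i.+1)%R <= (c * theta ^+ i)%:E)%E) ->
  forall n i, (q (f_ i \- f_ (i + n)%N)%R <=
    (2 * (1 + theta) / (1 - theta) ^+ 2 * c * theta ^+ i)%:E)%E.
Proof.
move=> /andP[th0 th1] mf fc.
have th10 : 0 < 1 - theta by rewrite subr_gt0.
have c0 : 0 <= c.
  by have := le_trans (wsq_ge0 mu W0 _) (fc 0%N); rewrite expr0 mulr1 lee_fin.
elim=> [|n IH] i.
  rewrite addn0 (_ : q _ = 0%E).
    rewrite lee_fin mulr_ge0 ?exprn_ge0 ?(ltW th0)// mulr_ge0//.
    by rewrite divr_ge0 ?sqr_ge0// mulr_ge0// addr_ge0// ltW.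
  by rewrite /wsq integral0_eq// => x _ /=; rewrite subrr expr0n mul0r.
have -> : (f_ i \- f_ (i + n.+1)%N)%R =
          ((f_ i \- f_ i.+1) \+ (f_ i.+1 \- f_ (i.+1 + n)%N))%R.
  by apply/funext => x /=; rewrite addrA subrK addSnnS.
pose e := 2 * theta / (1 - theta).
have e0 : 0 < e by rewrite divr_gt0 ?mulr_gt0.
apply: (le_trans (wsq_young mu mD mW W0 e0 _ _)); try exact: measurable_funB.
have h1 : (0 <= (1 + e)%:E :> \bar R)%E by rewrite lee_fin addr_ge0// ltW.
have h2 : (0 <= (1 + e^-1)%:E :> \bar R)%E by rewrite lee_fin addr_ge0// invr_ge0 ltW.
apply: (le_trans (leeD (lee_wpmul2l h1 (fc i)) (lee_wpmul2l h2 (IH i.+1)))).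
rewrite -!EFinM -EFinD lee_fin (exprS theta i) /e; move: (theta ^+ i) => t.
rewrite le_eqVlt; apply/orP; left; apply/eqP; field.
by rewrite !gt_eqF.
Qed.

Lemma wsq_ae_fatou (f_ : (T -> R)^nat) (f : T -> R) (c : \bar R) k :
  (forall i, measurable_fun D (f_ i)) -> measurable_fun D f ->
  {ae mu, forall x, D x -> f_ ^~ x @ \oo --> f x} ->
  (forall i, (k <= i)%N -> q (f_ i) <= c)%E -> (q f <= c)%E.
Proof.
move=> mf mff [N [mN N0 Nf]] fc.
(* On the exceptional set the sequence is replaced by its intended limit, so that it converges at
   every point, as [wsq_fatou] asks. *)
pose g i x := if x \in N then f x else f_ i x.
have mg i : measurable_fun D (g i).
  exact: measurable_fun_if_mem.
apply: (@wsq_fatou _ _ _ mu D mD W mW W0 g f c k) => //.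
- move=> x Dx; rewrite /g; have [xN|xN] := boolP (x \in N); first exact: cvg_cst.
  apply: contrapT => nc; move/negP: xN; apply; rewrite inE; apply: Nf => /= h.
  exact: nc (h Dx).
- move=> i ki; rewrite (wsq_ae (g := f_ i) mD mW W0)//; first exact: fc.
  exists N; split => //= x; apply: contra_notP => /= xN; rewrite /g.
  by rewrite ifF//; apply/negbTE/negP; rewrite inE.
Qed.

(** The geometric tail estimate is uniform in its second index, so Fatou's lemma lets that index
    tend to infinity. *)
Lemma wsq_geometric_limit (f_ : (T -> R)^nat) (f : T -> R) (c theta : R) :
  0 < theta < 1 -> (forall i, measurable_fun D (f_ i)) -> measurable_fun D f ->
  {ae mu, forall x, D x -> f_ ^~ x @ \oo --> f x} ->
  (forall i, (q (f_ i \- f_ i.+1)%R <= (c * theta ^+ i)%:E)%E) ->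
  forall i, (q (f_ i \- f)%R <=
    (2 * (1 + theta) / (1 - theta) ^+ 2 * c * theta ^+ i)%:E)%E.
Proof.
move=> th mf mff ff fc i.
apply: (@wsq_ae_fatou (fun m => f_ i \- f_ m)%R _ _ i).
- by move=> m; exact: measurable_funB.
- exact: measurable_funB.
- apply: filterS ff => x + Dx => /(_ Dx) ff.
  by apply: cvgB => //; exact: cvg_cst.
- by move=> m im; rewrite -(subnKC im); exact: wsq_geometric_tail.
Qed.

End weighted_square_limits.

(** Completeness in the style of Riesz and Fischer. Setting the sequence to 0 on the exceptional set
    makes it converge everywhere, which yields a measurable limit. *)
Lemma fast_cauchy_limit d (T : measurableType d) (R : realType)
    (mu : {measure set T -> \bar R}) (f_ : (T -> R)^nat) (c : R) :
  (forall i, measurable_fun setT (f_ i)) ->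
  (forall i, (wsq mu setT (cst 1%R) (f_ i \- f_ i.+1)%R <= (c * 4^-1 ^+ i)%:E)%E) ->
  exists2 f : T -> R, measurable_fun setT f & {ae mu, forall x, f_ ^~ x @ \oo --> f x}.
Proof.
move=> mf fc; have [N [mN N0 Nf]] := fast_cauchy_ae_cvg mf fc.
pose g i x := if x \in N then 0 else f_ i x.
have cg x : cvgn (g ^~ x).
  rewrite /g; have [xN|xN] := boolP (x \in N); first exact: is_cvg_cst.
  by apply: contrapT => nc; move/negP: xN; apply; rewrite inE; exact: Nf.
exists (fun x => limn (g ^~ x)).
  apply: (@measurable_fun_cvg _ _ _ _ g) => [i|x _]; last exact: cg.
  exact: measurable_fun_if_mem.
exists N; split => // x /=; apply: contra_notP => xN.
have xN' : (x \in N) = false by apply/negbTE/negP; rewrite inE.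
by have := cg x; rewrite /g xN'.
Qed.

Lemma ae_prod d (T : measurableType d) (R : realType)
    (mu : {sigma_finite_measure set T -> \bar R}) (P : T -> Prop) :
  {ae mu, forall x, P x} -> {ae (mu \x mu)%E, forall z, P z.1 /\ P z.2}.
Proof.
move=> [N [mN N0 NP]]; exists (N `*` setT `|` setT `*` N); split.
- by apply: measurableU; exact: measurableX.
- apply/eqP; rewrite -measure_le0.
  apply: (le_trans (measureU2 _ _ _)); try exact: measurableX.
  rewrite -[leLHS]/((mu \x mu)%E (N `*` setT) + (mu \x mu)%E (setT `*` N))%E.
  by rewrite !product_measure1E// [X in (X * _ + _)%E]N0 [X in (_ + _ * X)%E]N0 mul0e mule0 adde0.
- move=> [x y] /= /not_andP[nP|nP]; [left|right]; split => //; exact: NP.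
Qed.

(** * Averages over cells *)

Lemma integrable_of_sqr d (T : measurableType d) (R : realType)
    (mu : {measure set T -> \bar R}) (A : set T) (u : T -> R) :
  measurable A -> (mu A < +oo)%E -> measurable_fun A u ->
  (\int[mu]_(y in A) (u y ^+ 2)%:E < +oo)%E ->
  mu.-integrable A (EFin \o u) /\ mu.-integrable A (fun y => (u y ^+ 2)%:E).
Proof.
move=> mA muA mu_ uy.
have iu2 : mu.-integrable A (fun y => (u y ^+ 2)%:E).
  apply/integrableP; split; first by apply/measurable_EFinP; exact: measurable_funX.
  by under eq_integral do rewrite gee0_abs ?lee_fin ?sqr_ge0//.
split => //.
have c1 : mu.-integrable A (fun _ => 1%:E).
  apply: (measurable_bounded_integrable (f := cst (1 : R))) => //; exact: bounded_cst.
apply: (le_integrable mA _ _ (integrableD mA iu2 c1)).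
  exact/measurable_EFinP.
move=> x Ax /=; rewrite lee_fin (@ger0_norm _ (_ + 1)) ?addr_ge0 ?sqr_ge0//.
have := young_mul (u x) 1 (@ltr01 R); rewrite mulr1 invr1 expr1n.
have := sqr_ge0 (u x); lra.
Qed.

(** Expands the integral of (u - m)^2, which is nonnegative, where m is the mean of u. If u^2 has
    infinite integral, the right side is infinite. *)
Lemma jensen_sqr d (T : measurableType d) (R : realType)
    (mu : {measure set T -> \bar R}) (A : set T) (v : R) (u : T -> R) :
  0 < v -> measurable A -> mu A = v%:E -> measurable_fun A u ->
  (((v^-1 * \int[mu]_(y in A) u y) ^+ 2)%:E <=
    (v^-1)%:E * \int[mu]_(y in A) (u y ^+ 2)%:E)%E.
Proof.
move=> v0 mA muA mu_; set m := v^-1 * _.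
have cA (c : R) : mu.-integrable A (fun _ => c%:E).
  apply: (measurable_bounded_integrable (f := cst c)) => //.
  - by rewrite muA ltry.
  - exact: bounded_cst.
have [uy|] := ltP (\int[mu]_(y in A) (u y ^+ 2)%:E)%E +oo%E; last first.
  by rewrite leye_eq => /eqP ->; rewrite gt0_muley ?leey// lte_fin invr_gt0.
have muAy : (mu A < +oo)%E by rewrite muA ltry.
have [iu iu2] := integrable_of_sqr mA muAy mu_ uy.
have Iu : \int[mu]_(y in A) u y = v * m by rewrite /m mulrA divff ?mul1r ?gt_eqF.
have I2 : (\int[mu]_(y in A) (u y ^+ 2)%:E)%E = (\int[mu]_(y in A) (u y ^+ 2))%:E.
  by rewrite /Rintegral fineK// integrable_fin_num.
have : 0 <= \int[mu]_(y in A) ((u y ^+ 2 + (- (2 * m)) * u y) + m ^+ 2).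
  apply: Rintegral_ge0 => y _.
  suff -> : u y ^+ 2 + - (2 * m) * u y + m ^+ 2 = (u y - m) ^+ 2 by rewrite sqr_ge0.
  by ring.
have iZ : mu.-integrable A (EFin \o (fun y => - (2 * m) * u y)).
  by have := integrableZl mA (- (2 * m)) iu; apply: eq_integrable.
rewrite RintegralD//; [|exact: (integrableD mA iu2 iZ)|exact: cA].
rewrite RintegralD//.
rewrite RintegralZl// Iu Rintegral_cst// [fine _](_ : _ = v); last by rewrite muA.
rewrite I2 -EFinM lee_fin => h.
by rewrite mulrC -ler_pdivrMr ?invr_gt0// invrK; lra.
Qed.

Section cell_average.
Context d (T : measurableType d) (R : realType).
Context (mu : {sigma_finite_measure set T -> \bar R}).
Context (E : set (T * T)) (v : R).
Hypothesis v0 : 0 < v.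
Hypothesis mE : measurable E.
Hypothesis Esym : forall x y, E (x, y) -> E (y, x).
Hypothesis Etrans : forall x y z, E (x, y) -> E (y, z) -> E (x, z).
Hypothesis muE : forall x, mu (xsection E x) = v%:E.
Implicit Types u : T -> R.
Local Notation cell := (xsection E).

(** Conditional expectation for the partition into classes of [E]. Coding the partition by a
    measurable relation makes measurability in [x] a case of Tonelli's theorem. *)
Definition cell_avg u x : R := v^-1 * \int[mu]_(y in cell x) u y.

Let mcell x : measurable (cell x). Proof. exact: measurable_xsection. Qed.

Lemma cell_eq x y : E (x, y) -> cell x = cell y.
Proof.
move=> Exy; apply/seteqP; split => z; rewrite /xsection/= !inE => Ez.
- exact: Etrans (Esym Exy) Ez.
- exact: Etrans Exy Ez.
Qed.

Lemma cell_avg_cst u x y : E (x, y) -> cell_avg u x = cell_avg u y.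
Proof. by move=> Exy; rewrite /cell_avg (cell_eq Exy). Qed.

Lemma integral_cellE (h : T -> R) x :
  (\int[mu]_(y in cell x) (h y)%:E = \int[mu]_y (h y * \1_E (x, y))%:E)%E.
Proof.
rewrite integral_mkcond; apply: eq_integral => y _.
rewrite patchE mem_xsection indicE; case: ifPn => _; rewrite ?mulr1 ?mulr0//.
Qed.

Lemma measurable_integral_cell (h : T * T -> R) : measurable_fun setT h ->
  (forall z, 0 <= h z) ->
  measurable_fun setT (fun x => \int[mu]_(y in cell x) (h (x, y))%:E)%E.
Proof.
move=> mh h0.
have := @measurable_fun_fubini_tonelli_F _ _ T T R mu
  (fun z => (h z * \1_E z)%:E).
rewrite /fubini_F => H.
under eq_fun do rewrite integral_cellE.
apply: H; first by apply/measurable_EFinP; exact: measurable_funM.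
by move=> z; rewrite lee_fin mulr_ge0.
Qed.

Lemma measurable_cell_avg u : measurable_fun setT u -> measurable_fun setT (cell_avg u).
Proof.
move=> mu_; apply: measurable_funM => //.
rewrite /Rintegral; apply: (measurableT_comp (fine_measurable measurableT)).
under eq_fun do rewrite integralE.
apply: emeasurable_funB.
- rewrite [X in measurable_fun _ X](_ : _ = (fun x => \int[mu]_(y in cell x) (Num.max (u y) 0%R)%:E)%E).
    apply: (measurable_integral_cell (h := fun z => Num.max (u z.2) 0)).
      by apply: measurable_maxr => //; exact: measurableT_comp.
    by move=> z; rewrite le_max lexx orbT.
  by apply/funext => x; apply: eq_integral => y _; rewrite funeposE EFin_max.
- rewrite [X in measurable_fun _ X](_ : _ = (fun x => \int[mu]_(y in cell x) (Num.max (- u y)%R 0%R)%:E)%E).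
    apply: (measurable_integral_cell (h := fun z => Num.max (- u z.2) 0)).
      by apply: measurable_maxr => //; do 2 apply: measurableT_comp => //.
    by move=> z; rewrite le_max lexx orbT.
  by apply/funext => x; apply: eq_integral => y _; rewrite funenegE EFin_max.
Qed.


Let v1_ge0 : 0 <= v^-1. Proof. by rewrite invr_ge0 ltW. Qed.

Lemma cell_avg_sqr_le u x : measurable_fun setT u ->
  (((cell_avg u x) ^+ 2)%:E <= (v^-1)%:E * \int[mu]_(y in cell x) (u y ^+ 2)%:E)%E.
Proof. by move=> mu_; apply: jensen_sqr; [|exact: mcell|exact: muE|exact: measurable_funTS]. Qed.

Lemma sub_cell_avg_sqr_le u x : measurable_fun setT u ->
  (wsq mu setT (cst 1%R) u < +oo)%E ->
  (((u x - cell_avg u x) ^+ 2)%:E <=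
    (v^-1)%:E * \int[mu]_(y in cell x) ((u x - u y) ^+ 2)%:E)%E.
Proof.
move=> mu_ uy.
have mux : measurable_fun (cell x) u by exact: measurable_funTS.
have vy : ((mu : {measure set T -> \bar R}) (cell x) < +oo)%E.
  by rewrite [X in (X < _)%E]muE ltry.
have uxy : (\int[mu]_(y in cell x) (u y ^+ 2)%:E < +oo)%E.
  apply: le_lt_trans uy; rewrite /wsq.
  under [leRHS]eq_integral do rewrite mulr1.
  apply: ge0_subset_integral => //.
    by apply/measurable_EFinP; exact: measurable_funX.
  by move=> y _; rewrite lee_fin sqr_ge0.
have [iu _] := integrable_of_sqr (mcell x) vy mux uxy.
have -> : u x - cell_avg u x = v^-1 * \int[mu]_(y in cell x) (u x - u y).
  rewrite RintegralB//; last first.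
    apply: (measurable_bounded_integrable (f := cst (u x))) => //; exact: bounded_cst.
  rewrite Rintegral_cst// [fine _](_ : _ = v); last by rewrite [X in fine X]muE.
  by rewrite mulrBr mulrCA mulVf ?mulr1// gt_eqF.
by apply: jensen_sqr; [|exact: mcell|exact: muE|exact: measurable_funB].
Qed.

(** Jensen's inequality leads to the double integral over [E] of (u x - u y)^2 divided by [v]. There
    [K] is at least [k] off the diagonal, and on the diagonal the difference is 0; the exclusion
    matters because the fractional kernel vanishes there. *)
Lemma wsq_sub_cell_avg (K : T * T -> R) (k : R) u : measurable_fun setT K ->
  (forall z, 0 <= K z) -> 0 < k ->
  (forall x y, E (x, y) -> x <> y -> k <= K (x, y)) ->
  measurable_fun setT u -> (wsq mu setT (cst 1%R) u < +oo)%E ->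
  (wsq mu setT (cst 1%R) (u \- cell_avg u)%R <=
   ((v * k)^-1)%:E * wsq (mu \x mu)%E setT K (fun z => u z.1 - u z.2)%R)%E.
Proof.
move=> mK K0 k0 Kk mu_ uy.
have mu1 : measurable_fun setT (fun z : T * T => u z.1) by exact: measurableT_comp.
have mu2 : measurable_fun setT (fun z : T * T => u z.2) by exact: measurableT_comp.
have mdu : measurable_fun setT (fun z : T * T => (u z.1 - u z.2) ^+ 2).
  by apply: measurable_funX; exact: measurable_funB.
have mduE : measurable_fun setT (fun z : T * T => ((u z.1 - u z.2) ^+ 2 * \1_E z)%:E).
  by apply/measurable_EFinP; exact: measurable_funM.
apply: (@le_trans _ _ ((v^-1)%:E * \int[mu]_x \int[mu]_(y in cell x) ((u x - u y) ^+ 2)%:E)%E).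
  rewrite -ge0_integralZl_EFin//.
  - apply: ge0_le_integral => //.
    + by move=> x _; rewrite lee_fin mulr1 sqr_ge0.
    + apply/measurable_EFinP; apply: measurable_funM => //; apply: measurable_funX.
      by apply: measurable_funB => //; exact: measurable_cell_avg.
    + apply: measurable_funeM.
      by apply: (measurable_integral_cell (h := fun z => (u z.1 - u z.2) ^+ 2)) => // z; exact: sqr_ge0.
    + by move=> x _; rewrite mulr1; exact: sub_cell_avg_sqr_le.
  - by move=> x _; apply: integral_ge0 => y _; rewrite lee_fin sqr_ge0.
  - by apply: (measurable_integral_cell (h := fun z => (u z.1 - u z.2) ^+ 2)) => // z; exact: sqr_ge0.
rewrite invfM EFinM -muleA; apply: lee_wpmul2l; first by rewrite lee_fin.
under eq_integral do rewrite (integral_cellE (fun y => (u _ - u y) ^+ 2)).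
rewrite -(@fubini_tonelli1 _ _ T T R mu mu (fun z => ((u z.1 - u z.2) ^+ 2 * \1_E z)%:E))//; last first.
  by move=> z; rewrite lee_fin mulr_ge0// sqr_ge0.
rewrite /wsq -ge0_integralZl_EFin ?invr_ge0 ?(ltW k0)//.
- apply: ge0_le_integral => //.
  + by move=> z _; rewrite lee_fin mulr_ge0// sqr_ge0.
  + apply: measurable_funeM; apply/measurable_EFinP; exact: measurable_funM.
  + move=> [x y] _; rewrite -EFinM lee_fin /= indicE.
    have [xyE|_] := boolP (_ \in _); last first.
      by rewrite mulr0 mulr_ge0 ?invr_ge0 ?(ltW k0)// mulr_ge0 ?sqr_ge0.
    rewrite mulr1 mulrC -ler_pdivrMr ?invr_gt0// invrK.
    have [->|/eqP xy] := eqVneq x y; first by rewrite subrr expr0n/= !mul0r.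
    by rewrite ler_wpM2l ?sqr_ge0// Kk//; exact: set_mem.
- by move=> z _; rewrite lee_fin mulr_ge0// sqr_ge0.
- by apply/measurable_EFinP; exact: measurable_funM.
Qed.

(** Integrate h(y)^2 G(x) over [E] in both orders. Integrating first in y gives v h(x)^2 G(x), since
    h is constant on the cell; integrating first in x gives h(y)^2 times the integral of G over the
    cell of y. *)
Lemma wsq_cell_cst (G h : T -> R) (g : R) :
  measurable_fun setT G -> (forall x, 0 <= G x) -> measurable_fun setT h ->
  (forall x y, E (x, y) -> h x = h y) ->
  (forall x, \int[mu]_(y in cell x) (G y)%:E <= (v * g)%:E)%E ->
  (wsq mu setT G h <= g%:E * wsq mu setT (cst 1%R) h)%E.
Proof.
move=> mG G0 mh hE Gg.
have g0 : 0 <= g.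
  rewrite -(pmulr_rge0 _ v0) -lee_fin; apply: le_trans (Gg point).
  by apply: integral_ge0 => y _; rewrite lee_fin.
have mG1 : measurable_fun setT (fun z : T * T => G z.1) by exact: measurableT_comp.
have mG2 : measurable_fun setT (fun z : T * T => h z.2) by exact: measurableT_comp.
pose F (z : T * T) := h z.2 ^+ 2 * G z.1 * \1_E z.
have mF : measurable_fun setT (EFin \o F).
  apply/measurable_EFinP; apply: measurable_funM => //.
  by apply: measurable_funM => //; exact: measurable_funX.
have F0 z : (0 <= (F z)%:E)%E by rewrite lee_fin mulr_ge0// mulr_ge0// sqr_ge0.
have vv : v^-1 * v = 1 by rewrite mulVf ?gt_eqF.
have -> : wsq mu setT G h = ((v^-1)%:E * \int[mu]_x \int[mu]_y (F (x, y))%:E)%E.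
  rewrite -ge0_integralZl_EFin//.
  - apply: eq_integral => x _.
    rewrite (_ : (\int[mu]_y (F (x, y))%:E)%E = (v * (h x ^+ 2 * G x))%:E).
      by rewrite -EFinM (mulrA v^-1) vv mul1r.
    have -> : (v * (h x ^+ 2 * G x))%:E = (\int[mu]_(y in cell x) (h x ^+ 2 * G x)%:E)%E.
      by rewrite integral_cst// [X in (_ * X)%E]muE -EFinM mulrC.
    rewrite (integral_cellE (fun=> h x ^+ 2 * G x)).
    apply: eq_integral => y _; rewrite /F/= indicE.
    have [/set_mem xyE|_] := boolP (_ \in _); last by rewrite !mulr0.
    by rewrite (hE _ _ xyE).
  - by move=> x _; apply: integral_ge0.
  - exact: (@measurable_fun_fubini_tonelli_F _ _ T T R mu (EFin \o F)).
rewrite (@fubini_tonelli _ _ T T R mu mu (EFin \o F))//.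
have mh2 : measurable_fun setT (fun x => (h x ^+ 2 * 1)%:E).
  by apply/measurable_EFinP; apply: measurable_funM => //; exact: measurable_funX.
have mG_ := @measurable_fun_fubini_tonelli_G _ _ T T R mu (EFin \o F) mF (fun z => F0 z).
rewrite /wsq -!ge0_integralZl_EFin//; try by
  [move=> x _; apply: integral_ge0 => y _; exact: F0 | move=> x _; rewrite lee_fin mulr1 sqr_ge0].
apply: ge0_le_integral => //.
- by move=> x _; apply: mule_ge0; [rewrite lee_fin|apply: integral_ge0 => y _; exact: F0].
- exact: measurable_funeM.
- exact: measurable_funeM.
- move=> y _; rewrite mulr1.
  rewrite [X in (_ * X <= _)%E](_ : _ = ((h y ^+ 2)%:E * \int[mu]_(x in cell y) (G x)%:E)%E); last first.
    rewrite integral_cellE -ge0_integralZl_EFin ?sqr_ge0//.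
    + apply: eq_integral => x _; rewrite /= /F/= -EFinM -mulrA; congr (_ * (_ * _))%:E.
      rewrite !indicE.
      suff -> : ((x, y) \in E) = ((y, x) \in E) by [].
      by apply/idP/idP => /set_mem/Esym; exact: mem_set.
    + by move=> x _; rewrite lee_fin mulr_ge0.
    + apply/measurable_EFinP; apply: measurable_funM => //.
      by apply: measurableT_comp => //; exact: pair1_measurable.
  apply: (@le_trans _ _ ((v^-1)%:E * ((h y ^+ 2)%:E * (v * g)%:E))%E).
    by do 2 (apply: lee_wpmul2l; first by rewrite lee_fin ?sqr_ge0).
  by rewrite -!EFinM lee_fin (mulrCA (h y ^+ 2)) (mulrA v^-1) vv mul1r mulrC.
Qed.

End cell_average.

(** * Weighted bounds and compactness from a nested sequence of partitions *)

Lemma ultra_bounded_cvg (R : realType) (I : Type) (U : set_system I)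
    (a : I -> R) (B : R) : UltraFilter U -> (forall k, `|a k| <= B) ->
  exists l, forall e : R, 0 < e -> U [set k | `|l - a k| < e].
Proof.
move=> UU aB; have PU : ProperFilter U := @ultra_proper _ U UU.
have ab : (a @ U) `[- B, B]%classic.
  suff : U (a @^-1` `[- B, B]%classic) by [].
  apply: (@filterS _ U PU setT) => [k _|]; last exact: filterT.
  by rewrite /= in_itv/= -ler_norml.
have [l [_ lcl]] := segment_compact (fmap_proper_filter a PU) ab.
exists l => e e0.
have [//|H] := in_ultra_setVsetC [set k | `|l - a k| < e] UU.
pose V := [set y : R | ~ (`|l - y| < e)].
have aH : (a @ U) V by exact: H.
have [y [/= ye yl]] := lcl V (ball l e) aH (nbhsx_ballx l e e0).
by have := ye yl.
Qed.

Lemma mul_div_succ_le (R : realFieldType) (a dl c : R) : 0 <= a -> 0 < dl -> 0 < c ->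
  a * (dl / (c * (a + 1))) <= dl / c.
Proof.
move=> a0 dl0 c0; have a1 : 0 < a + 1 by rewrite ltr_wpDl.
have -> : a * (dl / (c * (a + 1))) = dl / c * (a / (a + 1)).
  by field; rewrite !gt_eqF.
by rewrite ler_piMr ?divr_ge0 ?(ltW dl0) ?(ltW c0)// ler_pdivrMr// mul1r lerDl.
Qed.

Section nested_cells.
Context d (T : measurableType d) (R : realType).
Context (mu : {sigma_finite_measure set T -> \bar R}).
Context (E : nat -> set (T * T)) (v k g : nat -> R) (K : T * T -> R) (G : T -> R).
Context (A C theta IG : R).
Hypothesis v0 : forall n, 0 < v n.
Hypothesis mE : forall n, measurable (E n).
Hypothesis Esym : forall n x y, E n (x, y) -> E n (y, x).
Hypothesis Etrans : forall n x y z, E n (x, y) -> E n (y, z) -> E n (x, z).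
Hypothesis E_nested : forall n x y, E n.+1 (x, y) -> E n (x, y).
Hypothesis muE : forall n x, mu (xsection (E n) x) = (v n)%:E.
Hypothesis mK : measurable_fun setT K.
Hypothesis K0 : forall z, 0 <= K z.
Hypothesis k0 : forall n, 0 < k n.
Hypothesis Kk : forall n x y, E n (x, y) -> x <> y -> k n <= K (x, y).
Hypothesis mG : measurable_fun setT G.
Hypothesis G0 : forall x, 0 <= G x.
Hypothesis intG : (\int[mu]_x (G x)%:E <= IG%:E)%E.
Hypothesis Gg : forall n x,
  (\int[mu]_(y in xsection (E n) x) (G y)%:E <= (v n * g n)%:E)%E.
Hypothesis theta01 : 0 < theta < 1.
(** By [wsq_sub_cell_avg], [(v n * k n)^-1] controls the L^2 error of averaging at level n. [rateA]
    makes these errors summable; [rateC] asks that their decay beat the growth of [g], the bound on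
    the averages of [G]. *)
Hypothesis rateA : forall n, (v n * k n)^-1 <= A * theta ^+ n.
Hypothesis rateC : forall n,
  g n.+1 * (2 * (v n * k n)^-1 + 2 * (v n.+1 * k n.+1)^-1) <= C * theta ^+ n.
Implicit Types u : T -> R.
Local Notation P := (fun n => cell_avg mu (E n) (v n)).
Local Notation sq := (wsq mu setT (cst 1%R)).
Local Notation semi u := (wsq (mu \x mu)%E setT K (fun z => u z.1 - u z.2)).
Local Notation wG := (wsq mu setT G).
Local Notation tail := (2 * (1 + theta) / (1 - theta) ^+ 2 * C).

Let mP n u : measurable_fun setT u -> measurable_fun setT (P n u).
Proof. by move=> mu_; apply: measurable_cell_avg. Qed.

Section one_function.
Variables (u : T -> R) (H M : R).
Hypothesis mu_ : measurable_fun setT u.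
Hypothesis uM : (sq u <= M%:E)%E.
Hypothesis uH : (semi u <= H%:E)%E.

Let uy : (sq u < +oo)%E. Proof. by apply: (le_lt_trans uM); rewrite ltry. Qed.

Let H0 : 0 <= H.
Proof. by rewrite -lee_fin; apply: le_trans uH; apply: wsq_ge0. Qed.

Let M0 : 0 <= M.
Proof. by rewrite -lee_fin; apply: le_trans uM; apply: wsq_ge0. Qed.

Lemma sq_sub_cell_avg n : (sq (u \- P n u)%R <= ((v n * k n)^-1 * H)%:E)%E.
Proof.
apply: (le_trans (wsq_sub_cell_avg (v0 n) (mE n) (@muE n) mK K0 (k0 n) (@Kk n) mu_ uy)).
rewrite EFinM; apply: lee_wpmul2l => //.
by rewrite lee_fin invr_ge0 mulr_ge0// ltW.
Qed.

(** Identifies the limit of the averages, so that the steps measured in the weighted norm can be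
    summed up to [u] itself. It comes from the unweighted errors, whose squares are summable. *)
Lemma cell_avg_ae_cvg : {ae mu, forall x, (fun n => P n u x) @ \oo --> u x}.
Proof.
have th : 0 <= theta < 1 by case/andP: theta01 => /ltW -> ->.
have := @ae_cvg0_of_wsq_le _ _ _ mu (fun n => u \- P n u)%R (A * H) theta th.
move=> /(_ _ _)[].
- by move=> n; apply: measurable_funB => //; exact: mP.
- move=> n; apply: (le_trans (sq_sub_cell_avg n)); rewrite lee_fin.
  by rewrite mulrAC ler_wpM2r.
- move=> N [mN N0 NP]; exists N; split => // x /= nx; apply: NP => /= h; apply: nx.
  have : u x - (u x - P n u x) @[n --> \oo] --> u x - 0.
    by apply: cvgB => //; exact: cvg_cst.
  by rewrite subr0; under eq_fun do rewrite subKr.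
Qed.

Lemma wG_cell_avg_step n : (wG (P n u \- P n.+1 u)%R <= (C * H * theta ^+ n)%:E)%E.
Proof.
apply: (le_trans (wsq_cell_cst (v0 n.+1) (mE n.+1) (@Esym n.+1) (@muE n.+1) mG G0 _ _ (@Gg n.+1))).
- by apply: measurable_funB; exact: mP.
- move=> x y Exy /=; congr (_ - _).
    by apply: cell_avg_cst => //; [exact: Esym|exact: Etrans|exact: E_nested].
  by apply: cell_avg_cst => //; [exact: Esym|exact: Etrans].
have g0 : 0 <= g n.+1.
  rewrite -(pmulr_rge0 _ (v0 n.+1)) -lee_fin; apply: le_trans (Gg n.+1 point).
  by apply: integral_ge0 => y _; rewrite lee_fin.
have -> : (P n u \- P n.+1 u)%R = ((u \- P n.+1 u) \- (u \- P n u))%R.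
  by apply/funext => x /=; rewrite opprB [RHS]addrC addrA subrK.
apply: (@le_trans _ _ ((g n.+1)%:E * (2%:E * ((v n.+1 * k n.+1)^-1 * H)%:E + 2%:E * ((v n * k n)^-1 * H)%:E))%E).
  apply: lee_wpmul2l; first by rewrite lee_fin.
  have := @wsqB_le _ _ _ mu setT measurableT (cst 1) _ _ (u \- P n.+1 u)%R (u \- P n u)%R.
  move=> /(_ _ _ _ _)/le_trans; apply => //.
  - by apply: measurable_funB => //; exact: mP.
  - by apply: measurable_funB => //; exact: mP.
  - by apply: leeD; apply: lee_wpmul2l => //; exact: sq_sub_cell_avg.
rewrite -!EFinM lee_fin.
have := ler_wpM2r H0 (rateC n); lra.
Qed.

Lemma wG_cell_avg_sub n : (wG (P n u \- u)%R <= (tail * H * theta ^+ n)%:E)%E.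
Proof.
have := @wsq_geometric_limit _ _ _ mu setT measurableT G mG _ (fun n => P n u) u (C * H) theta theta01.
rewrite mulrA; apply => //.
- by move=> i; exact: mP.
- by apply: filterS cell_avg_ae_cvg.
- exact: wG_cell_avg_step.
Qed.

Lemma cell_avg_bound n x : `|P n u x| ^+ 2 <= (v n)^-1 * M.
Proof.
rewrite real_normK ?num_real// -lee_fin [leRHS]EFinM.
apply: (le_trans (cell_avg_sqr_le (v0 n) (mE n) (@muE n) x mu_)).
apply: lee_wpmul2l; first by rewrite lee_fin invr_ge0 ltW.
apply: le_trans uM; rewrite /wsq.
under [leRHS]eq_integral do rewrite mulr1.
apply: ge0_subset_integral => //.
- exact: measurable_xsection.
- by apply/measurable_EFinP; exact: measurable_funX.
- by move=> y _; rewrite lee_fin sqr_ge0.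
Qed.

Lemma wG_le_of_bound (h : T -> R) (b : R) : 0 <= b -> measurable_fun setT h ->
  (forall x, G x != 0 -> `|h x| ^+ 2 <= b) -> (wG h <= (b * IG)%:E)%E.
Proof.
move=> b0 mh hb; apply: (@le_trans _ _ (b%:E * \int[mu]_x (G x)%:E)%E); last first.
  by rewrite EFinM; apply: lee_wpmul2l.
rewrite -ge0_integralZl_EFin//; last 2 first.
- by move=> x _; rewrite lee_fin.
- exact/measurable_EFinP.
apply: ge0_le_integral => //.
- by move=> x _; rewrite lee_fin mulr_ge0 ?sqr_ge0.
- exact: measurable_wsq.
- by apply: measurable_funeM; exact/measurable_EFinP.
- move=> x _; rewrite -EFinM lee_fin; have [->|Gx] := eqVneq (G x) 0; first by rewrite !mulr0.
  by rewrite ler_wpM2r// -(real_normK (num_real _)) hb.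
Qed.

Lemma wG_bound : (wG u <= (2 * (tail * H) + 2 * ((v 0%N)^-1 * M * IG))%:E)%E.
Proof.
have -> : u = (P 0 u \- (P 0 u \- u))%R.
  by apply/funext => x /=; rewrite subKr.
apply: (le_trans (wsqB_le mu measurableT mG _ _ _)) => //; first exact: mP.
- by apply: measurable_funB => //; exact: mP.
rewrite [X in (_ <= X%:E)%E]addrC [leRHS]EFinD; apply: leeD.
- rewrite EFinM; apply: lee_wpmul2l => //; apply: wG_le_of_bound.
  + by rewrite mulr_ge0// invr_ge0 ltW.
  + exact: mP.
  + by move=> x _; exact: cell_avg_bound.
- rewrite EFinM; apply: lee_wpmul2l => //.
  by apply: (le_trans (wG_cell_avg_sub 0)); rewrite expr0 mulr1.
Qed.

End one_function.
Hypothesis cover : forall n, exists m, exists r : 'I_m -> T,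
  forall x, G x != 0 -> exists i, E n (r i, x).

(** Where [G] is nonzero, an average at level n is determined by its values at the finitely many
    representatives [r i]. These numbers are bounded; the remainders are uniformly small by
    [wG_cell_avg_sub]. *)
Lemma wG_compact (u_ : nat -> T -> R) (M H : R) :
  (forall i, measurable_fun setT (u_ i)) -> (forall i, (sq (u_ i) <= M%:E)%E) ->
  (forall i, (semi (u_ i) <= H%:E)%E) ->
  exists2 f : nat -> nat, (forall i, (i <= f i)%N) &
    forall i j, (i <= j)%N -> (wG (u_ (f j) \- u_ (f i))%R <= (2^-1 ^+ i)%:E)%E.
Proof.
move=> mu_ uM uH; case/andP: (theta01) => th0 th1.
(* Along one ultrafilter every bounded numerical sequence converges, so all cell values at all
   levels are treated at once. As [U] contains the tails, each of its members has arbitrarily large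
   indices. *)
have [U [UU subU]] := ultraFilterLemma eventually_filter.
have IG0 : 0 <= IG.
  by rewrite -lee_fin; apply: le_trans intG; apply: integral_ge0 => x _; rewrite lee_fin.
have TH0 : 0 <= tail * H.
  have := le_trans (wsq_ge0 mu (fun x _ => G0 x) _) (wG_cell_avg_sub (mu_ 0%N) (uM 0%N) (uH 0%N) 0).
  by rewrite expr0 mulr1 lee_fin.
have close dl : 0 < dl -> exists2 S, U S & forall k' l, S k' -> S l ->
    (wG (u_ k' \- u_ l)%R <= dl%:E)%E.
  move=> dl0.
  (* Splitting twice into two gives coefficients 2, 4 and 4. The outer terms are at most dl/12 and
     the middle one at most dl/8, which adds up to dl; the + 1 in the denominators keeps them
     positive. Half the root of [e2] is used since two averages are compared through their common
     limit. *)
  have [n thn] : exists n, theta ^+ n < dl / (12 * (tail * H + 1)).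
    apply: geometric_small; first by rewrite (ltW th0).
    by rewrite divr_gt0// mulr_gt0// ltr_wpDl.
  pose e2 := dl / (8 * (IG + 1)).
  have e20 : 0 < e2 by rewrite divr_gt0// mulr_gt0// ltr_wpDl.
  pose e := Num.sqrt e2 / 2.
  have e0 : 0 < e by rewrite divr_gt0// sqrtr_gt0.
  have [m [r Hr]] := cover n.
  pose B := Num.sqrt ((v n)^-1 * M).
  have PB i k' : `|P n (u_ k') (r i)| <= B.
    rewrite -[leLHS]sqrtr_sqr ler_sqrt.
      by rewrite -(real_normK (num_real _)); exact: cell_avg_bound.
    exact: le_trans (sqr_ge0 _) (cell_avg_bound (mu_ k') (uM k') n (r i)).
  have /choice[lm Hlm] := fun i => ultra_bounded_cvg UU (PB i).
  exists [set k' | forall i, `|lm i - P n (u_ k') (r i)| < e].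
    by apply: filter_forall => i; exact: Hlm.
  move=> k' l Sk Sl.
  have -> : (u_ k' \- u_ l)%R = ((u_ k' \- P n (u_ k')) \+
      ((P n (u_ k') \- P n (u_ l)) \+ (P n (u_ l) \- u_ l)))%R.
    by apply/funext => x /=; ring.
  have mPu i : measurable_fun setT (P n (u_ i)) by exact: mP.
  have N1 : (wG (u_ k' \- P n (u_ k'))%R <= (tail * H * theta ^+ n)%:E)%E.
    by rewrite wsqC; exact: wG_cell_avg_sub.
  have N3 : (wG (P n (u_ l) \- u_ l)%R <= (tail * H * theta ^+ n)%:E)%E.
    exact: wG_cell_avg_sub.
  have N2 : (wG (P n (u_ k') \- P n (u_ l))%R <= (e2 * IG)%:E)%E.
    apply: wG_le_of_bound => //; [exact: ltW|exact: measurable_funB|].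
    move=> x /Hr[i Ei] /=.
    rewrite -(cell_avg_cst mu (v n) (@Esym n) (@Etrans n) (u_ k') Ei).
    rewrite -(cell_avg_cst mu (v n) (@Esym n) (@Etrans n) (u_ l) Ei).
    rewrite -[leRHS]sqr_sqrtr ?(ltW e20)// lerXn2r ?nnegrE ?sqrtr_ge0//.
    have := Sk i; have := Sl i; rewrite /e => h1 h2.
    have := ler_distD (lm i) (P n (u_ k') (r i)) (P n (u_ l) (r i)).
    by rewrite (distrC _ (lm i)); lra.
  have m1 : measurable_fun setT (u_ k' \- P n (u_ k'))%R by exact: measurable_funB.
  have m2 : measurable_fun setT (P n (u_ k') \- P n (u_ l))%R by exact: measurable_funB.
  have m3 : measurable_fun setT (P n (u_ l) \- u_ l)%R by exact: measurable_funB.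
  have W0 x : [set: T] x -> 0 <= G x by move=> _; exact: G0.
  apply: (le_trans (wsqD_le mu measurableT mG W0 m1 (measurable_funD m2 m3))).
  have h2 : (0 <= 2%:E :> \bar R)%E by rewrite lee_fin.
  apply: (le_trans (leeD (lee_wpmul2l h2 N1)
    (lee_wpmul2l h2 (wsqD_le mu measurableT mG W0 m2 m3)))).
  apply: (le_trans (leeD (lexx _) (lee_wpmul2l h2 (leeD (lee_wpmul2l h2 N2) (lee_wpmul2l h2 N3))))).
  rewrite -!EFinM -?EFinD -?EFinM -?EFinD lee_fin.
  have h3 : tail * H * theta ^+ n <= dl / 12.
    apply: (@le_trans _ _ (tail * H * (dl / (12 * (tail * H + 1))))).
      by rewrite ler_wpM2l// ltW.
    exact: mul_div_succ_le.
  have h4 : e2 * IG <= dl / 8 by rewrite mulrC; exact: mul_div_succ_le.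
  by move: h3 h4; move: (tail * H * theta ^+ n) (e2 * IG) => p q; lra.
have /choice[S HS] : forall j : nat, exists S, U S /\ forall k' l, S k' -> S l ->
    (wG (u_ k' \- u_ l)%R <= (2^-1 ^+ j)%:E)%E.
  move=> j; have [|S] := close (2^-1 ^+ j); first by rewrite exprn_gt0// invr_gt0.
  by exists S.
(* [f i] lies in [S 0] up to [S i] simultaneously, so every later [f j] is still in [S i]. This
   takes the place of a diagonal extraction. *)
have /choice[f Hf] : forall i : nat, exists k, (forall j : 'I_i.+1, S j k) /\ (i <= k)%N.
  move=> i; apply: (@filter_ex _ U); apply: filterI.
    by apply: filter_forall => j; exact: (HS j).1.
  by apply: subU; exists i.
exists f => [i|i j ij]; first exact: (Hf i).2.
apply: (HS i).2.
- by have := (Hf j).1 (Ordinal (ij : (i < j.+1)%N)).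
- by have := (Hf i).1 ord_max.
Qed.

End nested_cells.

(** * Dyadic cells of R^d and the fractional kernel *)

Section borel_boxes.
Context (R : realType).

Definition rV_box d (a : 'I_d -> R) (h : R) : set 'rV[R]_d :=
  [set y | forall i, a i <= y ord0 i < a i + h].

Lemma measurable_rV_box d (a : 'I_d -> R) h : measurable (rV_box a h).
Proof.
rewrite (_ : rV_box a h = \bigcap_(i in [set: 'I_d])
    (@coord_rV R d i @^-1` `[a i, a i + h[%classic)).
  apply: fin_bigcap_measurable => // i _.
  by rewrite -[X in measurable X]setTI; apply: measurable_coord_rV.
apply/seteqP; split => [y yb i _|y yb i]; first by rewrite /= in_itv/=; exact: yb.
by have := yb i I; rewrite /= in_itv.
Qed.

Lemma borel_lebesgue_box d (a : 'I_d -> R) h : 0 <= h ->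
  borel_lebesgue R d (rV_box a h) = (h ^+ d)%:E.
Proof.
move=> h0; elim: d a => [|d IH] a.
  rewrite /= /dirac indicE (_ : _ \in _ = true) ?expr0//.
  by apply: mem_set => -[].
rewrite /= /borel_lebesgueS /pushforward.
rewrite (_ : _ @^-1` _ = `[a ord0, a ord0 + h[%classic `*` rV_box (a \o lift ord0) h).
  rewrite product_measure1E//; last exact: measurable_rV_box.
  have E1 : lebesgue_measure `[a ord0, a ord0 + h[%classic = h%:E.
    rewrite lebesgue_measure_itv/= lte_fin.
    have [_|] := ltP (a ord0) (a ord0 + h); first by rewrite -EFinB addrAC subrr add0r.
    by rewrite gerDl => h0'; congr EFin; apply/eqP; rewrite eq_le h0 h0'.
  by rewrite IH [X in (X * _)%E]E1 exprS.
apply/seteqP; split => [[t y] /= H|[t y] /= [H1 H2] i].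
  split; first by have := H ord0; rewrite /cons_rV mxE unlift_none in_itv.
  by move=> i /=; have := H (lift ord0 i); rewrite /cons_rV mxE liftK.
rewrite /cons_rV mxE; case: unliftP => [j|] -> /=; first exact: H2.
by move: H1; rewrite in_itv.
Qed.

End borel_boxes.

Section lebesgue_cells.
Context (R : realType) (d : nat).
Local Notation leb := (@lebesgue_rV R d).
Local Notation lebT := (caratheodory_type (borel_lebesgue R d)^*%mu).

Lemma borel_lebT (A : set 'rV[R]_d) : measurable A -> measurable (A : set lebT).
Proof.
move=> mA; apply: sub_caratheodory; exact: sub_sigma_algebra.
Qed.

Lemma leb_borelE (A : set 'rV[R]_d) : measurable A -> leb A = borel_lebesgue R d A.
Proof. by move=> mA; exact: measurable_mu_extE. Qed.

Lemma measurable_coord (i : 'I_d) :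
  measurable_fun (setT : set lebT) (fun x : lebT => (x : 'rV[R]_d) ord0 i).
Proof.
move=> _ Y mY; rewrite setTI; apply: borel_lebT.
by have := @measurable_coord_rV R d i measurableT Y mY; rewrite setTI.
Qed.

Definition cell_index (n : nat) (x : 'rV[R]_d) (i : 'I_d) : int :=
  Num.floor (2 ^+ n * x ord0 i).

Definition dyadic_cells (n : nat) : set (lebT * lebT) :=
  [set z | cell_index n z.1 =1 cell_index n z.2].

Lemma dyadic_cells_sym n x y : dyadic_cells n (x, y) -> dyadic_cells n (y, x).
Proof. by move=> xy i /=; rewrite -xy. Qed.

Lemma dyadic_cells_trans n x y z :
  dyadic_cells n (x, y) -> dyadic_cells n (y, z) -> dyadic_cells n (x, z).
Proof. by move=> xy yz i /=; rewrite [LHS]xy [LHS]yz. Qed.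

Lemma cell_indexP n x i (m : int) : cell_index n x i = m <->
  m%:~R / 2 ^+ n <= x ord0 i < m%:~R / 2 ^+ n + 2^-1 ^+ n.
Proof.
have n0 : 0 < 2 ^+ n :> R by rewrite exprn_gt0.
have -> : m%:~R / 2 ^+ n + 2^-1 ^+ n = (m + 1)%:~R / 2 ^+ n :> R.
  by rewrite intrD mulrDl exprVn div1r.
rewrite ler_pdivrMr// ltr_pdivlMr// (mulrC (x _ _)).
split=> [<-|]; last exact: floor_def.
by rewrite real_floor_itv ?num_real.
Qed.

(** The level n index is decided by the comparisons m <= 2^n t for integers m, and each of these is
    the comparison 2m <= 2^(n+1) t, decided by the index at level n + 1. *)
Lemma dyadic_cells_nested n x y : dyadic_cells n.+1 (x, y) -> dyadic_cells n (x, y).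
Proof.
move=> xy i /=; apply/esym.
have E (t : 'rV[R]_d) (m : int) :
    (m%:~R <= 2 ^+ n * t ord0 i) = (2 * m <= cell_index n.+1 t i).
  rewrite /cell_index real_floor_ge_int ?num_real// exprS -mulrA intrM.
  by rewrite ler_pM2l.
apply: floor_def; set m := cell_index n x i.
have : m%:~R <= 2 ^+ n * x ord0 i < (m + 1)%:~R by rewrite real_floor_itv ?num_real.
by rewrite !ltNge !E (xy i).
Qed.

Lemma measurable_cell_index n i (m : int) :
  measurable ([set x | cell_index n x i = m] : set lebT).
Proof.
rewrite (_ : [set x | _] = (fun x : lebT => (x : 'rV[R]_d) ord0 i) @^-1`
  `[m%:~R / 2 ^+ n, m%:~R / 2 ^+ n + 2^-1 ^+ n[%classic).
  by rewrite -[X in measurable X]setTI; apply: measurable_coord.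
apply/seteqP; split => x /=; first by move=> /cell_indexP; rewrite in_itv/=.
by rewrite in_itv/= => /cell_indexP.
Qed.

Lemma measurable_dyadic_cells n : measurable (dyadic_cells n).
Proof.
rewrite (_ : dyadic_cells n = \bigcap_(i in [set: 'I_d]) \bigcup_(m : int)
  ([set x | cell_index n x i = m] `*` [set x | cell_index n x i = m])).
  apply: fin_bigcap_measurable => // i _.
  apply: countable_bigcupT_measurable; first exact: countableP.
  by move=> m; apply: measurableX; exact: measurable_cell_index.
apply/seteqP; split => [[x y] xy i _|[x y] xy i].
  by exists (cell_index n x i) => //; split => //=; rewrite -[LHS]xy.
by have [m _ [/= -> ->]] := xy i I.
Qed.
Lemma xsection_dyadic_cells n (x : lebT) : xsection (dyadic_cells n) x =
  rV_box (fun i => (cell_index n x i)%:~R / 2 ^+ n) (2^-1 ^+ n).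
Proof.
apply/seteqP; split => y.
- rewrite /xsection/= inE => xy i; apply/cell_indexP; by rewrite (xy i).
- by move=> yb; rewrite /xsection/= inE => i /=; apply/esym/cell_indexP; exact: yb.
Qed.

Lemma leb_dyadic_cell n x : leb (xsection (dyadic_cells n) x) = ((2^-1 ^+ n) ^+ d)%:E.
Proof.
rewrite xsection_dyadic_cells leb_borelE; last exact: measurable_rV_box.
by rewrite borel_lebesgue_box// exprn_ge0// invr_ge0.
Qed.

Lemma dyadic_cells_close n x y i : dyadic_cells n (x, y) ->
  `|(x : 'rV[R]_d) ord0 i - (y : 'rV[R]_d) ord0 i| < 2^-1 ^+ n.
Proof.
move=> xy; have /cell_indexP := erefl (cell_index n x i).
have /cell_indexP := esym (xy i); rewrite /= ltr_norml; lra.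
Qed.

(** An open set is the union of the dyadic cells that it contains, and cells are countably many. For
    the max norm a cell of side 2^-n around x lies in each ball of larger radius centred at x. *)
Lemma borel_open (A : set 'rV[R]_d) : open A -> measurable (A : set lebT).
Proof.
move=> oA; pose c n (z : {ffun 'I_d -> int}) : set lebT :=
  \bigcap_(i in [set: 'I_d]) [set x | cell_index n x i = z i].
have mc n z : measurable (c n z).
  by apply: fin_bigcap_measurable => // i _; exact: measurable_cell_index.
pose c' n z : set lebT := if `[< c n z `<=` A >] then c n z else set0.
rewrite (_ : A = \bigcup_n \bigcup_z c' n z).
  apply: bigcupT_measurable => n.
  apply: countable_bigcupT_measurable; first exact: countableP.
  by move=> z; rewrite /c'; case: asbool.
apply/seteqP; split=> [x Ax|x [n _ [z _]]]; last first.
  by rewrite /c'; case: asboolP => // + cx; exact.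
have /nbhs_ballP[e /= e0 eA] := open_nbhs_nbhs (conj oA Ax).
have [n ne] := exp_half_small e0.
exists n => //; exists [ffun i => cell_index n x i] => //.
rewrite /c' asboolT => [i _|]; first by rewrite /= ffunE.
move=> y yx; apply: eA; split => // i j; rewrite /ball/= (ord1 i).
apply: lt_trans ne; apply: dyadic_cells_close => k /=.
by have := yx k I; rewrite /= ffunE.
Qed.

Lemma continuous_measurable (f : 'rV[R]_d -> R) : continuous f ->
  measurable_fun (setT : set lebT) (f : lebT -> R).
Proof.
move=> cf; apply: (@measurability _ _ _ _ _ _ (@RGenOpens.G R)).
  exact: RGenOpens.measurableE.
move=> _ [_ [x [y ->]] <-]; rewrite setTI; apply: borel_open.
by apply: open_comp; [move=> z _; exact: cf|exact: interval_open].
Qed.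

Lemma measurable_frac_kernel s : measurable_fun (setT : set (lebT * lebT))
  (fun z => frac_kernel s (z.1 : 'rV[R]_d) (z.2 : 'rV[R]_d)).
Proof.
pose q (z : lebT * lebT) : R :=
  \sum_(i < d) ((z.1 : 'rV[R]_d) ord0 i - (z.2 : 'rV[R]_d) ord0 i) ^+ 2.
have q0 z : 0 <= q z by apply: sumr_ge0 => i _; exact: sqr_ge0.
have mq : measurable_fun setT q.
  apply: measurable_sum => i; apply: measurable_funX; apply: measurable_funB.
    exact: (measurableT_comp (measurable_coord i) measurable_fst).
  exact: (measurableT_comp (measurable_coord i) measurable_snd).
(* Root, power and inverse all become real powers, whose measurability is available; the conventions
   agree at 0. *)
rewrite (_ : (fun z => _) = fun z => ((q z `^ 2^-1) `^ (d%:R + 2 * s)) `^ (-1)).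
  by do 3 (apply: (measurableT_comp (measurable_powR _))).
apply/funext => z; rewrite powR_inv1 ?powR_ge0// powR12_sqrt//.
congr ((Num.sqrt _ `^ _)^-1); apply: eq_bigr => i _.
by rewrite !mxE.
Qed.
End lebesgue_cells.

(** * Growth of cell averages of an L^r weight against the fractional kernel *)

Lemma powR_exprn (R : realType) (a p : R) n : 0 <= a -> (a ^+ n) `^ p = (a `^ p) ^+ n.
Proof.
by move=> a0; rewrite -powR_mulrn// -powRrM mulrC powRrM powR_mulrn// powR_ge0.
Qed.

(** If a > t, then a / t is at least 1, so a is at most a (a / t)^(r - 1), which is the second
    term. *)
Lemma le_split_powR (R : realType) (a t r : R) : 0 <= a -> 0 < t -> 1 <= r ->
  a <= t + a `^ r * t `^ (1 - r).
Proof.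
move=> a0 t0 r1; have [at_|ta] := leP a t.
  by rewrite (le_trans at_)// lerDl mulr_ge0// powR_ge0.
have a0' : 0 < a by exact: lt_trans ta.
have -> : a `^ r * t `^ (1 - r) = a * (a / t) `^ (r - 1).
  rewrite powRM ?invr_ge0 ?(ltW t0)// -(powR_inv1 (ltW t0)) -powRrM mulN1r opprB mulrA.
  have aE : a * a `^ (r - 1) = a `^ r.
    rewrite -[X in X * _](powRr1 a0) -powRD ?subrKC//.
    by rewrite (gt_eqF a0') implybT.
  by rewrite aE.
rewrite -[leLHS]mulr1 (@le_trans _ _ (a * (a / t) `^ (r - 1)))//; last first.
  by rewrite lerDr ltW.
rewrite ler_wpM2l//.
have at1 : 1 <= a / t by rewrite ler_pdivlMr// mul1r ltW.
by have := @ler_powR _ _ at1 0 (r - 1); rewrite powRr0 subr_ge0; apply.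
Qed.

(** Hölder's inequality before optimisation in [t]. With [t] equal to v^(-1/r) both terms scale like
    v^(1 - 1/r). *)
Lemma integral_le_powR d (T : measurableType d) (R : realType)
    (mu : {measure set T -> \bar R}) (G : T -> R) (A : set T) (I r t v : R) :
  1 <= r -> measurable_fun setT G -> (forall x, 0 <= G x) ->
  (\int[mu]_x (G x `^ r)%:E <= I%:E)%E -> measurable A -> 0 < t ->
  (mu A <= v%:E)%E ->
  (\int[mu]_(x in A) (G x)%:E <= (t * v + I * t `^ (1 - r))%:E)%E.
Proof.
move=> r1 mG G0 GI mA t0 vA.
have mGr : measurable_fun A (fun x => (G x `^ r)%:E).
  apply/measurable_EFinP; apply: (measurableT_comp (measurable_powR _)).
  exact: measurable_funTS.
apply: (@le_trans _ _ (\int[mu]_(x in A) (t%:E + (t `^ (1 - r))%:E * (G x `^ r)%:E))%E).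
  apply: ge0_le_integral => //.
  - by move=> x _; rewrite lee_fin.
  - by apply/measurable_EFinP; exact: measurable_funTS.
  - by apply: emeasurable_funD => //; exact: measurable_funeM.
  - by move=> x _; rewrite lee_fin mulrC; exact: le_split_powR.
rewrite ge0_integralD//; last 3 first.
- by move=> x _; rewrite lee_fin ltW.
- by move=> x _; rewrite lee_fin mulr_ge0// powR_ge0.
- exact: measurable_funeM.
rewrite integral_cst// ge0_integralZl_EFin ?powR_ge0//; last first.
  by move=> x _; rewrite lee_fin powR_ge0.
rewrite EFinD !EFinM (muleC I%:E); apply: leeD; apply: lee_wpmul2l => //.
- by rewrite lee_fin ltW.
- by rewrite lee_fin powR_ge0.
apply: le_trans GI; apply: ge0_subset_integral => //.
- by apply/measurable_EFinP; apply: (measurableT_comp (measurable_powR _)).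
- by move=> x _; rewrite lee_fin powR_ge0.
Qed.

Section fractional_compactness.
Context (R : realType) (d : nat) (s r : R).
Hypothesis d0 : (0 < d)%N.
Hypothesis s0 : 0 < s.
Hypothesis r1 : 1 <= r.
Hypothesis rs : d%:R / (2 * s) < r.
Local Notation leb := (@lebesgue_rV R d).
Local Notation lebT := (caratheodory_type (borel_lebesgue R d)^*%mu).
Local Notation K := (fun z : lebT * lebT => frac_kernel s (z.1 : 'rV[R]_d) (z.2 : 'rV[R]_d)).
Local Notation h := (2^-1 : R).
Local Notation p := (d%:R + 2 * s).
Local Notation cd := (Num.sqrt d%:R `^ p : R).

Let h0 : 0 < h. Proof. by rewrite invr_gt0. Qed.
Let hn0 n : 0 < h ^+ n. Proof. exact: exprn_gt0. Qed.
Let d0R : 0 < d%:R :> R. Proof. by rewrite ltr0n. Qed.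
Let p0 : 0 < p. Proof. by rewrite addr_gt0// mulr_gt0. Qed.
Let cd0 : 0 < cd. Proof. by rewrite powR_gt0// sqrtr_gt0. Qed.
Let r0 : 0 < r. Proof. exact: lt_le_trans r1. Qed.

Lemma frac_kernel_ge0 (x y : 'rV[R]_d) : 0 <= frac_kernel s x y.
Proof. by rewrite invr_ge0 powR_ge0. Qed.

Lemma enorm_gt0 (x : 'rV[R]_d) : x <> 0 -> 0 < enorm x.
Proof.
move=> x0; rewrite sqrtr_gt0 lt_neqAle sumr_ge0 ?andbT; last by move=> i _; exact: sqr_ge0.
apply/eqP => /esym/eqP; rewrite psumr_eq0; last by move=> i _; exact: sqr_ge0.
move=> /allP x00; apply: x0; apply/rowP => i; rewrite mxE.
by have := x00 i (mem_index_enum _); rewrite sqrf_eq0 => /eqP.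
Qed.

Lemma enorm_le (x : 'rV[R]_d) (b : R) : 0 <= b -> (forall i, `|x ord0 i| <= b) ->
  enorm x <= Num.sqrt d%:R * b.
Proof.
move=> b0 xb; rewrite -[X in _ * X]ger0_norm// -sqrtr_sqr -sqrtrM ?ler0n//.
rewrite ler_sqrt; last by rewrite mulr_ge0 ?sqr_ge0.
apply: (@le_trans _ _ (\sum_(i < d) b ^+ 2)).
  by apply: ler_sum => i _; rewrite -(real_normK (num_real _)) lerXn2r ?nnegrE.
by rewrite sumr_const card_ord mulr_natl.
Qed.

Lemma frac_kernel_ge (x y : 'rV[R]_d) (b : R) : x <> y -> 0 < b ->
  (forall i, `|x ord0 i - y ord0 i| <= b) ->
  (cd * b `^ p)^-1 <= frac_kernel s x y.
Proof.
move=> xy b0 xyb; rewrite /frac_kernel.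
have n0 : 0 < enorm (x - y) by apply: enorm_gt0 => /eqP; rewrite subr_eq0 => /eqP.
have le1 : enorm (x - y) <= Num.sqrt d%:R * b.
  by apply: enorm_le; [exact: ltW|move=> i; rewrite !mxE].
rewrite lef_pV2 ?posrE; [|by rewrite mulr_gt0// powR_gt0|by rewrite powR_gt0].
rewrite -powRM ?sqrtr_ge0 ?(ltW b0)//.
apply: ge0_ler_powR => //; rewrite ?nnegrE; first exact: ltW.
- exact: ltW.
- by rewrite mulr_ge0 ?sqrtr_ge0// ltW.
Qed.

Variables (G : lebT -> R) (I m B : R).
Hypothesis mG : measurable_fun setT G.
Hypothesis G0 : forall x, 0 <= G x.
Hypothesis GI : (\int[leb]_x (G x `^ r)%:E <= I%:E)%E.
Variable D : set lebT.
Hypothesis mD : measurable D.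
Hypothesis Dm : (leb D <= m%:E)%E.
Hypothesis GD : forall x, ~ D x -> G x = 0.
Hypothesis DB : forall x : 'rV[R]_d, D x -> forall i, `|x ord0 i| <= B.

Let I0 : 0 <= I.
Proof.
by rewrite -lee_fin; apply: le_trans GI; apply: integral_ge0 => x _; rewrite lee_fin powR_ge0.
Qed.

Let integral_G_le (A : set lebT) (t v : R) : measurable A -> 0 < t ->
  (leb A <= v%:E)%E ->
  (\int[leb]_(x in A) (G x)%:E <= (t * v + I * t `^ (1 - r))%:E)%E.
Proof. by move=> mA t0 vA; exact: integral_le_powR. Qed.

(** The data of the nested partitions: [v] is the volume of a cell, [k] the kernel at distance sqrt
    d times 2^-n, [g] the bound on averages of G obtained from Hölder. [gam] is 2^(d/r), the growth
    ratio of [g]; [theta] is [gam] times the decay ratio 2^(-2s) of the squared L^2 error, and it is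
    below 1 exactly when d/r < 2s. *)
Let v n : R := (h ^+ n) ^+ d.
Let k n : R := (cd * (h ^+ n) `^ p)^-1.
Let g n : R := (1 + I) * (v n) `^ (- r^-1).
Let theta : R := h `^ (2 * s - d%:R / r).
Let gam : R := (h ^+ d) `^ (- r^-1).

Let v0 n : 0 < v n. Proof. exact: exprn_gt0. Qed.
Let k0 n : 0 < k n.
Proof. by rewrite invr_gt0 mulr_gt0// powR_gt0. Qed.

Let Kk n (x y : lebT) : dyadic_cells n (x, y) -> x <> y -> k n <= K (x, y).
Proof.
move=> xyE xy; apply: frac_kernel_ge => //= i.
exact: ltW (dyadic_cells_close i xyE).
Qed.

Let mcell n x : measurable (xsection (@dyadic_cells R d n) x).
Proof. by apply: measurable_xsection; exact: measurable_dyadic_cells. Qed.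

Let Gg n x : (\int[leb]_(y in xsection (@dyadic_cells R d n) x) (G y)%:E <= (v n * g n)%:E)%E.
Proof.
(* This [t] balances the two terms of [G <= t + G^r t^(1 - r)]. *)
pose t := (v n) `^ (- r^-1).
have t0 : 0 < t by exact: powR_gt0.
have vx : (leb (xsection (@dyadic_cells R d n) x) <= (v n)%:E)%E.
  by rewrite leb_dyadic_cell.
apply: (le_trans (integral_G_le (mcell n x) t0 vx)).
rewrite lee_fin /g -/t.
have -> : t `^ (1 - r) = v n * t.
  rewrite /t -powRrM mulrBr mulr1 mulNr mulVf ?gt_eqF// opprK addrC.
  by rewrite powRD ?powRr1 ?(ltW (v0 n))// (gt_eqF (v0 n)) implybT.
by rewrite le_eqVlt; apply/orP; left; apply/eqP; ring.
Qed.

Let vk n : (v n * k n)^-1 = cd * (h `^ (2 * s)) ^+ n.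
Proof.
have hp : h `^ p = h ^+ d * h `^ (2 * s).
  by rewrite powRD ?powR_mulrn ?(ltW h0)// (gt_eqF h0) implybT.
rewrite /v /k invfM invrK powR_exprn ?(ltW h0)// hp exprMn.
rewrite -!exprM (mulnC d) mulrCA (mulrA (h ^- _)) mulVf ?mul1r//.
Qed.

Let thetaE : theta = gam * h `^ (2 * s).
Proof.
rewrite /theta /gam -(powR_mulrn _ (ltW h0)) -powRrM -powRD; last by rewrite (gt_eqF h0) implybT.
by congr (_ `^ _); ring.
Qed.

Let powR_half_le1 q : 0 <= q -> h `^ q <= 1.
Proof.
move=> q0; apply: (@le_trans _ _ (1 `^ q)); last by rewrite powR1.
by apply: ge0_ler_powR => //; rewrite ?nnegrE ?(ltW h0)//; lra.
Qed.

Let sig1 : h `^ (2 * s) <= 1.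
Proof. by apply: powR_half_le1; rewrite mulr_ge0// ltW. Qed.

Let rs0 : 0 < 2 * s - d%:R / r.
Proof.
rewrite subr_gt0 ltr_pdivrMr//; move: rs; rewrite ltr_pdivrMr ?mulr_gt0//.
by rewrite mulrC.
Qed.

Let theta01 : 0 < theta < 1.
Proof.
rewrite powR_gt0//=; apply: (@lt_le_trans _ _ (1 `^ (2 * s - d%:R / r))).
  by apply: gt0_ltr_powR => //; rewrite ?nnegrE ?(ltW h0)//; lra.
by rewrite powR1.
Qed.

Let rateA n : (v n * k n)^-1 <= cd * theta ^+ n.
Proof.
rewrite vk ler_wpM2l ?(ltW cd0)// lerXn2r ?nnegrE ?powR_ge0//.
rewrite thetaE ler_peMl ?powR_ge0// /gam -(powR_mulrn _ (ltW h0)) -powRrM.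
rewrite mulrN powRN invf_ge1 ?powR_gt0//.
by apply: powR_half_le1; rewrite mulr_ge0// invr_ge0 ltW.
Qed.

(** Both L^2 errors are at most the one at level n, whence the 4; the extra [gam] pays for [g] being
    taken at level n + 1. *)
Let rateC n : g n.+1 * (2 * (v n * k n)^-1 + 2 * (v n.+1 * k n.+1)^-1) <=
  (4 * (1 + I) * gam * cd) * theta ^+ n.
Proof.
have gE : g n.+1 = (1 + I) * gam * gam ^+ n.
  rewrite /g /v -exprM mulnC exprM powR_exprn ?exprn_ge0 ?(ltW h0)// exprS.
  by rewrite mulrA.
rewrite !vk gE exprS thetaE exprMn.
have g0 : 0 < gam by rewrite powR_gt0// exprn_gt0.
have X0 : 0 <= (1 + I) * gam * gam ^+ n * cd * (h `^ (2 * s)) ^+ n.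
  by rewrite !mulr_ge0 ?exprn_ge0 ?powR_ge0 ?addr_ge0.
have : (1 + I) * gam * gam ^+ n * cd * (h `^ (2 * s)) ^+ n * h `^ (2 * s) <=
       (1 + I) * gam * gam ^+ n * cd * (h `^ (2 * s)) ^+ n.
  by rewrite ler_piMr.
move: (gam ^+ n) (h `^ (2 * s)) ((h `^ (2 * s)) ^+ n) => x y z; lra.
Qed.

Let intG : (\int[leb]_x (G x)%:E <= (m + I)%:E)%E.
Proof.
rewrite (_ : (\int[leb]_x _)%E = (\int[leb]_(x in D) (G x)%:E)%E).
  apply: (le_trans (integral_G_le mD ltr01 Dm)).
  by rewrite powR1 mulr1 mul1r.
rewrite [RHS]integral_mkcond; apply: eq_integral => x _.
by rewrite patchE; case: ifPn => // /negP; rewrite inE => /GD ->.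
Qed.

Let cover n : exists q, exists f : 'I_q -> lebT,
  forall x, G x != 0 -> exists i, dyadic_cells n (f i, x).
Proof.
pose Bn := (Num.truncn B).+1.
have BB : B < Bn%:R.
  have [B0|B0] := ltP B 0; first by rewrite (lt_le_trans B0).
  by rewrite /Bn; exact: truncnS_gt.
(* Coordinates bounded by B have level n indices between -W and W; shifting by W makes them naturals
   below 2W + 1, so finitely many codes occur. *)
pose W := (Bn * 2 ^ n)%N.
have idx x i : G x != 0 -> - W%:Z <= cell_index n x i <= W%:Z.
  move=> Gx; have Dx : D x by apply: contrapT => /GD Gx0; rewrite Gx0 eqxx in Gx.
  have := DB Dx i; rewrite ler_norml => /andP[l u].
  have n0 : 0 < 2 ^+ n :> R by rewrite exprn_gt0.
  rewrite /cell_index real_floor_ge_int ?num_real// -ltzD1 real_floor_lt_int ?num_real//.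
  rewrite intrD mulrNz /W -!pmulrn natrM natrX.
  have u' : 2 ^+ n * (x : 'rV[R]_d) ord0 i <= 2 ^+ n * Bn%:R.
    by rewrite ler_pM2l// (le_trans u)// ltW.
  have l' : 2 ^+ n * (- Bn%:R) <= 2 ^+ n * (x : 'rV[R]_d) ord0 i.
    by rewrite ler_pM2l// (le_trans _ l)// lerN2 ltW.
  move: u' l'; rewrite mulrN (mulrC _ Bn%:R) => u' l'.
  by rewrite l'/= (le_lt_trans u')// ltrDl.
pose code (x : lebT) : {ffun 'I_d -> 'I_(2 * W).+1} :=
  [ffun i => inord (absz (cell_index n x i + W%:Z))].
have codeP x y : G x != 0 -> G y != 0 -> code x = code y -> dyadic_cells n (x, y).
  move=> Gx Gy /ffunP xy i /=; have := xy i; rewrite !ffunE => /(congr1 val) /=.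
  have /andP[x1 x2] := idx x i Gx; have /andP[y1 y2] := idx y i Gy.
  have bd (z : int) : - W%:Z <= z -> z <= W%:Z -> (absz (z + W%:Z)%R < (2 * W).+1)%N.
    move=> z1 z2; rewrite ltnS -lez_nat gez0_abs; last by rewrite -lerBlDr sub0r.
    by rewrite mul2n -addnn PoszD lerD2r.
  rewrite !inordK ?bd// => /(congr1 Posz).
  rewrite !gez0_abs; [|by rewrite -lerBlDr sub0r|by rewrite -lerBlDr sub0r].
  exact: addIr.
exists #|{: {ffun 'I_d -> 'I_(2 * W).+1}}|.
(* A code attained where G is nonzero is represented by such a point; every other code receives the
   default [point], which does no harm. *)
exists (fun j => xget point [set x : lebT | G x != 0 /\ code x = enum_val j]) => x Gx.
exists (enum_rank (code x)).
have := @xgetPex _ point [set y : lebT | G y != 0 /\ code y = enum_val (enum_rank (code x))].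
rewrite enum_rankK => -[]; first by exists x.
by move=> Gy cy; exact: codeP.
Qed.

Local Notation sq := (wsq leb setT (cst 1%R)).
Local Notation semi u := (wsq (leb \x leb)%E setT K (fun z => u z.1 - u z.2)).

Lemma frac_weighted_bound : exists c, 0 <= c /\ forall (u : lebT -> R) M H,
  measurable_fun setT u -> (sq u <= M%:E)%E -> (semi u <= H%:E)%E ->
  (wsq leb setT G u <= (c * (M + H))%:E)%E.
Proof.
have mK := @measurable_frac_kernel R d s.
have K0 (z : lebT * lebT) : 0 <= K z by exact: frac_kernel_ge0.
pose C := 4 * (1 + I) * gam * cd.
pose tail := 2 * (1 + theta) / (1 - theta) ^+ 2 * C.
have [th0 th1] := andP theta01.
have IG0 : 0 <= m + I.
  by rewrite -lee_fin; apply: le_trans intG; apply: integral_ge0 => x _; rewrite lee_fin.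
have tail0 : 0 <= tail.
  rewrite !mulr_ge0 ?invr_ge0 ?sqr_ge0 ?powR_ge0 ?addr_ge0 ?(ltW th0)//.
have vI : 0 <= (v 0)^-1 * (m + I) by rewrite mulr_ge0// invr_ge0 ltW.
exists (2 * tail + 2 * ((v 0)^-1 * (m + I))); split.
  by rewrite addr_ge0// mulr_ge0.
move=> u M H mu_ uM uH.
have M0 : 0 <= M by rewrite -lee_fin; apply: le_trans uM; apply: wsq_ge0.
have H0 : 0 <= H.
  by rewrite -lee_fin; apply: le_trans uH; apply: wsq_ge0 => z _; exact: K0.
apply: (le_trans (wG_bound v0 (@measurable_dyadic_cells R d)
  (@dyadic_cells_sym R d) (@dyadic_cells_trans R d) (@dyadic_cells_nested R d)
  (@leb_dyadic_cell R d) mK K0 k0 Kk mG G0 intG Gg theta01 rateA rateC mu_ uM uH)).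
rewrite lee_fin -/C -/tail.
have := mulr_ge0 tail0 M0; have := mulr_ge0 vI H0; lra.
Qed.

Lemma frac_weighted_compact (u_ : nat -> lebT -> R) M H :
  (forall i, measurable_fun setT (u_ i)) -> (forall i, (sq (u_ i) <= M%:E)%E) ->
  (forall i, (semi (u_ i) <= H%:E)%E) ->
  exists2 f : nat -> nat, (forall i, (i <= f i)%N) &
    forall i j, (i <= j)%N ->
    (wsq leb setT G (u_ (f j) \- u_ (f i))%R <= (2^-1 ^+ i)%:E)%E.
Proof.
have mK := @measurable_frac_kernel R d s.
have K0 (z : lebT * lebT) : 0 <= K z by exact: frac_kernel_ge0.
exact: (wG_compact v0 (@measurable_dyadic_cells R d)
  (@dyadic_cells_sym R d) (@dyadic_cells_trans R d) (@dyadic_cells_nested R d)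
  (@leb_dyadic_cell R d) mK K0 k0 Kk mG G0 intG Gg theta01 rateA rateC cover).
Qed.

End fractional_compactness.

(** * The spaces H^s and tilde H^s *)

Lemma poweR_half_lt (R : realType) (x : \bar R) (e : R) : (0 <= x)%E -> 0 < e ->
  (x `^ 2^-1 < e%:E)%E = (x < (e ^+ 2)%:E)%E.
Proof.
case: x => [x| |] //= x0 e0; last first.
  by rewrite /poweR invr_eq0 pnatr_eq0.
rewrite lee_fin in x0; rewrite !lte_fin powR12_sqrt//.
by rewrite -[X in _ < X]ger0_norm ?(ltW e0)// -sqrtr_sqr ltr_sqrt// exprn_gt0.
Qed.

Section Lfun2.
Context d (T : measurableType d) (R : realType) (mu : {measure set T -> \bar R}).

Lemma Lfun2P (f : T -> R) :
  f \in Lfun mu 2%:E <-> measurable_fun setT f /\ (wsq mu setT (cst 1%R) f < +oo)%E.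
Proof.
have E : (wsq mu setT (cst 1%R) f = \int[mu]_x (`|(f x)%:E| `^ 2))%E.
  by apply: eq_integral => x _ /=; rewrite mulr1 powR_mulrn// real_normK ?num_real.
rewrite inE; split=> [/andP[]|[mf fy]].
  rewrite !inE/= => mf; rewrite /finite_norm => fy; split=> //.
  rewrite E -poweR_Lnorm//; exact: poweR_lty.
apply/andP; rewrite !inE/=; split => //; rewrite /finite_norm.
by rewrite unlock -E; exact: poweR_lty.
Qed.

Lemma Lnorm2_sqr (f : T -> R) :
  (fine ('N[mu]_2%:E[EFin \o f])%E) ^+ 2 = fine (wsq mu setT (cst 1%R) f).
Proof.
have E : (wsq mu setT (cst 1%R) f = \int[mu]_x (`|(f x)%:E| `^ 2))%E.
  by apply: eq_integral => x _ /=; rewrite mulr1 powR_mulrn// real_normK ?num_real.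
rewrite E -poweR_Lnorm//.
have := Lnorm_ge0 mu 2%:E (EFin \o f).
case: (Lnorm mu 2%:E (EFin \o f)) => [x| |] //=.
- by rewrite lee_fin => x0; rewrite powR_mulrn.
- by move=> _; rewrite expr0n/= pnatr_eq0.
Qed.

Lemma wsq_restrict (D : set T) (f : T -> R) :
  wsq mu setT (cst 1%R) (f \_ D) = wsq mu D (cst 1%R) f.
Proof.
rewrite /wsq [RHS]integral_mkcond; apply: eq_integral => x _.
by rewrite !patchE; case: ifPn => // _; rewrite expr0n mul0r.
Qed.

End Lfun2.

Section test_functions.
Context (R : realType) (d : nat).
Implicit Types f g : 'rV[R]_d -> R.

Lemma Ck_continuous k f : Ck k f -> continuous f.
Proof. by case: k => [|k] []. Qed.

Lemma CkD k f g : Ck k f -> Ck k g -> Ck k (f + g).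
Proof.
elim: k f g => [|k IH] f g /= [cf df] [cg dg].
  by split=> // x; apply: continuousD; [exact: cf|exact: cg].
split=> [x|i]; first by apply: continuousD; [exact: cf|exact: cg].
have [dfi Cf] := df i; have [dgi Cg] := dg i; split=> [x|]; first exact: derivableD.
rewrite (_ : 'D_ _ _ = 'D_(delta_mx ord0 i) f + 'D_(delta_mx ord0 i) g); first exact: IH.
by apply/funext => x; rewrite deriveD.
Qed.

Lemma CkZ k (c : R) f : Ck k f -> Ck k (c \*: f).
Proof.
elim: k f => [|k IH] f /= [cf df].
  by split=> // x; apply: continuousZl_tmp; exact: cf.
split=> [x|i]; first by apply: continuousZl_tmp; exact: cf.
have [dfi Cf] := df i; split=> [x|]; first exact: derivableZ.
rewrite (_ : 'D_ _ _ = c \*: 'D_(delta_mx ord0 i) f); first exact: IH.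
by apply/funext => x; rewrite deriveZ.
Qed.

Lemma test_functionD Omega f g : test_function Omega f -> test_function Omega g ->
  test_function Omega (f + g).
Proof.
move=> [Cf cf sf] [Cg cg sg].
have sub : closure [set x | (f + g) x != 0] `<=`
    closure [set x | f x != 0] `|` closure [set x | g x != 0].
  rewrite -closureU; apply: closure_subset => x /=.
  have [fx|] := eqVneq (f x) 0; last by left.
  by have [gx|] := eqVneq (g x) 0; [rewrite fctE fx gx addr0 eqxx|right].
split=> [k||x /sub[]]; [exact: CkD| |exact: sf|exact: sg].
apply: subclosed_compact sub; first exact: closed_closure.
exact: compactU.
Qed.

Lemma test_functionZ Omega (c : R) f : test_function Omega f ->
  test_function Omega (c \*: f).
Proof.
move=> [Cf cf sf].
have sub : closure [set x | (c \*: f) x != 0] `<=` closure [set x | f x != 0].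
  apply: closure_subset => x /=; apply: contra => /eqP ->.
  by rewrite scaler0.
split=> [k||x /sub]; [exact: CkZ| |exact: sf].
by apply: subclosed_compact sub => //; exact: closed_closure.
Qed.

Lemma test_function_eq0 Omega f x : test_function Omega f -> ~ Omega x -> f x = 0.
Proof.
move=> [_ _ sf] nx; apply: contrapT => /eqP fx; apply: nx; apply: sf.
exact: subset_closure.
Qed.

End test_functions.

Section sobolev_space.
Context (R : realType) (d : nat) (s : R).
Local Notation leb := (@lebesgue_rV R d).
Local Notation lebT := (caratheodory_type (borel_lebesgue R d)^*%mu).
Local Notation K := (fun z : lebT * lebT => frac_kernel s (z.1 : 'rV[R]_d) (z.2 : 'rV[R]_d)).
Implicit Types u v : lebT -> R.

Definition sq_norm u : \bar R := wsq leb setT (cst 1%R) u.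
Definition diffs u : lebT * lebT -> R := fun z => u z.1 - u z.2.
Definition seminorm u : \bar R := wsq (leb \x leb)%E setT K (diffs u).
(** The square of [Hs_norm]. Working with it keeps roots of extended reals out of the estimates. *)
Definition energy u : \bar R := (sq_norm u + seminorm u)%E.

Let mK : measurable_fun setT K. Proof. exact: measurable_frac_kernel. Qed.
Let K0 (z : lebT * lebT) : setT z -> 0 <= K z.
Proof. by move=> _; exact: frac_kernel_ge0. Qed.
Let c1 (x : lebT) : setT x -> 0 <= cst (1 : R) x. Proof. by []. Qed.

Lemma measurable_diffs u : measurable_fun setT u -> measurable_fun setT (diffs u).
Proof. by move=> mu; apply: measurable_funB; exact: measurableT_comp. Qed.

Lemma sq_norm_ge0 u : (0 <= sq_norm u)%E.
Proof. exact: wsq_ge0. Qed.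

Lemma seminorm_ge0 u : (0 <= seminorm u)%E.
Proof. exact: wsq_ge0. Qed.

Lemma energy_ge0 u : (0 <= energy u)%E.
Proof. by rewrite adde_ge0 ?sq_norm_ge0 ?seminorm_ge0. Qed.

Lemma energyD_le u v : measurable_fun setT u -> measurable_fun setT v ->
  (energy (u \+ v)%R <= 2%:E * energy u + 2%:E * energy v)%E.
Proof.
move=> mu mv.
have h1 : (sq_norm (u \+ v)%R <= 2%:E * sq_norm u + 2%:E * sq_norm v)%E.
  exact: (wsqD_le leb measurableT (measurable_cst (1 : R)) c1 mu mv).
have h2 : (seminorm (u \+ v)%R <= 2%:E * seminorm u + 2%:E * seminorm v)%E.
  have E : diffs (u \+ v) = (diffs u \+ diffs v)%R.
    by apply/funext => z; rewrite /diffs/=; ring.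
  rewrite /seminorm E.
  exact: (wsqD_le _ measurableT mK K0 (measurable_diffs mu) (measurable_diffs mv)).
rewrite /energy; apply: (le_trans (leeD h1 h2)).
rewrite (ge0_muleDr _ (sq_norm_ge0 u) (seminorm_ge0 u)).
by rewrite (ge0_muleDr _ (sq_norm_ge0 v) (seminorm_ge0 v)) addeACA.
Qed.

Lemma energyZ (c : R) u : measurable_fun setT u ->
  energy (fun x => c * u x) = ((c ^+ 2)%:E * energy u)%E.
Proof.
move=> mu.
have E : diffs (fun x => c * u x) = (fun z => c * diffs u z).
  by apply/funext => z; rewrite /diffs/=; ring.
rewrite /energy /seminorm E /sq_norm wsqZ// wsqZ//; last exact: measurable_diffs.
by rewrite (ge0_muleDr _ (sq_norm_ge0 u) (seminorm_ge0 u)).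
Qed.

Lemma Hs_norm_lt u (e : R) : 0 < e ->
  (Hs_norm s u < e%:E)%E = (energy u < (e ^+ 2)%:E)%E.
Proof.
move=> e0; rewrite -poweR_half_lt ?energy_ge0// /Hs_norm /energy.
suff -> : sq_norm u = (\int[leb]_x (u x ^+ 2)%:E)%E by [].
by apply: eq_integral => x _; rewrite mulr1.
Qed.

Lemma HsP u : Hs s u <-> measurable_fun setT u /\ (energy u < +oo)%E.
Proof.
have E : (Hs_norm s u < +oo)%E <-> (energy u < +oo)%E.
  have -> : Hs_norm s u = (energy u `^ 2^-1)%E.
    congr (_ `^ _)%E; congr (_ + _)%E.
    by apply: eq_integral => x _; rewrite mulr1.
  split; last exact: poweR_lty.
  by apply: lty_poweRy; rewrite invr_eq0.
split=> [[/Lfun2P[mu _] /E]//|[mu ey]].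
split; last exact/E.
by apply/Lfun2P; split => //; apply: le_lt_trans ey; rewrite leeDl ?seminorm_ge0.
Qed.

Section subspace.
Variable Omega : set 'rV[R]_d.
Local Notation V := (tildeHs s Omega).

Lemma tildeHs_measurable u : V u -> measurable_fun setT u.
Proof. by move=> [/HsP[]]. Qed.

Lemma tildeHs_energy u : V u -> (energy u < +oo)%E.
Proof. by move=> [/HsP[]]. Qed.

Lemma tildeHs_sq u : V u -> (sq_norm u < +oo)%E.
Proof.
by move=> /tildeHs_energy; apply: le_lt_trans; rewrite leeDl ?seminorm_ge0.
Qed.

Lemma tildeHs_seminorm u : V u -> (seminorm u < +oo)%E.
Proof.
by move=> /tildeHs_energy; apply: le_lt_trans; rewrite leeDr ?sq_norm_ge0.
Qed.

Lemma test_measurable (f : lebT -> R) : test_function Omega f -> measurable_fun setT f.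
Proof. by move=> [/(_ 0%N) Cf _ _]; apply: continuous_measurable; exact: Ck_continuous Cf. Qed.

Lemma tildeHsP u : V u <-> [/\ measurable_fun setT u, (energy u < +oo)%E &
  forall e : R, 0 < e -> exists2 f, test_function Omega f & (energy (u \- f)%R < e%:E)%E].
Proof.
split=> [[/HsP[mu ey] H]|[mu ey H]]; split => //.
- move=> e e0; have se0 : 0 < Num.sqrt e by rewrite sqrtr_gt0.
  have [f tf] := H _ se0; rewrite Hs_norm_lt// sqr_sqrtr ?(ltW e0)// => uf.
  by exists f.
- exact/HsP.
- move=> e e0; have [f tf uf] := H (e ^+ 2) (exprn_gt0 _ e0).
  by exists f => //; rewrite Hs_norm_lt.
Qed.

Lemma tildeHsD u v : V u -> V v -> V (u \+ v)%R.
Proof.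
move=> /tildeHsP[mu uy Hu] /tildeHsP[mv vy Hv]; apply/tildeHsP; split.
- exact: measurable_funD.
- by apply: (le_lt_trans (energyD_le mu mv)); rewrite lte_add_pinfty// lte_mul_pinfty.
- move=> e e0; have e40 : 0 < e / 4 by rewrite divr_gt0.
  have [f tf uf] := Hu _ e40; have [g tg vg] := Hv _ e40.
  exists (f + g); first exact: test_functionD.
  have -> : ((u \+ v) \- (f + g)%R)%R = ((u \- f) \+ (v \- g))%R.
    by apply/funext => x; rewrite /= fctE; ring.
  have mf := test_measurable tf; have mg := test_measurable tg.
  apply: (le_lt_trans (energyD_le (measurable_funB mu mf) (measurable_funB mv mg))).
  have -> : e%:E = (2%:E * (e / 4)%:E + 2%:E * (e / 4)%:E)%E.
    by rewrite -EFinM -EFinD; congr EFin; lra.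
  by apply: lteD; rewrite lte_pmul2l.
Qed.

Lemma tildeHsZ (c : R) u : V u -> V (fun x => c * u x).
Proof.
move=> /tildeHsP[mu uy Hu]; apply/tildeHsP; split.
- exact: measurable_funM.
- by rewrite energyZ// lte_mul_pinfty// lee_fin sqr_ge0.
- move=> e e0; have c0 : 0 < c ^+ 2 + 1 by rewrite ltr_wpDl ?sqr_ge0.
  have [f tf uf] := Hu _ (divr_gt0 e0 c0).
  exists (c \*: f); first exact: test_functionZ.
  have mf := test_measurable tf.
  have -> : ((fun x => c * u x) \- (c \*: f))%R = (fun x => c * (u \- f) x)%R.
    by apply/funext => x /=; rewrite mulrBr.
  rewrite energyZ; last exact: measurable_funB.
  apply: (@le_lt_trans _ _ ((c ^+ 2)%:E * (e / (c ^+ 2 + 1))%:E)%E).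
    by apply: lee_wpmul2l; [rewrite lee_fin sqr_ge0|exact: ltW].
  rewrite -EFinM lte_fin mulrA ltr_pdivrMr// mulrDr mulr1 mulrC.
  by rewrite ltrDl.
Qed.

Lemma tildeHsB u v : V u -> V v -> V (u \- v)%R.
Proof.
move=> Vu Vv; have := tildeHsD Vu (tildeHsZ (-1) Vv).
by congr (V _); apply/funext => x /=; rewrite mulN1r.
Qed.

Lemma tildeHs_closed u : measurable_fun setT u ->
  (forall e : R, 0 < e -> exists2 v, V v & (energy (u \- v)%R < e%:E)%E) -> V u.
Proof.
move=> mu H; apply/tildeHsP; split => //.
- have [v Vv uv] := H 1 ltr01; have mv := tildeHs_measurable Vv.
  have -> : u = ((u \- v) \+ v)%R by apply/funext => x /=; rewrite subrK.
  apply: (le_lt_trans (energyD_le (measurable_funB mu mv) mv)).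
  rewrite lte_add_pinfty// lte_mul_pinfty//; last exact: tildeHs_energy Vv.
  by apply: (lt_trans uv); rewrite ltry.
- move=> e e0; have e40 : 0 < e / 4 by rewrite divr_gt0.
  have [v Vv uv] := H _ e40.
  have /tildeHsP[mv _ /(_ _ e40)[f tf vf]] := Vv.
  have mf := test_measurable tf.
  exists f => //.
  have -> : (u \- f)%R = ((u \- v) \+ (v \- f))%R.
    by apply/funext => x; rewrite /= addrA subrK.
  apply: (le_lt_trans (energyD_le (measurable_funB mu mv) (measurable_funB mv mf))).
  have -> : e%:E = (2%:E * (e / 4)%:E + 2%:E * (e / 4)%:E)%E.
    by rewrite -EFinM -EFinD; congr EFin; lra.
  by apply: lteD; rewrite lte_pmul2l.
Qed.

(** A test function f vanishes outside Omega, so there the square of u is that of u - f, whose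
    integral can be made arbitrarily small. *)
Lemma tildeHs_out u : measurable (Omega : set lebT) -> V u ->
  {ae leb, forall x, ~ Omega x -> u x = 0}.
Proof.
move=> mO Vu; have /tildeHsP[mu _ H] := Vu.
have mC : measurable (~` Omega : set lebT) by exact: measurableC.
suff : wsq leb (~` Omega) (cst 1%R) u = 0%E.
  by apply: wsq1_eq0 => //; exact: measurable_funTS.
apply/eqP; rewrite eq_le; apply/andP; split; last exact: wsq_ge0.
apply/lee_addgt0Pr => e e0; rewrite add0e.
have [f tf uf] := H e e0.
rewrite (_ : wsq _ _ _ _ = wsq leb (~` Omega) (cst 1%R) (u \- f)%R); last first.
  apply: eq_integral => x /set_mem nx /=.
  by rewrite (test_function_eq0 tf nx) subr0.
apply: (le_trans _ (ltW uf)); apply: (@le_trans _ _ (sq_norm (u \- f)%R)).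
  have muf : measurable_fun setT (u \- f)%R by apply: measurable_funB => //; exact: test_measurable.
  exact: (wsq_subset leb measurableT (measurable_cst (1 : R)) c1 mC (@subsetT _ _) muf).
by rewrite leeDl ?seminorm_ge0.
Qed.

End subspace.
End sobolev_space.

(** * The linearized equation *)

Section weighted_bilinear.
Context d (T : measurableType d) (R : realType) (mu : {measure set T -> \bar R}).
Context (D : set T) (mD : measurable D) (W : T -> R).
Hypothesis mW : measurable_fun D W.
Hypothesis W0 : forall x, D x -> 0 <= W x.
Implicit Types f g : T -> R.
Local Notation q := (wsq mu D W).

Definition wip f g : R := \int[mu]_(x in D) (f x * g x * W x).

Definition sq_int f := measurable_fun D f /\ (q f < +oo)%E.

Lemma sq_int_integrable f g : sq_int f -> sq_int g ->
  mu.-integrable D (EFin \o (fun x => f x * g x * W x)).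
Proof. by move=> [mf qf] [mg qg]; exact: wsq_mul_integrable. Qed.

Lemma sq_intD f g : sq_int f -> sq_int g -> sq_int (f \+ g)%R.
Proof.
by move=> [mf qf] [mg qg]; split; [exact: measurable_funD|exact: wsqD_lty].
Qed.

Lemma sq_intB f g : sq_int f -> sq_int g -> sq_int (f \- g)%R.
Proof.
by move=> [mf qf] [mg qg]; split; [exact: measurable_funB|exact: wsqB_lty].
Qed.

Lemma sq_intZ (c : R) f : sq_int f -> sq_int (fun x => c * f x).
Proof.
by move=> [mf qf]; split; [exact: measurable_funM|exact: wsqZ_lty].
Qed.

Lemma wipDl f1 f2 g : sq_int f1 -> sq_int f2 -> sq_int g ->
  wip (f1 \+ f2)%R g = wip f1 g + wip f2 g.
Proof.
move=> sf1 sf2 sg; rewrite /wip -RintegralD//; try exact: sq_int_integrable.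
by apply: eq_Rintegral => x _ /=; ring.
Qed.

Lemma wipZl (c : R) f g : sq_int f -> sq_int g -> wip (fun x => c * f x) g = c * wip f g.
Proof.
move=> sf sg; rewrite /wip -RintegralZl//; try exact: sq_int_integrable.
by apply: eq_Rintegral => x _ /=; ring.
Qed.

Lemma wipBl f1 f2 g : sq_int f1 -> sq_int f2 -> sq_int g ->
  wip (f1 \- f2)%R g = wip f1 g - wip f2 g.
Proof.
move=> sf1 sf2 sg; rewrite /wip -RintegralB//; try exact: sq_int_integrable.
by apply: eq_Rintegral => x _ /=; ring.
Qed.

Lemma wip_diag f : wip f f = fine (q f).
Proof. by rewrite /wip /Rintegral; congr fine; apply: eq_integral => x _. Qed.

(** The Cauchy-Schwarz inequality in Young form: the caller chooses [e], to absorb a term or to let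
    an error tend to 0. *)
Lemma wip_le (e : R) f g : 0 < e -> sq_int f -> sq_int g ->
  `|wip f g| <= (e * fine (q f) + e^-1 * fine (q g)) / 2.
Proof.
move=> e0 sf sg; rewrite -!wip_diag.
have If := sq_int_integrable sf sf; have Ig := sq_int_integrable sg sg.
have Ifg := sq_int_integrable sf sg.
apply: (le_trans (le_normr_Rintegral mD Ifg)).
rewrite -(wipZl e sf sf) -(wipZl e^-1 sg sg) /wip.
have I1 := sq_int_integrable (sq_intZ e sf) sf.
have I2 := sq_int_integrable (sq_intZ e^-1 sg) sg.
rewrite -RintegralD// mulrC -RintegralZl//; last exact: (integrableD mD I1 I2).
apply: le_Rintegral => //.
- exact: integrable_norm.
- have := integrableZl mD 2^-1 (integrableD mD I1 I2).
  by apply: eq_integrable.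
- move=> x Dx; rewrite normrM (ger0_norm (W0 Dx)).
  have := young_mul (f x) (g x) e0; have := W0 Dx.
  move: (f x * g x) => y w0 h.
  have := ler_wpM2r w0 h; rewrite !expr2; lra.
Qed.

End weighted_bilinear.

Lemma wsq_cst d (T : measurableType d) (R : realType) (mu : {measure set T -> \bar R})
    (D : set T) (c : R) (f : T -> R) : measurable D -> 0 <= c -> measurable_fun D f ->
  wsq mu D (cst c) f = (c%:E * wsq mu D (cst 1%R) f)%E.
Proof.
move=> mD c0 mf; rewrite /wsq -ge0_integralZl_EFin//.
- by apply: eq_integral => x _; rewrite -EFinM /= mulr1 mulrC.
- by move=> x _; rewrite lee_fin mulr1 sqr_ge0.
- by apply/measurable_EFinP; apply: measurable_funM => //; exact: measurable_funX.
Qed.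

(** * A fractional Poincaré inequality on bounded sets *)

Section poincare.
Context (R : realType) (d : nat) (s : R).
Hypothesis d0 : (0 < d)%N.
Hypothesis s0 : 0 < s.
Local Notation leb := (@lebesgue_rV R d).
Local Notation lebT := (caratheodory_type (borel_lebesgue R d)^*%mu).
Local Notation K := (fun z : lebT * lebT => frac_kernel s (z.1 : 'rV[R]_d) (z.2 : 'rV[R]_d)).
Context (Omega : set 'rV[R]_d) (B : R).
Hypothesis mO : measurable (Omega : set lebT).
Hypothesis OB : forall x, Omega x -> forall i, `|x ord0 i| <= B.

(* Compare with the values on a unit cell lying at a positive distance from
   Omega, where u vanishes. *)
Lemma poincare : exists2 c, 0 < c & forall u : lebT -> R, tildeHs s Omega u ->
  (sq_norm u <= c%:E * seminorm s u)%E.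
Proof.
pose N := (Num.truncn B).+1.
have BN : B < N%:R.
  have [B0|B0] := ltP B 0; first by rewrite (lt_le_trans B0).
  by rewrite /N; exact: truncnS_gt.
(* The level 0 cell of this point is the cube [N, N+1)^d. It misses Omega because B < N, and each
   coordinate difference between its points and those of Omega is at most [b]. *)
pose p : lebT := (const_mx N%:R : 'rV[R]_d).
pose F : set lebT := xsection (@dyadic_cells R d 0) p.
have mF : measurable F by apply: measurable_xsection; exact: measurable_dyadic_cells.
have muF : leb F = 1%E by rewrite leb_dyadic_cell expr0 expr1n.
have Fy (y : lebT) : F y -> forall i, N%:R <= (y : 'rV[R]_d) ord0 i < N%:R + 1.
  rewrite /F /xsection/= inE => Fy i; have := Fy i; rewrite /= /cell_index mxE.
  have N_int : N%:R = (N%:Z)%:~R :> R by [].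
  rewrite expr0 !mul1r N_int intrKfloor => /esym/eqP.
  by rewrite real_floor_eq ?num_real// intrD.
pose b : R := `|B| + N%:R + 1.
have b0 : 0 < b by rewrite ltr_wpDl// addr_ge0.
pose kap : R := (Num.sqrt d%:R `^ (d%:R + 2 * s) * b `^ (d%:R + 2 * s))^-1.
have kap0 : 0 < kap.
  by rewrite invr_gt0 mulr_gt0// powR_gt0// sqrtr_gt0 ltr0n.
have Kkap (x y : lebT) : Omega x -> F y -> kap <= K (x, y).
  move=> Ox /Fy Fy'; apply: frac_kernel_ge => //=.
    move=> xy; have /andP[+ _] := Fy' (Ordinal d0); rewrite -xy leNgt => /negP; apply.
    by apply: le_lt_trans BN; apply: le_trans (OB Ox (Ordinal d0)); exact: ler_norm.
  move=> i; have /andP[y1 y2] := Fy' i; have := OB Ox i; rewrite ler_norml => /andP[x1 x2].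
  have := ler_norm B; rewrite /b ler_norml; lra.
have FO (y : lebT) : F y -> ~ Omega y.
  move=> /Fy /(_ (Ordinal d0)) /andP[y1 _] Oy.
  have := OB Oy (Ordinal d0); rewrite ler_norml => /andP[_]; lra.
exists kap^-1 => [|u Vu]; first by rewrite invr_gt0.
have mu := tildeHs_measurable Vu.
have /ae_prod uO := tildeHs_out mO Vu.
suff : (kap%:E * sq_norm u <= seminorm s u)%E.
  move=> H; have -> : sq_norm u = ((kap^-1)%:E * (kap%:E * sq_norm u))%E.
    by rewrite muleA -EFinM mulVf ?gt_eqF// mul1e.
  by apply: lee_wpmul2l => //; rewrite lee_fin invr_ge0 ltW.
(* [F] has measure 1, so integrating [G] in its second variable gives back kap times u^2. For x in
   Omega and y in F the difference u x - u y is almost everywhere u x, which compares [G] with the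
   integrand of the seminorm. *)
pose G (z : lebT * lebT) : R := u z.1 ^+ 2 * (kap * \1_F z.2).
have mG : measurable_fun setT G.
  apply: measurable_funM; first by apply: measurable_funX; exact: measurableT_comp.
  by apply: measurable_funM => //; apply: measurableT_comp.
have G0 z : 0 <= G z by rewrite mulr_ge0 ?sqr_ge0// mulr_ge0// ltW.
apply: (@le_trans _ _ (\int[(leb \x leb)%E]_z (G z)%:E)%E).
  rewrite (@fubini_tonelli1 _ _ lebT lebT R leb leb (fun z => (G z)%:E))//; last first.
    exact/measurable_EFinP.
  rewrite /sq_norm -(wsq_cst leb measurableT (ltW kap0) mu) /wsq.
  rewrite le_eqVlt; apply/orP; left; apply/eqP; apply: eq_integral => x _.
  have iF : (\int[leb]_y (\1_F y)%:E = 1)%E.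
    by rewrite integral_indic// setIT [LHS]muF.
  transitivity ((u x ^+ 2 * kap)%:E * \int[leb]_y (\1_F y)%:E)%E.
    by rewrite iF mule1.
  rewrite -ge0_integralZl_EFin; first by apply: eq_integral => y _; rewrite /G/= -EFinM mulrA.
  - exact: measurableT.
  - by move=> y _; rewrite lee_fin.
  - exact/measurable_EFinP.
  - by rewrite mulr_ge0 ?sqr_ge0// ltW.
apply: ae_ge0_le_integral => //.
- by move=> z _; rewrite lee_fin.
- exact/measurable_EFinP.
- by move=> z _; rewrite lee_fin mulr_ge0 ?sqr_ge0// frac_kernel_ge0.
- by apply: measurable_wsq; [exact: measurable_frac_kernel|exact: measurable_diffs].
apply: filterS uO => -[x y] /= [ux uy] _; rewrite lee_fin /G /diffs/= indicE.
have [/set_mem Fy'|_] := boolP (y \in F); last first.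
  by rewrite mulr0 mulr0 mulr_ge0 ?sqr_ge0// frac_kernel_ge0.
rewrite (uy (FO _ Fy')) subr0 mulr1.
have [Ox|/ux ->] := pselect (Omega x); last by rewrite expr0n !mul0r.
by rewrite ler_wpM2l ?sqr_ge0//; exact: Kkap.
Qed.

End poincare.

(** The Young parameter 2c/k is chosen so that the term in [n] is at most k/4 times [S], half of
    what the left side provides. *)
Lemma coercivity_estimate (R : realFieldType) (k c S a W n : R) :
  0 < k -> 0 < c -> 0 <= a -> n <= c * S ->
  k / 2 * S + a <= (2 * c / k * W + (2 * c / k)^-1 * n) / 2 ->
  S <= 4 * c / k ^+ 2 * W.
Proof.
move=> k0 c0 a0 nS; rewrite invf_div => le1.
have n1 : k / (2 * c) * n <= k / 2 * S.
  apply: (@le_trans _ _ (k / (2 * c) * (c * S))).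
    by apply: ler_wpM2l => //; rewrite divr_ge0 ?(ltW k0)// mulr_ge0// ltW.
  rewrite le_eqVlt; apply/orP; left; apply/eqP; field; rewrite gt_eqF//.
have n2 : k / 4 * S <= c / k * W by lra.
rewrite -(ler_pM2l (_ : 0 < k / 4)) ?divr_gt0//; apply: (le_trans n2).
rewrite le_eqVlt; apply/orP; left; apply/eqP; field.
by rewrite !gt_eqF.
Qed.

Lemma residual_split (R : realFieldType) (k a b e f w w' : R) : k * a + e = w ->
  k * b + f - w' = w - w' - k * (a - b) - (e - f).
Proof. by move=> <-; ring. Qed.

(** The quantities [r*] are squared errors of order e^2 and the [q*] belong to a fixed test
    function. Young's inequality with parameter e^-1 divides the former by e and multiplies the
    latter by e. *)
Lemma residual_bound (R : realFieldType) (k e o ka a qo qk qa ro rk ra t1 t2 t3 : R) :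
  0 <= k ->
  `|a| <= (e^-1 * ra + e * qa) / 2 -> `|ka| <= (e^-1 * rk + e * qk) / 2 ->
  `|o| <= (e^-1 * ro + e * qo) / 2 ->
  e^-1 * ro <= t1 * e -> e^-1 * rk <= t2 * e -> e^-1 * ra <= t3 * e ->
  `|o - k * ka - a| <= ((qo + k * qk + qa) / 2 + (t1 + k * t2 + t3) / 2) * e.
Proof.
move=> k0 hA hK hO p1 p2 p3.
have hK' := ler_wpM2l k0 hK; have p2' := ler_wpM2l k0 p2.
have := ler_normB (o - k * ka) a; have := ler_normB o (k * ka).
rewrite (normrM k) (ger0_norm k0); lra.
Qed.

Section linear_state.
Context (R : realType) (d : nat) (s : R).
Hypothesis d0 : (0 < d)%N.
Hypothesis s0 : 0 < s.
Hypothesis cds_gt0 : 0 < cds d s.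
Local Notation leb := (@lebesgue_rV R d).
Local Notation lebT := (caratheodory_type (borel_lebesgue R d)^*%mu).
Local Notation K := (fun z : lebT * lebT => frac_kernel s (z.1 : 'rV[R]_d) (z.2 : 'rV[R]_d)).
Context (Omega : set 'rV[R]_d) (B : R).
Hypothesis mO : measurable (Omega : set lebT).
Hypothesis OB : forall x, Omega x -> forall i, `|x ord0 i| <= B.
Context (A : lebT -> R) (Ca : R).
Hypothesis mA : measurable_fun (Omega : set lebT) A.
Hypothesis A0 : forall x : lebT, Omega x -> 0 <= A x.
Hypothesis ACa : forall x : lebT, Omega x -> A x <= Ca.
Local Notation V := (tildeHs s Omega).
Local Notation L2O := (sq_int leb (Omega : set lebT) (cst 1)).
Local Notation nO w := (wsq leb (Omega : set lebT) (cst 1%R) w).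
Local Notation ipO := (wip leb (Omega : set lebT) (cst 1%R)).
Local Notation ipA := (wip leb (Omega : set lebT) A).
Local Notation ipK u v := (wip (leb \x leb)%E setT K (diffs u) (diffs v)).

Let mK : measurable_fun setT K. Proof. exact: measurable_frac_kernel. Qed.
Let K0 (z : lebT * lebT) : setT z -> 0 <= K z.
Proof. by move=> _; exact: frac_kernel_ge0. Qed.
Let m1 : measurable_fun (Omega : set lebT) (cst (1 : R)). Proof. by []. Qed.
Let c1 (x : lebT) : Omega x -> 0 <= cst (1 : R) x. Proof. by []. Qed.

Lemma tildeHs_sq_int u : V u -> sq_int (leb \x leb)%E setT K (diffs u).
Proof.
move=> Vu; split; last exact: tildeHs_seminorm Vu.
exact: measurable_diffs (tildeHs_measurable Vu).
Qed.

Lemma nO_le_sq_norm (u : lebT -> R) : measurable_fun setT u -> (nO u <= sq_norm u)%E.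
Proof.
move=> mu; exact: (wsq_subset leb measurableT (measurable_cst (1 : R)) (fun _ _ => ler01) mO (@subsetT _ _) mu).
Qed.

Lemma tildeHs_L2O u : V u -> L2O u.
Proof.
move=> Vu; have mu := tildeHs_measurable Vu; split; first exact: measurable_funTS.
by apply: (le_lt_trans (nO_le_sq_norm mu)); exact: tildeHs_sq Vu.
Qed.

Lemma wsqA_le u : measurable_fun (Omega : set lebT) u ->
  (wsq leb (Omega : set lebT) A u <= (`|Ca|)%:E * nO u)%E.
Proof.
move=> mu; apply: (wsq_weight_le leb mO mA A0 _ _ mu) => // x Ox.
by apply: le_trans (ACa Ox) _; exact: ler_norm.
Qed.

Lemma L2O_sq_intA u : L2O u -> sq_int leb (Omega : set lebT) A u.
Proof.
move=> [mu uy]; split => //; apply: (le_lt_trans (wsqA_le mu)).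
by rewrite lte_mul_pinfty// lee_fin.
Qed.

Lemma calAE u v : calA s u v = cds d s / 2 * ipK u v.
Proof. by []. Qed.

Definition linear_state (w phi : lebT -> R) := V phi /\
  forall v, V v -> cds d s / 2 * ipK phi v + ipA phi v = ipO w v.

Lemma diffsD u v : diffs (u \+ v)%R = (diffs u \+ diffs v)%R :> (lebT * lebT -> R).
Proof. by apply/funext => z; rewrite /diffs/=; ring. Qed.

Lemma diffsB u v : diffs (u \- v)%R = (diffs u \- diffs v)%R :> (lebT * lebT -> R).
Proof. by apply/funext => z; rewrite /diffs/=; ring. Qed.

Lemma diffsZ (c : R) u : diffs (fun x => c * u x) = (fun z => c * diffs u z) :> (lebT * lebT -> R).
Proof. by apply/funext => z; rewrite /diffs/=; ring. Qed.

Lemma linear_stateD w1 w2 phi1 phi2 : L2O w1 -> L2O w2 ->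
  linear_state w1 phi1 -> linear_state w2 phi2 ->
  linear_state (w1 \+ w2)%R (phi1 \+ phi2)%R.
Proof.
move=> W1 W2 [V1 H1] [V2 H2]; split=> [|v Vv]; first exact: tildeHsD.
have vO := tildeHs_L2O Vv.
have := H1 v Vv; have := H2 v Vv.
have O1 := tildeHs_L2O V1; have O2 := tildeHs_L2O V2.
rewrite diffsD (wipDl measurableT mK K0 (tildeHs_sq_int V1) (tildeHs_sq_int V2) (tildeHs_sq_int Vv)).
rewrite (wipDl mO mA A0 (L2O_sq_intA O1) (L2O_sq_intA O2) (L2O_sq_intA vO)) (wipDl mO m1 c1 W1 W2 vO).
lra.
Qed.

Lemma linear_stateZ (c : R) w phi : L2O w -> linear_state w phi ->
  linear_state (fun x => c * w x) (fun x => c * phi x).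
Proof.
move=> W1 [V1 H1]; split=> [|v Vv]; first exact: tildeHsZ.
have vO := tildeHs_L2O Vv; have O1 := tildeHs_L2O V1.
rewrite diffsZ (wipZl measurableT mK K0 c (tildeHs_sq_int V1) (tildeHs_sq_int Vv)).
rewrite (wipZl mO mA A0 c (L2O_sq_intA O1) (L2O_sq_intA vO)) (wipZl mO m1 c1 c W1 vO).
by rewrite -(H1 v Vv) mulrDr (mulrCA (cds d s / 2)).
Qed.

Lemma linear_stateB w1 w2 phi1 phi2 : L2O w1 -> L2O w2 ->
  linear_state w1 phi1 -> linear_state w2 phi2 ->
  linear_state (w1 \- w2)%R (phi1 \- phi2)%R.
Proof.
move=> W1 W2 S1 S2.
have := linear_stateD W1 (sq_intZ mO m1 c1 (-1) W2) S1 (linear_stateZ (-1) W2 S2).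
by congr linear_state; apply/funext => x /=; rewrite mulN1r.
Qed.

(** Test the equation with [phi] itself. The zero order term is nonnegative, and the Poincaré
    inequality lets the seminorm absorb the contribution of [phi] on the right. *)
Lemma linear_state_energy : exists2 C, 0 <= C & forall w phi, L2O w ->
  linear_state w phi -> (energy s phi <= (C * fine (nO w))%:E)%E.
Proof.
have [c c0 Hc] := poincare d0 s0 mO OB.
pose k := cds d s.
exists ((1 + c) * (4 * c / k ^+ 2)).
  by rewrite mulr_ge0// ?divr_ge0 ?sqr_ge0 ?mulr_ge0 ?addr_ge0 ?(ltW c0).
move=> w phi W [Vp Hp].
have Op := tildeHs_L2O Vp.
have mp := tildeHs_measurable Vp.
have Sp : seminorm s phi \is a fin_num.
  by rewrite ge0_fin_numE ?seminorm_ge0//; exact: tildeHs_seminorm Vp.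
have Qp : sq_norm phi \is a fin_num.
  by rewrite ge0_fin_numE ?sq_norm_ge0//; exact: tildeHs_sq Vp.
have := Hp phi Vp; rewrite !wip_diag -/(seminorm s phi) => E.
have A_ge0 : 0 <= fine (wsq leb (Omega : set lebT) A phi).
  by apply: fine_ge0; exact: wsq_ge0.
have t0 : 0 < 2 * c / k by rewrite divr_gt0// mulr_gt0.
have := le_trans (ler_norm _) (wip_le mO m1 c1 t0 W Op).
have P1 : fine (sq_norm phi) <= c * fine (seminorm s phi).
  rewrite -lee_fin EFinM !fineK//; exact: Hc.
have P2 : fine (nO phi) <= fine (sq_norm phi).
  apply: fine_le => //; last exact: nO_le_sq_norm.
  exact: (wsq_fin c1 Op.2).
rewrite -E => le1.
have n2 : fine (seminorm s phi) <= 4 * c / k ^+ 2 * fine (nO w).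
  exact: (coercivity_estimate _ c0 A_ge0 (le_trans P2 P1) le1).
rewrite /energy -(fineK Sp) -(fineK Qp) -EFinD lee_fin.
have c10 : 0 <= 1 + c by rewrite addr_ge0// ltW.
rewrite -[leRHS]mulrA; apply: le_trans (ler_wpM2l c10 n2).
by rewrite mulrDl mul1r addrC lerD2l.
Qed.

Lemma energyC (u v : lebT -> R) : measurable_fun setT u -> measurable_fun setT v ->
  energy s (u \- v)%R = energy s (v \- u)%R.
Proof.
move=> mu mv; rewrite (_ : (u \- v)%R = (fun x => -1 * (v \- u)%R x)).
  by rewrite (energyZ s (-1) (measurable_funB mv mu)) sqrrN expr1n mul1e.
by apply/funext => x /=; rewrite mulN1r opprB.
Qed.

Lemma restrictB (f g : lebT -> R) : (f \_ Omega \- g \_ Omega)%R = ((f \- g)%R \_ Omega).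
Proof. by apply/funext => x; rewrite /= !patchE; case: ifPn => //; rewrite subr0. Qed.

(** By linearity, differences of states solve the equation for differences of controls, so the
    energy estimate gives the states the same geometric rate. Both sequences then have almost
    everywhere limits, and the equation passes to the limit. *)
Lemma linear_state_complete (w_ phi_ : nat -> lebT -> R) :
  (forall i, L2O (w_ i)) -> (forall i, linear_state (w_ i) (phi_ i)) ->
  (forall i, fine (nO (w_ i \- w_ i.+1)%R) <= 4^-1 ^+ i) ->
  exists w phi, [/\ L2O w, linear_state w phi,
    {ae leb, forall x, Omega x -> w_ ^~ x @ \oo --> w x} &
    exists c, forall i, fine (nO (w_ i \- w)%R) <= c * 4^-1 ^+ i].
Proof.
move=> W S Wc.
have [C C0 HC] := linear_state_energy.
have q4 : 0 < (4^-1 : R) < 1 by lra.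
have q4' : 0 <= (4^-1 : R) < 1 by lra.
have WcE i : (nO (w_ i \- w_ i.+1)%R <= (4^-1 ^+ i)%:E)%E.
  rewrite -[X in (X <= _)%E]fineK ?lee_fin//.
  by have [_ h] := sq_intB mO m1 c1 (W i) (W i.+1); exact: (wsq_fin c1 h).
(* Controls are measured on Omega only; extension by 0 allows the limit theorem on the whole
   space. *)
pose g i := (w_ i) \_ (Omega : set lebT).
have mg i : measurable_fun setT (g i).
  by apply/(measurable_restrictT _ mO); case: (W i).
have gc i : (wsq leb setT (cst 1%R) (g i \- g i.+1)%R <= (1 * 4^-1 ^+ i)%:E)%E.
  by rewrite mul1r /g restrictB wsq_restrict.
have [w mw gw] := fast_cauchy_limit mg gc.
have wO : {ae leb, forall x, Omega x -> w_ ^~ x @ \oo --> w x}.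
  apply: filterS gw => x + Ox.
  by rewrite (_ : g ^~ x = w_ ^~ x)//; apply/funext => i; rewrite /g patchE mem_set.
have mwO : measurable_fun (Omega : set lebT) w by exact: measurable_funTS.
have mwi i : measurable_fun (Omega : set lebT) (w_ i) by case: (W i).
pose tl := 2 * (1 + 4^-1) / (1 - 4^-1) ^+ 2 : R.
have wiw i : (nO (w_ i \- w)%R <= (tl * 4^-1 ^+ i)%:E)%E.
  have := wsq_geometric_limit mO m1 c1 q4 mwi mwO wO.
  move=> /(_ 1); rewrite -/tl mulr1; apply => j.
  by rewrite mul1r; exact: WcE.
have LB i : L2O (w_ i \- w)%R.
  by split; [exact: measurable_funB|apply: (le_lt_trans (wiw i)); rewrite ltry].
have Lw : L2O w.
  have := sq_intB mO m1 c1 (W 0%N) (LB 0%N); congr sq_int.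
  by apply/funext => x /=; rewrite subKr.
have eB i : (energy s (phi_ i \- phi_ i.+1)%R <= (C * 4^-1 ^+ i)%:E)%E.
  apply: (le_trans (HC _ _ (sq_intB mO m1 c1 (W i) (W i.+1)) (linear_stateB (W i) (W i.+1) (S i) (S i.+1)))).
  by rewrite lee_fin ler_wpM2l.
have Vp i : V (phi_ i) by case: (S i).
have mp i : measurable_fun setT (phi_ i) by exact: tildeHs_measurable (Vp i).
have sB i : (sq_norm (phi_ i \- phi_ i.+1)%R <= (C * 4^-1 ^+ i)%:E)%E.
  by apply: le_trans (eB i); rewrite leeDl ?seminorm_ge0.
have [phi mphi phic] := fast_cauchy_limit mp sB.
have semB i : (wsq (leb \x leb)%E setT K (diffs (phi_ i) \- diffs (phi_ i.+1))%R <= (C * 4^-1 ^+ i)%:E)%E.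
  by rewrite -diffsB; apply: le_trans (eB i); rewrite leeDr ?sq_norm_ge0.
have sqL i : (sq_norm (phi_ i \- phi)%R <= (tl * C * 4^-1 ^+ i)%:E)%E.
  apply: (wsq_geometric_limit measurableT _ _ q4 mp mphi _ sB) => //.
  by apply: filterS phic.
have semL i : (seminorm s (phi_ i \- phi)%R <= (tl * C * 4^-1 ^+ i)%:E)%E.
  rewrite /seminorm diffsB.
  apply: (wsq_geometric_limit (f_ := fun i => diffs (phi_ i)) measurableT mK K0 q4 _ _ _ semB).
  - by move=> j; exact: measurable_diffs.
  - exact: measurable_diffs.
  - apply: filterS (ae_prod phic) => -[x y] /= [hx hy] _.
    exact: cvgB hx hy.
have tl0 : 0 <= tl by rewrite /tl divr_ge0 ?sqr_ge0//; lra.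
have tlC0 : 0 <= tl * C by rewrite mulr_ge0.
have eL i : (energy s (phi_ i \- phi)%R <= (2 * (tl * C) * 4^-1 ^+ i)%:E)%E.
  rewrite -mulrA mulr_natl mulr2n EFinD; exact: leeD.
have Vphi : V phi.
  apply: tildeHs_closed => // e e0.
  have X0 : 0 < 2 * (tl * C) + 1 by rewrite ltr_wpDl// mulr_ge0.
  have [k hk] := geometric_small q4' (divr_gt0 e0 X0).
  exists (phi_ k); first exact: Vp.
  rewrite energyC//; apply: (le_lt_trans (eL k)); rewrite lte_fin.
  apply: (@le_lt_trans _ _ ((2 * (tl * C) + 1) * 4^-1 ^+ k)).
    by rewrite ler_wpM2r ?exprn_ge0 ?invr_ge0// lerDl.
  by move: hk; rewrite ltr_pdivlMr// mulrC.
exists w, phi; split => //; last first.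
  exists tl => i; rewrite -lee_fin fineK//.
  by case: (LB i) => _ h; exact: (wsq_fin c1 h).
split=> // v Vv.
have vO := tildeHs_L2O Vv; have vA := L2O_sq_intA vO; have vK := tildeHs_sq_int Vv.
have VB i := tildeHsB (Vp i) Vphi.
(* The residual of the limit pair, to be shown 0. It does not depend on i, and subtracting the
   equation of the i-th pair expresses it through differences of squared size 4^-i; i is then chosen
   with 4^-i < e^2. [M1] collects the norms of the test function, [M2] those of the errors. *)
pose X := cds d s / 2 * ipK phi v + ipA phi v - ipO w v.
have XE i : X = ipO (w_ i \- w)%R v - cds d s / 2 * ipK (phi_ i \- phi)%R v - ipA (phi_ i \- phi)%R v.
  have [_ /(_ v Vv) H] := S i.
  have Oi := tildeHs_L2O (Vp i); have Op := tildeHs_L2O Vphi.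
  rewrite diffsB (wipBl measurableT mK K0 (tildeHs_sq_int (Vp i)) (tildeHs_sq_int Vphi) vK).
  rewrite (wipBl mO mA A0 (L2O_sq_intA Oi) (L2O_sq_intA Op) vA) (wipBl mO m1 c1 (W i) Lw vO).
  exact: residual_split H.
suff X0 : `|X| <= 0.
  by move: X0; rewrite normr_le0 subr_eq0 => /eqP.
pose kk := cds d s / 2.
have kk0 : 0 <= kk by rewrite divr_ge0// ltW.
pose M1 := (fine (nO v) + kk * fine (seminorm s v) + fine (wsq leb (Omega : set lebT) A v)) / 2.
pose M2 := (tl + kk * (tl * C) + `|Ca| * (tl * C)) / 2.
apply: (@le_eps_mul _ _ (M1 + M2)) => e e0.
have [i hi] : exists i, (4^-1 : R) ^+ i < e ^+ 2.
  exact: geometric_small q4' (exprn_gt0 _ e0).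
have ie0 : 0 < e^-1 by rewrite invr_gt0.
have Li := tildeHs_L2O (VB i).
have := wip_le mO m1 c1 ie0 (LB i) vO.
have := wip_le measurableT mK K0 ie0 (tildeHs_sq_int (VB i)) vK.
have := wip_le mO mA A0 ie0 (L2O_sq_intA Li) vA.
rewrite -/(seminorm s (phi_ i \- phi)%R) -/(seminorm s v) invrK.
have n1 : fine (nO (w_ i \- w)%R) <= tl * e ^+ 2.
  apply: (@le_trans _ _ (tl * 4^-1 ^+ i)); last by rewrite ler_wpM2l// ltW.
  by rewrite -lee_fin fineK ?wiw//; case: (LB i) => _ h; exact: (wsq_fin c1 h).
have n2 : fine (seminorm s (phi_ i \- phi)%R) <= tl * C * e ^+ 2.
  apply: (@le_trans _ _ (tl * C * 4^-1 ^+ i)); last by rewrite ler_wpM2l// ltW.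
  rewrite -lee_fin fineK ?semL// ge0_fin_numE ?seminorm_ge0//.
  exact: tildeHs_seminorm (VB i).
have n3 : fine (wsq leb (Omega : set lebT) A (phi_ i \- phi)%R) <= `|Ca| * (tl * C) * e ^+ 2.
  apply: (@le_trans _ _ (`|Ca| * (tl * C * 4^-1 ^+ i))); last first.
    by rewrite -[leRHS]mulrA ler_wpM2l// ler_wpM2l// ltW.
  rewrite -lee_fin fineK; last by case: (L2O_sq_intA Li) => _ h; exact: (wsq_fin A0 h).
  apply: (le_trans (wsqA_le _)); first by case: Li.
  rewrite EFinM; apply: lee_wpmul2l => //.
  by apply: le_trans (sqL i); apply: nO_le_sq_norm; exact: measurable_funB.
move=> hA hK hO.
have P (a t : R) : a <= t * e ^+ 2 -> e^-1 * a <= t * e.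
  move=> h; rewrite ler_pdivrMl// mulrCA -expr2 //.
have := P _ _ n1; have := P _ _ n2; have := P _ _ n3 => p3 p2 p1.
rewrite (XE i) -/kk.
exact: (residual_bound kk0 hA hK hO p1 p2 p3).
Qed.

End linear_state.

(** * Positivity of C(d, s) *)

Section gamma_positive.
Context (R : realType) (z : R).
Hypothesis z0 : 0 < z.
Local Notation mu := (@lebesgue_measure R).
Local Notation h := (2^-1 : R).
Local Notation f := (fun t : R => t `^ (z - 1) * expR (- t)).

Let h0 : 0 < h. Proof. by rewrite invr_gt0. Qed.
Let hn0 n : 0 < h ^+ n. Proof. exact: exprn_gt0. Qed.

Let F k : set R := `]h ^+ k.+1, h ^+ k]%classic.
Let q : R := h `^ z.
Let c k : R := (h ^+ k.+1)^-1 * q ^+ k.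
Let p : R := z + 1.
Let C : R := 2 * (2 * p) `^ p.

Let p0 : 0 < p. Proof. by rewrite addr_gt0. Qed.

Let c_ge0 k : 0 <= c k.
Proof. by rewrite mulr_ge0 ?invr_ge0 ?exprn_ge0 ?powR_ge0// ltW. Qed.

(** Since t^(z - 1) may increase or decrease, it is split into t^z and 1/t. On [F k] the first
    factor is at most q^k and the second at most 2^(k+1). *)
Lemma gamma_integrand_le_dyadic t k : F k t -> f t <= c k.
Proof.
rewrite /F /= in_itv/= => /andP[t1 t2].
have t0 : 0 < t by exact: lt_trans t1.
apply: (@le_trans _ _ (t `^ (z - 1))).
  by rewrite ler_piMr ?powR_ge0// -expR0 ler_expR oppr_le0 ltW.
rewrite powRD; last by rewrite (gt_eqF t0) implybT.
rewrite powR_inv1 ?(ltW t0)// mulrC /c.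
apply: ler_pM; rewrite ?invr_ge0 ?powR_ge0 ?(ltW t0)//.
  by rewrite lef_pV2 ?posrE// ltW.
rewrite /q -powR_mulrn ?powR_ge0// -powRrM mulrC powRrM powR_mulrn ?(ltW h0)//.
by apply: ge0_ler_powR; rewrite ?nnegrE ?(ltW t0) ?(ltW z0)// ltW.
Qed.

(** Write t as 2p times t/(2p) and use x <= e^x: the power then costs (2p)^p times e^(t/2), leaving
    e^(-t/2). The 2 in [C] cancels the factor 1/2 of the exponential density of that rate. *)
Lemma gamma_integrand_le_exp t : 1 <= t -> f t <= C * exponential_pdf h t.
Proof.
move=> t1; have t0 : 0 < t by exact: lt_le_trans t1.
rewrite exponential_pdfE ?(ltW t0)// /C.
have p20 : 0 < 2 * p by rewrite mulr_gt0.
have tp : t `^ (z - 1) <= (2 * p) `^ p * expR (t / 2).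
  apply: (@le_trans _ _ (t `^ p)); first by rewrite ler_powR// /p; lra.
  have -> : t = 2 * p * (t / (2 * p)) by rewrite mulrCA divff ?mulr1// gt_eqF.
  rewrite powRM ?divr_ge0 ?(ltW p20) ?(ltW t0)// ler_wpM2l ?powR_ge0//.
  apply: (@le_trans _ _ (expR (t / (2 * p)) `^ p)).
    apply: ge0_ler_powR; rewrite ?nnegrE ?expR_ge0 ?divr_ge0 ?(ltW p20) ?(ltW t0) ?(ltW p0)//.
    by apply: le_trans (expR_ge1Dx _); rewrite lerDr.
  rewrite -expRM ler_expR le_eqVlt; apply/orP; left; apply/eqP; field.
  by rewrite gt_eqF.
apply: (@le_trans _ _ ((2 * p) `^ p * expR (t / 2) * expR (- t))).
  by rewrite ler_wpM2r ?expR_ge0.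
rewrite -mulrA -expRD (_ : t / 2 - t = - h * t); last by lra.
by rewrite [leRHS]mulrCA !mulrA; lra.
Qed.

Let F_cover t : 0 < t -> t <= 1 -> exists k, F k t.
Proof.
move=> t0 t1.
have ex : exists k, h ^+ k.+1 < t.
  have [k hk] := exp_half_small t0; exists k; apply: le_lt_trans hk.
  by rewrite exprS ler_piMl ?exprn_ge0 ?(ltW h0)//; lra.
exists (ex_minn ex); case: ex_minnP => k hk kmin.
rewrite /F /= in_itv/= hk/=; case: k hk kmin => [|k] hk kmin; first by rewrite expr0.
by rewrite leNgt; apply/negP => /kmin; rewrite ltnn.
Qed.

Let mf : measurable_fun setT f.
Proof.
apply: measurable_funM; first exact: measurable_powR.
apply: measurableT_comp => //; exact: measurableT_comp.
Qed.

Let f0 t : 0 <= f t.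
Proof. by rewrite mulr_ge0 ?powR_ge0 ?expR_ge0. Qed.

(** Up to 1 the dyadic intervals contribute at most q^k each, with q < 1 because z > 0; beyond 1 the
    integrand lies below a multiple of a probability density. *)
Lemma gamma_integral_lty :
  (\int[mu]_(t in `]0%R, +oo[) (f t)%:E < +oo)%E.
Proof.
pose g k (t : R) := (c k * \1_(F k) t)%:E.
have g0 k t : (0 <= g k t)%E by rewrite lee_fin mulr_ge0.
have mF k : measurable (F k) by exact: measurable_itv.
have mg k : measurable_fun setT (g k).
  by apply/measurable_EFinP; apply: measurable_funM.
pose e (t : R) := (C * exponential_pdf h t)%:E.
have me : measurable_fun setT e.
  by apply/measurable_EFinP; apply: measurable_funM => //; exact: measurable_exponential_pdf.
have C0 : 0 <= C by rewrite mulr_ge0// powR_ge0.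
have e0 t : (0 <= e t)%E.
  by rewrite lee_fin mulr_ge0// exponential_pdf_ge0// ltW.
have ms : measurable_fun setT (fun t => \sum_(k <oo) g k t)%E.
  by apply: (ge0_emeasurable_sum (P := xpredT)) => // k _.
have s0 t : (0 <= \sum_(k <oo) g k t)%E by exact: nneseries_ge0.
apply: (@le_lt_trans _ _ (\int[mu]_t (\sum_(k <oo) g k t + e t))%E).
  rewrite integral_mkcond; apply: ge0_le_integral => //.
  - move=> t _; rewrite patchE; case: ifPn => // _; rewrite lee_fin; exact: f0.
  - apply/(measurable_restrictT _ (measurable_itv _)).
    by apply/measurable_EFinP; exact: measurable_funTS.
  - exact: emeasurable_funD.
  - move=> t _; rewrite patchE; case: ifPn => [|_]; last by rewrite adde_ge0.
    rewrite inE /= in_itv/= andbT => t0.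
    have [t1|t1] := leP t 1; last first.
      rewrite -[leLHS]add0e; apply: leeD => //.
      by rewrite lee_fin; apply: gamma_integrand_le_exp; exact: ltW.
    have [k Fk] := F_cover t0 t1.
    rewrite -[leLHS]adde0; apply: leeD => //.
    apply: (@le_trans _ _ (g k t)).
      by rewrite lee_fin indicE mem_set// mulr1; exact: gamma_integrand_le_dyadic.
    apply: (le_trans _ (nneseries_lim_ge k.+1 _)) => //.
    by rewrite big_nat_recr//= leeDr// sume_ge0.
rewrite ge0_integralD//; apply: lte_add_pinfty; last first.
  rewrite /e; under eq_integral do rewrite EFinM.
  rewrite ge0_integralZl_EFin//; last 2 first.
  - by move=> t _; rewrite lee_fin exponential_pdf_ge0// ltW.
  - by apply/measurable_EFinP; exact: measurable_exponential_pdf.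
  by rewrite integral_exponential_pdf// mule1 ltry.
have Ig k : (\int[mu]_t g k t = (q ^+ k)%:E)%E.
  rewrite /g; under eq_integral do rewrite EFinM.
  rewrite ge0_integralZl_EFin ?c_ge0//; try by
    [move=> t _; rewrite lee_fin|apply/measurable_EFinP; apply: measurable_indic; exact: mF].
  have -> : (\int[mu]_t (\1_(F k) t)%:E = mu (F k))%E.
    rewrite integral_indic ?setIT//; exact: mF.
  rewrite /F lebesgue_measure_itv/= lte_fin.
  have -> : h ^+ k.+1 < h ^+ k by rewrite exprS gtr_pMl//; lra.
  rewrite -EFinB -EFinM /c; congr EFin.
  have -> : h ^+ k - h ^+ k.+1 = h ^+ k.+1 by rewrite exprS; lra.
  by rewrite mulrAC mulVf ?mul1r// gt_eqF.
rewrite integral_nneseries// (eq_eseriesr (fun k _ => Ig k)).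
have q1 : q < 1.
  rewrite /q; apply: (@lt_le_trans _ _ (1 `^ z)); last by rewrite powR1.
  by apply: gt0_ltr_powR; rewrite ?nnegrE ?(ltW h0)//; lra.
have cg := @cvg_geometric_series R 1 q.
rewrite (_ : (\sum_(i <oo) _)%E = ((1 - q)^-1)%:E) ?ltry//.
apply: cvg_lim => //.
rewrite (_ : (fun n => _) = EFin \o series (geometric 1 q)).
  apply: cvg_EFin; first exact: nearW.
  by rewrite -[X in _ --> X]mul1r; apply: cg; rewrite ger0_norm// powR_ge0.
apply/funext => n; rewrite /= sumEFin; congr EFin; apply: eq_bigr => i _.
by rewrite /= mul1r.
Qed.

Lemma gamma_fun_gt0 : 0 < gamma_fun z.
Proof.
(* A lower bound for the integrand on [1, 2]: there the power is at least 1/t, hence at least 1/2,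
   and the exponential is at least e^-2. *)
pose b : R := 2^-1 * expR (- 2).
have b0 : 0 < b by rewrite mulr_gt0// expR_gt0.
apply: (lt_le_trans b0); rewrite /gamma_fun /Rintegral -lee_fin fineK; last first.
  by rewrite ge0_fin_numE ?gamma_integral_lty//; apply: integral_ge0 => t _; rewrite lee_fin.
have mI : measurable `[1 : R, 2]%classic by exact: measurable_itv.
have -> : b%:E = (\int[mu]_(t in `[1%R, 2%R]) b%:E)%E.
  have mu12 : mu `[1 : R, 2]%classic = 1%E.
    rewrite lebesgue_measure_itv/= lte_fin ltr1n -EFinB; congr EFin; lra.
  by rewrite integral_cst// [X in (_ * X)%E]mu12 mule1.
apply: (@le_trans _ _ (\int[mu]_(t in `[1%R, 2%R]) (f t)%:E)%E).
  apply: ge0_le_integral => //.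
  - by move=> t _; rewrite lee_fin ltW.
  - by apply/measurable_EFinP; exact: measurable_funTS.
  - move=> t; rewrite /= in_itv/= => /andP[t1 t2]; rewrite lee_fin /b.
    have t0 : 0 < t by exact: lt_le_trans t1.
    apply: ler_pM; rewrite ?expR_ge0//; last by rewrite ler_expR lerN2.
    apply: (@le_trans _ _ (t `^ (- 1))); last by rewrite ler_powR// lerBrDr addNr ltW.
    by rewrite powR_inv1 ?(ltW t0)// lef_pV2 ?posrE.
apply: ge0_subset_integral => //.
- by apply/measurable_EFinP; exact: measurable_funTS.
- by move=> t _; rewrite lee_fin.
- move=> t; rewrite /= !in_itv/= andbT => /andP[t1 _]; exact: lt_le_trans t1.
Qed.

End gamma_positive.

Lemma cds_gt0 (R : realType) (d : nat) (s : R) : 0 < s < 1 -> 0 < cds d s.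
Proof.
move=> /andP[s0 s1]; rewrite /cds divr_gt0// !mulr_gt0// ?powR_gt0 ?pi_gt0//.
- by apply: gamma_fun_gt0; rewrite ltr_wpDr// divr_ge0.
- by apply: gamma_fun_gt0; rewrite subr_gt0.
Qed.

(** * Measurability of superposition operators *)

Lemma dyadic_floor_cvg (R : realType) (t : R) :
  (Num.floor (2 ^+ n * t))%:~R / 2 ^+ n @[n --> \oo] --> t.
Proof.
have n0 n : 0 < 2 ^+ n :> R by rewrite exprn_gt0.
have hc : t - (2^-1 : R) ^+ n @[n --> \oo] --> t.
  rewrite -[X in _ --> X]subr0; apply: cvgB; first exact: cvg_cst.
  by apply: cvg_expr; rewrite ger0_norm ?invr_ge0//; lra.
apply: (squeeze_cvgr _ hc (cvg_cst t)); apply: nearW => n /=.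
have /andP[f1 f2] : (Num.floor (2 ^+ n * t))%:~R <= 2 ^+ n * t <
    (Num.floor (2 ^+ n * t) + 1)%:~R by rewrite real_floor_itv ?num_real.
rewrite ler_pdivrMr// (mulrC t) f1 andbT ler_pdivlMr// mulrBl -exprMn mulVf// expr1n.
by move: f2; rewrite intrD mulrC => f2; rewrite lerBlDr ltW.
Qed.

Section superposition.
Context d (T : measurableType d) (R : realType) (mu : {measure set T -> \bar R}).
Hypothesis mu_complete : measure_is_complete mu.
Context (D : set T) (mD : measurable D).

(** The pointwise limit agrees with a measurable function off a null set, and completeness of the
    measure makes it measurable. *)
Lemma ae_cvg_measurable (f_ : (T -> R)^nat) (f : T -> R) :
  (forall n, measurable_fun D (f_ n)) ->
  {ae mu, forall x, D x -> f_ ^~ x @ \oo --> f x} -> measurable_fun D f.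
Proof.
move=> mf [N [mN N0 Nf]].
have mh : measurable_fun D (fun x => if x \in N then 0 else f x).
  apply: (@measurable_fun_cvg _ _ _ _ (fun n x => if x \in N then 0 else f_ n x)).
    by move=> n; exact: measurable_fun_if_mem.
  move=> x Dx; have [xN|xN] := boolP (x \in N); first exact: cvg_cst.
  apply: contrapT => nc; move/negP: xN; apply; rewrite inE; apply: Nf => /= h.
  exact: nc (h Dx).
apply/measurable_EFinP; move/measurable_EFinP : mh.
apply: (ae_measurable_fun mu_complete).
exists N; split => // x /=; apply: contra_notP => xN _ /=.
by rewrite ifF//; apply/negbTE/negP; rewrite inE.
Qed.

Variable f : T -> R -> R.
Hypothesis mf : forall t, measurable_fun D (f ^~ t).

(** For the dyadic approximations of [w], which take countably many values, the composition is a
    countable patchwork of the functions f(., t). Continuity in the second variable handles the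
    limit almost everywhere. *)
Lemma measurable_superposition (w : T -> R) : measurable_fun D w ->
  {ae mu, forall x, D x -> continuous (f x)} ->
  measurable_fun D (fun x => f x (w x)).
Proof.
move=> mw cf.
pose g n x := f x ((Num.floor (2 ^+ n * w x))%:~R / 2 ^+ n).
apply: (@ae_cvg_measurable g); last first.
  apply: filterS cf => x + Dx => /(_ Dx) cfx.
  by apply: continuous_cvg; [exact: cfx|exact: dyadic_floor_cvg].
move=> n _ Y mY.
have n0 : 0 < 2 ^+ n :> R by rewrite exprn_gt0.
rewrite (_ : D `&` _ = \bigcup_(m : int)
  ((D `&` w @^-1` `[m%:~R / 2 ^+ n, (m + 1)%:~R / 2 ^+ n[%classic) `&`
   (D `&` (f ^~ (m%:~R / 2 ^+ n)) @^-1` Y))).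
  apply: countable_bigcupT_measurable; first exact: countableP.
  by move=> m; apply: measurableI; [exact: mw|exact: mf].
have P (t : R) (m : int) : Num.floor (2 ^+ n * t) = m <->
    m%:~R / 2 ^+ n <= t < (m + 1)%:~R / 2 ^+ n.
  rewrite ler_pdivrMr// ltr_pdivlMr// (mulrC t); split=> [<-|]; last exact: floor_def.
  by rewrite real_floor_itv ?num_real.
apply/seteqP; split=> [x [Dx gx]|x [m _ [[Dx wx] [_ fx]]]].
  exists (Num.floor (2 ^+ n * w x)) => //; split; split => //.
  by rewrite /= in_itv/=; exact/P.
split=> //; move: wx; rewrite /= in_itv/= => /P wx.
by rewrite /g wx.
Qed.

(** The derivative is the almost everywhere limit of difference quotients with steps 1/(n+1), each a
    superposition. *)
Lemma measurable_derive1 (w : T -> R) : measurable_fun D w ->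
  {ae mu, forall x, D x -> forall t, derivable (f x) t 1} ->
  measurable_fun D (fun x => derive1 (f x) (w x)).
Proof.
move=> mw df.
have cf : {ae mu, forall x, D x -> continuous (f x)}.
  apply: filterS df => x + Dx => /(_ Dx) dfx t.
  by apply/differentiable_continuous/derivable1_diffP.
pose h n : R := n.+1%:R^-1.
pose g n x := (h n)^-1 * (f x (h n + w x) - f x (w x)).
apply: (@ae_cvg_measurable g) => [n|].
  apply: measurable_funM => //; apply: measurable_funB.
    by apply: measurable_superposition => //; exact: measurable_funD.
  exact: measurable_superposition.
apply: filterS df => x + Dx => /(_ Dx) dfx.
have hd : (fun t => t^-1 *: (f x (t + w x) - f x (w x))) @ 0^' -->
    derive1 (f x) (w x).
  suff -> : (fun t => t^-1 *: (f x (t + w x) - f x (w x))) = 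
    (fun h => h^-1 *: ((f x \o shift (w x)) (h *: 1) - f x (w x))).
    have := dfx (w x); rewrite /derivable => /cvgP; rewrite derive1E /derive; exact.
  by apply/funext => t /=; rewrite /GRing.scale/= mulr1.
apply: (cvg_comp h _ _ hd).
move=> A [e /= e0 eA].
have : \forall n \near \oo, h n < e.
  have := @cvg_harmonic R => /cvgrPdist_lt /(_ _ e0); apply: filterS => n.
  by rewrite sub0r normrN; apply: le_lt_trans; exact: ler_norm.
rewrite /= => hh; change (\forall n \near \oo, A (h n)).
apply: filterS hh => n hn; apply: eA => /=; last by rewrite invr_eq0 pnatr_eq0.
have hn0 : 0 <= h n by rewrite invr_ge0 ler0n.
by rewrite sub0r normrN (ger0_norm hn0).
Qed.

End superposition.

Lemma measurable_derive1n2 d (T : measurableType d) (R : realType)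
    (mu : {measure set T -> \bar R}) (D : set T) (f : T -> R -> R) (w : T -> R) :
  measure_is_complete mu -> measurable D ->
  (forall t, measurable_fun D (f ^~ t)) -> measurable_fun D w ->
  {ae mu, forall x, D x -> C2 (f x)} ->
  measurable_fun D (fun x => derive1n 2 (f x) (w x)).
Proof.
move=> mu_complete mD mf mw f2.
apply: (measurable_derive1 (f := fun x => derive1 (f x)) mu_complete mD _ mw).
  move=> t; apply: (measurable_derive1 mu_complete mD mf); first exact: measurable_cst.
  by apply: filterS f2 => x + Dx => /(_ Dx)[h _ _]; exact: h.
by apply: filterS f2 => x + Dx => /(_ Dx)[_ h _]; exact: h.
Qed.

(** * First and second variations *)

Lemma ae_and d (T : measurableType d) (R : realType) (mu : {measure set T -> \bar R})
    (P Q : T -> Prop) :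
  {ae mu, forall x, P x} -> {ae mu, forall x, Q x} -> {ae mu, forall x, P x /\ Q x}.
Proof. by move=> hP hQ; near=> x; split; near: x. Unshelve. all: by end_near. Qed.

Lemma ae_imply d (T : measurableType d) (R : realType) (mu : {measure set T -> \bar R})
    (P Q : T -> Prop) : (forall x, P x -> Q x) ->
  {ae mu, forall x, P x} -> {ae mu, forall x, Q x}.
Proof. by move=> PQ; apply: filterS. Qed.

Section essentially_bounded.
Context d (T : measurableType d) (R : realType) (mu : {measure set T -> \bar R}).
Context (D : set T) (mD : measurable D).

Lemma Lfun_restrict_measurable (p : \bar R) (f : T -> R) :
  f \_ D \in Lfun mu p -> measurable_fun D f.
Proof.
rewrite inE => /andP[]; rewrite inE => mf _; apply/(measurable_restrictT _ mD).
exact: mf.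
Qed.

Lemma Lfun_infty_bounded (f : T -> R) : f \_ D \in Lfun mu +oo%E ->
  exists2 m, 0 < m & {ae mu, forall x, D x -> `|f x| <= m}.
Proof.
rewrite inE => /andP[_]; rewrite inE /= /finite_norm unlock.
have [T0|T0] := ltP 0%E (mu setT) => [|_]; last first.
  exists 1 => //; exists setT; split => //.
  by apply/eqP; rewrite eq_le T0 measure_ge0.
move=> fy; have := ess_sup_ge mu (abse \o (EFin \o f \_ D)).
move: fy; set M := ess_sup _ _ => fy fM.
exists (Num.max 1 (fine M)); first by rewrite lt_max ltr01.
apply: filterS fM => x /= + Dx; rewrite patchE mem_set//.
move: fy; case: M => [M| |]//= _; first by rewrite lee_fin => h; rewrite le_max h orbT.
Qed.

Lemma Lfun_powR (r : R) (f : T -> R) : 0 < r -> f \_ D \in Lfun mu r%:E ->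
  (\int[mu]_(x in D) (`|f x| `^ r)%:E < +oo)%E.
Proof.
move=> r0; rewrite inE => /andP[_]; rewrite inE /= /finite_norm => fy.
rewrite (_ : (\int[mu]_(x in D) _)%E = (\int[mu]_x `|(f \_ D x)%:E| `^ r)%E).
  by rewrite -powR_Lnorm ?gt_eqF//; exact: poweR_lty.
rewrite [LHS]integral_mkcond; apply: eq_integral => x _; rewrite !patchE.
by case: ifPn => //= _; rewrite normr0 powR0 ?gt_eqF.
Qed.

Lemma ae_eq_Rintegral (f g : T -> R) : measurable_fun D f -> measurable_fun D g ->
  {ae mu, forall x, D x -> f x = g x} ->
  \int[mu]_(x in D) f x = \int[mu]_(x in D) g x.
Proof.
move=> mf mg fg; rewrite /Rintegral; congr fine; apply: ae_eq_integral => //.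
- exact/measurable_EFinP.
- exact/measurable_EFinP.
- by apply: filterS fg => x + Dx => /(_ Dx) ->.
Qed.

Lemma ae_ge0_Rintegral (f : T -> R) : measurable_fun D f ->
  {ae mu, forall x, D x -> 0 <= f x} -> 0 <= \int[mu]_(x in D) f x.
Proof.
move=> mf f0; rewrite (@ae_eq_Rintegral _ (fun x => Num.max 0 (f x)))//.
- by apply: Rintegral_ge0 => x _; rewrite le_max lexx.
- exact: measurable_maxr.
- by apply: filterS f0 => x + Dx => /(_ Dx) fx; rewrite max_r.
Qed.

Lemma ae_le0_Rintegral_eq0 (f : T -> R) : mu.-integrable D (EFin \o f) ->
  {ae mu, forall x, D x -> f x <= 0} -> 0 <= \int[mu]_(x in D) f x ->
  {ae mu, forall x, D x -> f x = 0}.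
Proof.
move=> If f0 If0.
have mf : measurable_fun D f by apply/measurable_EFinP; exact: measurable_int If.
have IN : mu.-integrable D (EFin \o (fun x => `|f x|)) by exact: integrable_norm.
have NE : \int[mu]_(x in D) `|f x| = -1 * \int[mu]_(x in D) f x.
  rewrite -RintegralZl//; apply: ae_eq_Rintegral.
  - exact: measurableT_comp.
  - exact: measurable_funM.
  - by apply: filterS f0 => x + Dx => /(_ Dx) fx; rewrite mulN1r ler0_norm.
have N0 : \int[mu]_(x in D) `|f x| = 0.
  apply/eqP; rewrite eq_le Rintegral_ge0// andbT NE mulN1r oppr_le0; exact: If0.
have : (\int[mu]_(x in D) `|(f x)%:E| = 0)%E.
  have := fineK (integrable_fin_num mD IN).
  by rewrite -/(Rintegral mu D (fun x => `|f x|)) /= N0 => <-.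
move/(ae_eq_integral_abs mu mD (measurable_int _ If)).
by apply: filterS => x + Dx => /(_ Dx)/= [].
Qed.

Lemma ae_le_Rintegral (f g : T -> R) : mu.-integrable D (EFin \o f) ->
  mu.-integrable D (EFin \o g) -> {ae mu, forall x, D x -> f x <= g x} ->
  \int[mu]_(x in D) f x <= \int[mu]_(x in D) g x.
Proof.
move=> If Ig fg; rewrite -subr_ge0 -RintegralB//; apply: ae_ge0_Rintegral.
  by apply: measurable_funB; apply/measurable_EFinP; [exact: measurable_int Ig|exact: measurable_int If].
by apply: filterS fg => x + Dx => /(_ Dx); rewrite subr_ge0.
Qed.

Lemma ae_le_integrable (f g : T -> R) : measurable_fun D f ->
  mu.-integrable D (EFin \o g) -> {ae mu, forall x, D x -> `|f x| <= g x} ->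
  mu.-integrable D (EFin \o f).
Proof.
move=> mf Ig fg; apply/integrableP; split; first exact/measurable_EFinP.
have /integrableP[mg] := Ig; apply: le_lt_trans; apply: ae_ge0_le_integral => //.
- by apply: measurableT_comp => //; exact/measurable_EFinP.
- by apply: measurableT_comp.
- apply: filterS fg => x + Dx => /(_ Dx) h /=.
  by rewrite lee_fin (le_trans h)// ler_norm.
Qed.

Lemma cst_integrable (c : R) : (mu D < +oo)%E -> mu.-integrable D (EFin \o cst c).
Proof.
move=> Dy; apply/integrableP; split; first by apply/measurable_EFinP.
rewrite (eq_integral (cst `|c|%:E))// integral_cst//.
exact: lte_mul_pinfty.
Qed.

Lemma ae_bounded_integrable (f : T -> R) (c : R) : (mu D < +oo)%E -> measurable_fun D f ->
  {ae mu, forall x, D x -> `|f x| <= c} -> mu.-integrable D (EFin \o f).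
Proof.
move=> Dy mf; apply: ae_le_integrable => //.
exact: cst_integrable.
Qed.

End essentially_bounded.

Section finite_weighted_square.
Context d (T : measurableType d) (R : realType) (mu : {measure set T -> \bar R}).
Context (D : set T) (mD : measurable D) (W : T -> R).
Hypothesis mW : measurable_fun D W.
Hypothesis W0 : forall x, D x -> 0 <= W x.
Local Notation N f := (fine (wsq mu D W f)).
Local Notation sq := (sq_int mu D W).

Lemma sq_int_fin f : sq f -> wsq mu D W f \is a fin_num.
Proof. by case=> _; exact: wsq_fin. Qed.

Lemma fine_wsqZ (c : R) f : sq f -> N (fun x => c * f x) = c ^+ 2 * N f.
Proof. by move=> sf; rewrite wsqZ//; [rewrite fineM// sq_int_fin|case: sf]. Qed.

Lemma fine_wsq_parallelogram f g : sq f -> sq g ->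
  N (f \- g)%R + N (f \+ g)%R <= 2 * N f + 2 * N g.
Proof.
move=> sf sg; have [mf _] := sf; have [mg _] := sg.
have fB := sq_int_fin (sq_intB mD mW W0 sf sg); have fD := sq_int_fin (sq_intD mD mW W0 sf sg).
rewrite -lee_fin !EFinD !EFinM (fineK fB) (fineK fD) (fineK (sq_int_fin sf)) (fineK (sq_int_fin sg)).
by rewrite wsq_parallelogram.
Qed.

Lemma fine_wsq_young e f g : 0 < e -> sq f -> sq g ->
  N (f \+ g)%R <= (1 + e) * N f + (1 + e^-1) * N g.
Proof.
move=> e0 sf sg; have [mf _] := sf; have [mg _] := sg.
have fD := sq_int_fin (sq_intD mD mW W0 sf sg).
rewrite -lee_fin EFinD (EFinM (1 + e)) (EFinM (1 + e^-1)) (fineK fD).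
rewrite (fineK (sq_int_fin sf)) (fineK (sq_int_fin sg)).
exact: wsq_young.
Qed.

Lemma fine_wsqD_le f g : sq f -> sq g -> N (f \+ g)%R <= 2 * N f + 2 * N g.
Proof.
by move=> sf sg; have := fine_wsq_young ltr01 sf sg; rewrite invr1.
Qed.

End finite_weighted_square.

Section directional_functional.
Context d (T : measurableType d) (R : realType) (mu : {measure set T -> \bar R}).
Context (D : set T) (mD : measurable D) (psi : T -> R -> R) (k : R).
Hypothesis Dy : (mu D < +oo)%E.
Hypothesis mpsi : forall w, measurable_fun D w -> measurable_fun D (fun x => psi x (w x)).
Hypothesis psiZ : forall c x t, 0 <= c -> psi x (c * t) = c * psi x t.
Hypothesis psiD : forall x t t', psi x (t + t') <= psi x t + psi x t'.
Hypothesis k0 : 0 <= k.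
Hypothesis psi_le : {ae mu, forall x, D x -> forall t, `|psi x t| <= k * `|t|}.
Local Notation sq1 := (sq_int mu D (cst 1)).
Local Notation J w := (\int[mu]_(x in D) psi x (w x)).

Lemma sq_int1_integrable w : sq1 w -> mu.-integrable D (EFin \o w).
Proof.
move=> sw; have s1 : sq1 (cst 1).
  split=> //; rewrite /wsq (eq_integral (cst 1%E)) => [|x _].
    by rewrite integral_cst// mul1e.
  by rewrite expr1n mulr1.
have := sq_int_integrable mD (measurable_cst (1 : R)) (fun _ _ => ler01) sw s1.
by apply: eq_integrable => // x _ /=; rewrite !mulr1.
Qed.

Lemma psi_integrable w : sq1 w -> mu.-integrable D (EFin \o (fun x => psi x (w x))).
Proof.
move=> sw; apply: (@ae_le_integrable _ _ _ mu D mD _ (fun x => k * `|w x|)).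
- by apply: mpsi; case: sw.
- have := integrableZl mD k (integrable_norm (sq_int1_integrable sw)).
  by apply: eq_integrable.
- by apply: filterS psi_le => x + Dx => /(_ Dx).
Qed.

Lemma directionalZ c w : 0 <= c -> sq1 w -> J (fun x => c * w x) = c * J w.
Proof.
move=> c0 sw; rewrite -RintegralZl//; last exact: psi_integrable.
by apply: eq_Rintegral => x _; exact: psiZ.
Qed.

Lemma directionalD w v : sq1 w -> sq1 v -> J (w \+ v)%R <= J w + J v.
Proof.
move=> sw sv; rewrite -RintegralD//; try exact: psi_integrable.
apply: le_Rintegral => //; first exact: psi_integrable (sq_intD mD (measurable_cst (1 : R)) (fun _ _ => ler01) sw sv).
  exact: integrableD (psi_integrable sw) (psi_integrable sv).
by move=> x _; exact: psiD.
Qed.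

(** Pointwise |t| is at most e + t^2/e. The measure of [D] multiplies only the first term; the + 1
    allows one common factor. *)
Lemma directional_le e w : 0 < e -> sq1 w ->
  J w <= (k * (fine (mu D) + 1)) * (e + e^-1 * fine (wsq mu D (cst 1) w)).
Proof.
move=> e0 sw.
have [mw wy] := sw.
have I1 : mu.-integrable D (EFin \o cst e) by exact: cst_integrable.
have I2 := wsq_integrable mD (measurable_cst (1 : R)) (fun _ _ => ler01) mw wy.
have I3 := integrableZl mD e^-1 I2.
have I4 : mu.-integrable D (EFin \o (fun x => e^-1 * (w x ^+ 2 * cst 1 x))).
  by apply: eq_integrable I3.
have I5 : mu.-integrable D (EFin \o (fun x => e + e^-1 * (w x ^+ 2 * cst 1 x))).
  by apply: eq_integrable (integrableD mD I1 I4).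
apply: (@le_trans _ _ (\int[mu]_(x in D) (k * (e + e^-1 * (w x ^+ 2 * cst 1 x))))).
  apply: ae_le_Rintegral => //; first exact: psi_integrable.
    by apply: eq_integrable (integrableZl mD k I5).
  apply: filterS psi_le => x + Dx => /(_ Dx) /(_ (w x)) h.
  apply: (le_trans (ler_norm _)); apply: (le_trans h); rewrite ler_wpM2l// mulr1.
  have [we|ew] := leP `|w x| e.
    by rewrite (le_trans we)// lerDl mulr_ge0 ?sqr_ge0// invr_ge0 ltW.
  apply: (@le_trans _ _ (e^-1 * w x ^+ 2)); last by rewrite lerDr ltW.
  by rewrite ler_pdivlMl// -(real_normK (num_real (w x))) expr2 ler_wpM2r// ltW.
rewrite RintegralZl// RintegralD// Rintegral_cst// RintegralZl//.
rewrite -mulrA ler_wpM2l// -/(wsq mu D (cst 1) w).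
have n0 : 0 <= fine (wsq mu D (cst 1) w) by rewrite fine_ge0// wsq_ge0.
rewrite -[X in _ + _ * X]/(fine (wsq mu D (cst 1) w)).
have m0 : 0 <= fine (mu D) by rewrite fine_ge0.
have := mulr_ge0 m0 (mulr_ge0 (ltW (_ : 0 < e^-1)) n0); rewrite invr_gt0 => /(_ e0); lra.
Qed.

End directional_functional.

Section quadratic_perturbation.
Context d (T : measurableType d) (R : realType) (mu : {measure set T -> \bar R}).
Context (D : set T) (mD : measurable D) (G g : T -> R).
Hypothesis mG : measurable_fun D G.
Hypothesis G0 : forall x, D x -> 0 <= G x.
Hypothesis mg : measurable_fun D g.
Hypothesis gG : {ae mu, forall x, D x -> `|g x| <= G x}.
Local Notation sqG := (sq_int mu D G).
Local Notation N f := (fine (wsq mu D G f)).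
Local Notation b f := (\int[mu]_(x in D) (f x ^+ 2 * g x)).

Lemma quadratic_integrable f : sqG f -> mu.-integrable D (EFin \o (fun x => f x ^+ 2 * g x)).
Proof.
move=> [mf fy]; apply: (ae_le_integrable mD _ (wsq_integrable mD mG G0 mf fy)).
  by apply: measurable_funM => //; exact: measurable_funX.
apply: filterS gG => x + Dx => /(_ Dx) h; rewrite normrM ger0_norm ?sqr_ge0//.
by rewrite ler_wpM2l ?sqr_ge0.
Qed.

Lemma quadraticZ c f : sqG f -> b (fun x => c * f x) = c ^+ 2 * b f.
Proof.
move=> sf; rewrite -RintegralZl//; last exact: quadratic_integrable.
by apply: eq_Rintegral => x _; rewrite exprMn mulrA.
Qed.

(** Factor f^2 - h^2 and apply Young's inequality so that the difference carries e^-1, while the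
    square of f + h is at most twice the sum of squares. *)
Lemma quadratic_cont e f h : 0 < e -> sqG f -> sqG h ->
  `|b f - b h| <= e * (N f + N h) + e^-1 * N (f \- h)%R.
Proof.
move=> e0 sf sh.
have sB := sq_intB mD mG G0 sf sh.
have I2 k : sqG k -> mu.-integrable D (EFin \o (fun x => k x ^+ 2 * G x)).
  by case=> mk ky; exact: wsq_integrable.
have If := I2 _ sf; have Ih := I2 _ sh; have IB := I2 _ sB.
have Qf := quadratic_integrable sf; have Qh := quadratic_integrable sh.
have IS : mu.-integrable D (EFin \o (fun x => f x ^+ 2 * G x + h x ^+ 2 * G x)).
  by apply: eq_integrable (integrableD mD If Ih).
have IE : mu.-integrable D (EFin \o (fun x => e * (f x ^+ 2 * G x + h x ^+ 2 * G x))).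
  by apply: eq_integrable (integrableZl mD e IS).
have IV : mu.-integrable D (EFin \o (fun x => e^-1 * ((f \- h)%R x ^+ 2 * G x))).
  by apply: eq_integrable (integrableZl mD e^-1 IB).
have NE k : N k = \int[mu]_(x in D) (k x ^+ 2 * G x) by [].
rewrite !NE -RintegralD// -(RintegralZl e mD IS) -(RintegralZl e^-1 mD IB) -RintegralD//.
rewrite -RintegralB//; apply: (le_trans (le_normr_Rintegral mD _)).
  by apply: eq_integrable (integrableB mD Qf Qh).
apply: ae_le_Rintegral => //.
- by apply: integrable_norm; apply: eq_integrable (integrableB mD Qf Qh).
- by apply: eq_integrable (integrableD mD IE IV).
apply: filterS gG => x + Dx => /(_ Dx) hx /=.
rewrite -mulrBl normrM (@le_trans _ _ (`|f x ^+ 2 - h x ^+ 2| * G x))//.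
  by rewrite ler_wpM2l.
rewrite -!mulrDl !mulrA -!mulrDl ler_wpM2r ?G0//.
rewrite subr_sqr.
have := young_mul (f x - h x) (f x + h x) (_ : 0 < e^-1); rewrite invr_gt0 invrK => /(_ e0).
have q : (f x + h x) ^+ 2 <= 2 * (f x ^+ 2 + h x ^+ 2).
  have := sqr_ge0 (f x - h x); rewrite !expr2; lra.
have := ler_wpM2l (ltW e0) q.
have := mulr_ge0 (ltW (_ : 0 < e^-1)) (sqr_ge0 (f x - h x)); rewrite invr_gt0 => /(_ e0); lra.
Qed.

End quadratic_perturbation.

(** * The linearized control problem *)

Section uniform_positivity.
Context (R : realType) (d : nat) (s r : R).
Hypothesis d0 : (0 < d)%N.
Hypothesis s0 : 0 < s.
Hypothesis r1 : 1 <= r.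
Hypothesis rs : d%:R / (2 * s) < r.
Hypothesis cds_gt0 : 0 < cds d s.
Local Notation leb := (@lebesgue_rV R d).
Local Notation lebT := (caratheodory_type (borel_lebesgue R d)^*%mu).
Context (Omega : set 'rV[R]_d) (B m : R).
Hypothesis mO : measurable (Omega : set lebT).
Hypothesis Om : (leb Omega <= m%:E)%E.
Hypothesis OB : forall x, Omega x -> forall i, `|x ord0 i| <= B.
Context (A : lebT -> R) (Ca : R).
Hypothesis mA : measurable_fun (Omega : set lebT) A.
Hypothesis A0 : forall x : lebT, Omega x -> 0 <= A x.
Hypothesis ACa : forall x : lebT, Omega x -> A x <= Ca.
Context (G g : lebT -> R) (I : R).
Hypothesis mG : measurable_fun setT G.
Hypothesis G0 : forall x, 0 <= G x.
Hypothesis GI : (\int[leb]_x (G x `^ r)%:E <= I%:E)%E.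
Hypothesis GO : forall x : lebT, ~ Omega x -> G x = 0.
Hypothesis mg : measurable_fun (Omega : set lebT) g.
Hypothesis gG : {ae leb, forall x, Omega x -> `|g x| <= G x}.
Context (psi : lebT -> R -> R) (k : R).
Hypothesis mpsi : forall w, measurable_fun (Omega : set lebT) w ->
  measurable_fun (Omega : set lebT) (fun x => psi x (w x)).
Hypothesis psiZ : forall c x t, 0 <= c -> psi x (c * t) = c * psi x t.
Hypothesis psiD : forall x t t', psi x (t + t') <= psi x t + psi x t'.
Hypothesis k0 : 0 <= k.
Hypothesis psi_le : {ae leb, forall x, Omega x -> forall t, `|psi x t| <= k * `|t|}.
Context (lam : R) (K : lebT -> set R).
Hypothesis lam0 : 0 < lam.
Hypothesis KD : forall x t t', K x t -> K x t' -> K x (t + t').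
Hypothesis KZ : forall c x t, 0 <= c -> K x t -> K x (c * t).
Hypothesis Kclosed : forall x, closed (K x).
Hypothesis psi_ge0 : {ae leb, forall x, Omega x -> forall t, K x t -> 0 <= psi x t}.
Local Notation L2O := (sq_int leb (Omega : set lebT) (cst 1)).
Local Notation n w := (fine (wsq leb (Omega : set lebT) (cst 1%R) w)).
Local Notation N f := (fine (wsq leb (Omega : set lebT) G f)).
Local Notation b f := (\int[leb]_(x in Omega) (f x ^+ 2 * g x)).
Local Notation J w := (\int[leb]_(x in Omega) psi x (w x)).
Local Notation X := ((lebT -> R^o) * (lebT -> R^o))%type.
Local Notation lin := (linear_state s Omega A).
Local Notation inK w := {ae leb, forall x, Omega x -> K x (w x)}.

(** States are carried along with their controls, so that linear combinations and limits act on
    both; [R^o] turns the function spaces into modules over R. *)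
Let S : set X := [set x | L2O x.1 /\ lin x.1 x.2].
Let C : set X := [set x | S x /\ inK x.1].

Let m1 : measurable_fun (Omega : set lebT) (cst (1 : R)). Proof. by []. Qed.
Let c1 (x : lebT) : Omega x -> 0 <= cst (1 : R) x. Proof. by []. Qed.
Let mGO : measurable_fun (Omega : set lebT) G. Proof. exact: measurable_funTS. Qed.
Let G0O (x : lebT) : Omega x -> 0 <= G x. Proof. by []. Qed.
Let Oy : (leb Omega < +oo)%E. Proof. by apply: (le_lt_trans Om); rewrite ltry. Qed.

Let SB x y : S x -> S y -> S (x - y).
Proof.
move=> [x1 x2] [y1 y2]; split; first exact: sq_intB.
exact: (linear_stateB mO mA A0 ACa x1 y1 x2 y2).
Qed.

Let SD x y : S x -> S y -> S (x + y).
Proof.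
move=> [x1 x2] [y1 y2]; split; first exact: sq_intD.
exact: (linear_stateD mO mA A0 ACa x1 y1 x2 y2).
Qed.

Let SZ c x : S x -> S (c *: x).
Proof.
move=> [x1 x2]; split; first exact: sq_intZ.
exact: (linear_stateZ mO mA A0 ACa c x1 x2).
Qed.

Let CD x y : C x -> C y -> C (x + y).
Proof.
move=> [Sx Kx] [Sy Ky]; split; first exact: SD.
by apply: ae_imply (ae_and Kx Ky) => z [xz yz] Oz; apply: KD; [exact: xz|exact: yz].
Qed.

Let CZ c x : 0 <= c -> C x -> C (c *: x).
Proof.
move=> c0 [Sx Kx]; split; first exact: SZ.
by apply: ae_imply Kx => z xz Oz; apply: KZ => //; exact: xz.
Qed.

Let finG f : sq_int leb (Omega : set lebT) G f ->
  wsq leb (Omega : set lebT) G f \is a fin_num.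
Proof. by case=> _; exact: wsq_fin. Qed.

Lemma N_bound : exists2 c, 0 <= c & forall w phi, L2O w -> lin w phi ->
  sq_int leb (Omega : set lebT) G phi /\ N phi <= c * n w.
Proof.
have [c [c0 Hc]] := frac_weighted_bound d0 s0 r1 rs mG G0 GI mO Om GO.
have [C' C0 HC] := linear_state_energy d0 s0 cds_gt0 mO OB A0.
(* [C'] bounds the whole energy, hence is used once for the L^2 part and once for the seminorm. *)
exists (c * (C' + C')); first by rewrite mulr_ge0// addr_ge0.
move=> w phi Lw Sw; have E := HC w phi Lw Sw.
have [Vp _] := Sw; have mp := tildeHs_measurable Vp.
have E1 : (sq_norm phi <= (C' * n w)%:E)%E.
  by apply: le_trans E; rewrite leeDl ?seminorm_ge0.
have E2 : (seminorm s phi <= (C' * n w)%:E)%E.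
  by apply: le_trans E; rewrite leeDr ?sq_norm_ge0.
have E3 : (wsq leb (Omega : set lebT) G phi <= (c * (C' * n w + C' * n w))%:E)%E.
  apply: le_trans (Hc _ _ _ mp E1 E2).
  exact: (wsq_subset leb measurableT mG (fun x _ => G0 x) mO (@subsetT _ _) mp).
have sG : sq_int leb (Omega : set lebT) G phi.
  by split; [exact: measurable_funTS|apply: (le_lt_trans E3); rewrite ltry].
split=> //; rewrite -lee_fin fineK; last exact: finG.
by apply: (le_trans E3); rewrite lee_fin -mulrA mulrDl.
Qed.

Let SG x : S x -> sq_int leb (Omega : set lebT) G x.2.
Proof. by have [c _ H] := N_bound; move=> [x1 x2]; have [] := H _ _ x1 x2. Qed.

Let N_compact (x_ : nat -> X) : (forall i, S (x_ i)) -> (forall i, n (x_ i).1 <= 1) ->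
  exists2 f : nat -> nat, (forall i, (i <= f i)%N) &
    forall i j, (i <= j)%N -> N ((x_ (f j)).2 - (x_ (f i)).2) <= 2^-1 ^+ i.
Proof.
move=> Sx nx.
have [C' C0 HC] := linear_state_energy d0 s0 cds_gt0 mO OB A0.
have E i : (energy s (x_ i).2 <= C'%:E)%E.
  have [xi1 xi2] := Sx i; apply: (le_trans (HC _ _ xi1 xi2)).
  by rewrite lee_fin ler_piMr.
have mx i : measurable_fun setT (x_ i).2.
  by have [_ [Vx _]] := Sx i; exact: tildeHs_measurable Vx.
have [||f fi Hf] := frac_weighted_compact d0 s0 r1 rs mG G0 GI mO Om GO OB mx
    (M := C') (H := C').
- by move=> i; apply: le_trans (E i); rewrite leeDl ?seminorm_ge0.
- by move=> i; apply: le_trans (E i); rewrite leeDr ?sq_norm_ge0.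
exists f => // i j ij.
rewrite -lee_fin fineK; last exact: finG (SG (SB (Sx _) (Sx _))).
apply: le_trans (Hf i j ij).
apply: (wsq_subset leb measurableT mG (fun x _ => G0 x) mO (@subsetT _ _)).
exact: measurable_funB.
Qed.

Let n_complete (x_ : nat -> X) : (forall i, C (x_ i)) ->
  (forall i, n ((x_ i).1 - (x_ i.+1).1) <= 4^-1 ^+ i) ->
  exists2 x : X, C x & forall e, 0 < e ->
    exists k, forall i, (k <= i)%N -> n ((x_ i).1 - x.1) <= e.
Proof.
move=> Cx nx.
have [|||w [phi [Lw Sw wc [c Hc]]]] := @linear_state_complete R d s d0 s0 cds_gt0
  Omega B mO OB A Ca mA A0 ACa (fun i => (x_ i).1) (fun i => (x_ i).2).
- by move=> i; have [[]] := Cx i.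
- by move=> i; have [[]] := Cx i.
- exact: nx.
exists (w, phi); first split => //.
  (* Countably many null sets are merged first; then at almost every point the limit of the controls
     stays in the closed set [K x]. *)
  have Kx : {ae leb, forall x, forall i, Omega x -> K x ((x_ i).1 x)}.
    by apply: ae_foralln => i; have [] := Cx i.
  apply: ae_imply (ae_and Kx wc) => x [Kxx cx] Ox.
  apply: (@closed_cvg _ _ \oo eventually_filter (fun i => (x_ i).1 x) (K x)).
  - exact: Kclosed.
  - by apply: nearW => i; exact: Kxx.
  - exact: cx.
move=> e e0.
have c1' : 0 < `|c| + 1 by rewrite ltr_wpDl.
have [j hj] := @geometric_small R 4^-1 (e / (`|c| + 1)) ltac:(lra) (divr_gt0 e0 c1').
exists j => i ji; apply: (le_trans (Hc i)).
apply: (@le_trans _ _ ((`|c| + 1) * 4^-1 ^+ j)).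
  apply: (@le_trans _ _ ((`|c| + 1) * 4^-1 ^+ i)).
    by rewrite ler_wpM2r ?exprn_ge0 ?invr_ge0// (le_trans (ler_norm _))// lerDl.
  by rewrite ler_wpM2l ?(ltW c1')// ler_wiXn2l//; lra.
by move: hj; rewrite ltr_pdivlMr// mulrC => /ltW.
Qed.

Lemma uniform_positivity :
  (forall w phi, L2O w -> lin w phi -> inK w -> J w = 0 -> n w <> 0 ->
    0 < lam * n w + b phi) ->
  exists tau delta : R, [/\ 0 < tau, 0 < delta &
    forall w phi, L2O w -> lin w phi -> inK w -> J w <= tau * Num.sqrt (n w) ->
    delta * n w <= lam * n w + b phi].
Proof.
move=> pos; have [c cc HN] := N_bound.
have n_ge0 w : 0 <= n w by rewrite fine_ge0// wsq_ge0.
have N_ge0 f : 0 <= N f by rewrite fine_ge0// wsq_ge0.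
(* Subadditivity bounds the difference of the two values by the value at the difference of the
   controls. *)
have j_cont e (x y : X) : 0 < e -> S x -> S y ->
    J x.1 - J y.1 <= k * (fine (leb Omega) + 1) * (e + e^-1 * n (x.1 - y.1)).
  move=> e0 Sx Sy; have SBx := sq_intB mO m1 c1 Sx.1 Sy.1.
  have := directionalD mO Oy mpsi psiD psi_le SBx Sy.1.
  have -> : ((x.1 \- y.1) \+ y.1)%R = x.1 by apply/funext => z /=; rewrite subrK.
  have := directional_le mO Oy mpsi k0 psi_le e0 SBx.
  rewrite -lerBlDr; exact: (fun p q => le_trans q p).
have j_ge0 x : C x -> 0 <= J x.1.
  move=> [[[mx _] _] Kx]; apply: (ae_ge0_Rintegral mO (mpsi mx)).
  by apply: ae_imply (ae_and Kx psi_ge0) => z [xz pz] Oz; apply: (pz Oz); exact: xz.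
have [|tau [delta [tau0 delta0 H]]] := @strict_positivity_is_uniform R X S C
  (fun x => n x.1) (fun x => N x.2) (fun x => b x.2) (fun x => J x.1) lam c
  (k * (fine (leb Omega) + 1)) lam0 SB (fun x Cx => Cx.1) CD CZ
  (fun x => n_ge0 x.1) (fun c' x Sx => fine_wsqZ mO m1 c1 c' Sx.1)
  (fun x y Sx Sy => fine_wsq_parallelogram mO m1 c1 Sx.1 Sy.1)
  (fun e x y e0 Sx Sy => fine_wsq_young mO m1 c1 e0 Sx.1 Sy.1)
  (fun x => N_ge0 x.2) (fun c' x Sx => fine_wsqZ mO mGO G0O c' (SG Sx))
  (fun x y Sx Sy => fine_wsqD_le mO mGO G0O (SG Sx) (SG Sy))
  (fun x Sx => (HN _ _ Sx.1 Sx.2).2)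
  (fun c' x Sx => quadraticZ mO mGO G0O mg gG c' (SG Sx))
  (fun e x y e0 Sx Sy => quadratic_cont mO mGO G0O mg gG e0 (SG Sx) (SG Sy))
  (fun c' x c0' Sx => directionalZ mO Oy mpsi psiZ psi_le c0' Sx.1)
  (fun x y Sx Sy => directionalD mO Oy mpsi psiD psi_le Sx.1 Sy.1)
  j_cont j_ge0 n_complete N_compact.
- by move=> x [[x1 x2] x3] Jx nx; exact: pos.
- exists tau, delta; split => // w phi Lw Sw Kw Jw.
  exact: (H (w, phi)).
Qed.

End uniform_positivity.

(** * The directional derivative of the absolute value and the variational inequality *)

Definition abs_dir (R : realType) (a t : R) : R :=
  if 0 < a then t else if a < 0 then - t else `|t|.

Section abs_dir.
Context (R : realType).
Implicit Types a t e : R.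

Lemma abs_dirZ c a t : 0 <= c -> abs_dir a (c * t) = c * abs_dir a t.
Proof.
move=> c0; rewrite /abs_dir; case: ifP => // _; case: ifP => _; first by rewrite mulrN.
by rewrite normrM ger0_norm.
Qed.

Lemma abs_dirD a t t' : abs_dir a (t + t') <= abs_dir a t + abs_dir a t'.
Proof.
rewrite /abs_dir; case: ifP => // _; case: ifP => _; last exact: ler_normD.
by rewrite opprD.
Qed.

Lemma normr_abs_dir a t : `|abs_dir a t| = `|t|.
Proof.
by rewrite /abs_dir; case: ifP => // _; case: ifP => _; rewrite ?normrN ?normr_id.
Qed.

(** The subgradient inequality: directional derivatives of a convex function dominate every
    subgradient. *)
Lemma abs_dir_ge a e t : (0 < a -> e = 1) -> (a < 0 -> e = -1) ->
  (a = 0 -> -1 <= e <= 1) -> e * t <= abs_dir a t.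
Proof.
rewrite /abs_dir; case: ltrgtP => // a0.
- by move=> /(_ isT) ->; rewrite mul1r.
- by move=> _ /(_ isT) ->; rewrite mulN1r.
- move=> _ _ /(_ (esym a0)); rewrite -ler_norml => e1.
  apply: (le_trans (ler_norm _)); rewrite normrM; exact: ler_piMl.
Qed.

End abs_dir.

Section abs_dir_integral.
Context d (T : measurableType d) (R : realType) (mu : {measure set T -> \bar R}).
Context (D : set T) (mD : measurable D).

Lemma measurable_fun_ite (h : T -> bool) (f g : T -> R) : measurable_fun D h ->
  measurable_fun D f -> measurable_fun D g ->
  measurable_fun D (fun x => if h x then f x else g x).
Proof.
move=> mh mf mg; apply: measurable_fun_if => //.
- by apply: measurable_funS mf => // x [].
- by apply: measurable_funS mg => // x [].
Qed.

Lemma measurable_abs_dir (q w : T -> R) : measurable_fun D q -> measurable_fun D w ->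
  measurable_fun D (fun x => abs_dir (q x) (w x)).
Proof.
move=> mq mw; apply: measurable_fun_ite => //; first exact: measurable_fun_ltr.
apply: measurable_fun_ite => //; first exact: measurable_fun_ltr.
- exact: measurableT_comp.
- exact: measurableT_comp.
Qed.

Lemma Rintegral_abs_dir (q w : T -> R) : measurable_fun D q ->
  mu.-integrable D (EFin \o w) ->
  \int[mu]_(x in D `&` [set x | 0 < q x]) w x -
  \int[mu]_(x in D `&` [set x | q x < 0]) w x +
  \int[mu]_(x in D `&` [set x | q x = 0]) `|w x| =
  \int[mu]_(x in D) abs_dir (q x) (w x).
Proof.
move=> mq Iw.
have P (h : T -> bool) (f : T -> R) : measurable_fun D h -> mu.-integrable D (EFin \o f) ->
    mu.-integrable D (EFin \o (fun x => if h x then f x else 0)).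
  move=> mh If; have mf : measurable_fun D f.
    by apply/measurable_EFinP; exact: measurable_int If.
  apply: (ae_le_integrable mD _ (integrable_norm If)); first exact: measurable_fun_ite.
  by apply: aeW => x _ /=; case: ifP => _ //=; rewrite normr0.
have E (h : T -> bool) (f : T -> R) :
    f \_ [set x | h x] = (fun x => if h x then f x else 0).
  apply/funext => x; rewrite patchE; congr (if _ then _ else _).
  by apply/idP/idP => [/set_mem|h1]; [|apply/mem_set].
have I1 := P _ _ (measurable_fun_ltr (measurable_cst (0 : R)) mq) Iw.
have I2 := P _ _ (measurable_fun_ltr mq (measurable_cst (0 : R))) Iw.
have I3 := P _ _ (measurable_fun_eqr mq (measurable_cst (0 : R))) (integrable_norm Iw).
rewrite (_ : [set x | q x = 0] = [set x | q x == 0]); last first.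
  by apply/seteqP; split=> x /eqP.
rewrite !Rintegral_mkcondr !E -RintegralB// -RintegralD//; last by apply: eq_integrable (integrableB mD I1 I2).
apply: eq_Rintegral => x _; rewrite /abs_dir (eq_sym (q x)).
by case: ltrgtP => qx /=; rewrite ?subr0 ?addr0 ?sub0r ?add0r.
Qed.

End abs_dir_integral.

Section bang_bang.
Context d (T : measurableType d) (R : realType) (mu : {measure set T -> \bar R}).
Context (D : set T) (mD : measurable D).
Hypothesis Dy : (mu D < +oo)%E.

(* Test the variational inequality with the control that equals alpha where
   h > 0, beta where h < 0, and q elsewhere. *)
Lemma variational_sign (h q : T -> R) (alpha beta k : R) :
  measurable_fun D h -> measurable_fun D q ->
  {ae mu, forall x, D x -> `|h x| <= k} ->
  {ae mu, forall x, D x -> alpha <= q x <= beta} -> alpha <= beta ->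
  (forall q', measurable_fun D q' -> {ae mu, forall x, D x -> alpha <= q' x <= beta} ->
    0 <= \int[mu]_(x in D) (h x * (q' x - q x))) ->
  {ae mu, forall x, D x -> (0 < h x -> q x = alpha) /\ (h x < 0 -> q x = beta)}.
Proof.
move=> mh mq hk qab ab var.
pose q' x := if 0 < h x then alpha else if h x < 0 then beta else q x.
have mq' : measurable_fun D q'.
  apply: measurable_fun_ite => //; first exact: measurable_fun_ltr.
  by apply: measurable_fun_ite => //; exact: measurable_fun_ltr.
have q'ab : {ae mu, forall x, D x -> alpha <= q' x <= beta}.
  apply: ae_imply qab => x + Dx => /(_ Dx) H; rewrite /q'.
  by case: ifP => _; [rewrite lexx|case: ifP => _ //; rewrite lexx andbT].
have mp : measurable_fun D (fun x => h x * (q' x - q x)).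
  by apply: measurable_funM => //; exact: measurable_funB.
have Ip : mu.-integrable D (EFin \o (fun x => h x * (q' x - q x))).
  apply: (@ae_bounded_integrable _ _ _ _ _ mD _ (k * (beta - alpha))) => //.
  apply: ae_imply (ae_and hk (ae_and qab q'ab)) => x [H1 [H2 H3]] Dx.
  have {}H1 := H1 Dx; have /andP[] := H2 Dx; have /andP[] := H3 Dx => a1 b1 a2 b2.
  rewrite normrM; apply: ler_pM => //.
  by rewrite ler_norml; apply/andP; split; lra.
(* The choice of [q'] makes the integrand nonpositive, whereas the variational inequality makes its
   integral nonnegative. It therefore vanishes almost everywhere. *)
have le0 : {ae mu, forall x, D x -> h x * (q' x - q x) <= 0}.
  apply: ae_imply qab => x + Dx => /(_ Dx) /andP[a1 b1]; rewrite /q'.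
  have [h0|h0|h0] := ltrgtP 0 (h x).
  - by rewrite pmulr_rle0// subr_le0.
  - by rewrite nmulr_rle0// subr_ge0.
  - by rewrite -h0 mul0r.
apply: ae_imply (ae_le0_Rintegral_eq0 mD Ip le0 (var _ mq' q'ab)) => x + Dx => /(_ Dx)/eqP.
rewrite mulf_eq0 subr_eq0 /q'; have [h0|h0|h0] := ltrgtP 0 (h x).
- by move=> /= /eqP e; split.
- by move=> /= /eqP e; split.
- by [].
Qed.

End bang_bang.

(** * Bounds, weights and integrals for the data of the control problem *)

Lemma bounded_coordinates (R : realType) d (A : set 'rV[R]_d) : bounded_set A ->
  exists2 B, 0 <= B & forall x, A x -> forall i, `|x ord0 i| <= B.
Proof.
move=> [M [_ AM]]; exists (`|M| + 1); first by rewrite addr_ge0.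
move=> x Ax i; have := AM (`|M| + 1) _ x Ax.
have M1 : M < `|M| + 1 by rewrite (le_lt_trans (ler_norm _))// ltrDl.
move/(_ M1) => /=; apply: le_trans; rewrite /Num.Def.normr /= mx_normrE.
exact: (le_bigmax _ (fun i : 'I_1 * 'I_d => `|x i.1 i.2|) (ord0, i)).
Qed.

Lemma leb_bounded (R : realType) d (A : set 'rV[R]_d) (B : R) :
  measurable (A : set (caratheodory_type (borel_lebesgue R d)^*%mu)) -> 0 <= B ->
  (forall x, A x -> forall i, `|x ord0 i| <= B) ->
  (lebesgue_rV R d A <= ((2 * (B + 1)) ^+ d)%:E)%E.
Proof.
move=> mA B0 AB; have h0 : 0 <= 2 * (B + 1) by lra.
(* Boxes are half-open; the margin 1 keeps points with a coordinate equal to B inside. *)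
rewrite -(borel_lebesgue_box (fun=> - (B + 1)) h0) -leb_borelE; last exact: measurable_rV_box.
apply: le_measure; rewrite ?inE//.
  by apply: borel_lebT; exact: measurable_rV_box.
move=> x Ax i; have := AB x Ax i; rewrite ler_norml => /andP[]; lra.
Qed.

Section weighted_data.
Context d (T : measurableType d) (R : realType) (mu : {measure set T -> \bar R}).
Context (D : set T) (mD : measurable D).

Lemma Lfun2_restrictP (f : T -> R) :
  f \_ D \in Lfun mu 2%:E <-> sq_int mu D (cst 1) f.
Proof.
rewrite Lfun2P wsq_restrict; split=> -[mf fy]; split => //.
  exact/(measurable_restrictT _ mD).
exact/(measurable_restrictT f mD).
Qed.

(** The weight is |f| + c on [D] and 0 elsewhere, since the cell averages require a function on the
    whole space. It is in L^r because [D] has finite measure and (x + c)^r is at most 2^r (x^r +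
    c^r). *)
Lemma dominating_weight (r c : R) (f : T -> R) : (mu D < +oo)%E -> 1 <= r -> 0 <= c ->
  f \_ D \in Lfun mu r%:E -> exists (G : T -> R) (I : R),
  [/\ measurable_fun setT G, forall x, 0 <= G x,
      (\int[mu]_x (G x `^ r)%:E <= I%:E)%E, forall x, ~ D x -> G x = 0 &
      forall x, D x -> G x = `|f x| + c].
Proof.
move=> Dy r1 c0 fr; have r0 : 0 < r by exact: lt_le_trans r1.
have mf := Lfun_restrict_measurable mD fr.
have := Lfun_powR r0 fr; set X := (\int[mu]_(x in D) _)%E => Xy.
pose G := (fun x => `|f x| + c) \_ D.
have mGD : measurable_fun D (fun x => `|f x| + c).
  by apply: measurable_funD => //; exact: measurableT_comp.
have mp (h : T -> R) : measurable_fun D h -> measurable_fun D (fun x => (h x `^ r)%:E).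
  by move=> mh; apply/measurable_EFinP; apply: (measurableT_comp (measurable_powR _)).
have mfr : measurable_fun D (fun x => (`|f x| `^ r)%:E) by apply: mp; exact: measurableT_comp.
have GI : (\int[mu]_x (G x `^ r)%:E < +oo)%E.
  rewrite (_ : (\int[mu]_x _)%E = (\int[mu]_(x in D) ((`|f x| + c) `^ r)%:E)%E); last first.
    rewrite [RHS]integral_mkcond; apply: eq_integral => x _; rewrite /G !patchE.
    by case: ifPn => // _; rewrite powR0 ?gt_eqF.
  apply: (@le_lt_trans _ _ (\int[mu]_(x in D) ((2 `^ r)%:E * (`|f x| `^ r)%:E + (2 `^ r * c `^ r)%:E))%E).
    apply: ge0_le_integral => //.
    - by move=> x _; rewrite lee_fin powR_ge0.
    - exact: mp.
    - by apply: emeasurable_funD => //; exact: measurable_funeM.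
    move=> x _; rewrite -EFinM -EFinD lee_fin -mulrDr.
    apply: (@le_trans _ _ ((2 * Num.max `|f x| c) `^ r)).
      apply: ge0_ler_powR; rewrite ?nnegrE ?(ltW r0) ?addr_ge0 ?mulr_ge0 ?le_max ?normr_ge0//.
      by rewrite mulr_natl mulr2n lerD// le_max lexx ?orbT.
    rewrite powRM ?le_max ?normr_ge0// ler_wpM2l ?powR_ge0//.
    by rewrite /Num.max; case: ifP => _; rewrite ?lerDl ?lerDr powR_ge0.
  have h1 x : D x -> (0 <= (2 `^ r)%:E * (`|f x| `^ r)%:E)%E.
    by move=> _; rewrite -EFinM lee_fin mulr_ge0 ?powR_ge0.
  have h2 x : D x -> (0 <= (2 `^ r * c `^ r)%:E)%E.
    by move=> _; rewrite lee_fin mulr_ge0 ?powR_ge0.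
  rewrite (ge0_integralD _ mD h1 (measurable_funeM _ mfr) h2)//.
  have h3 x : D x -> (0 <= (`|f x| `^ r)%:E)%E by rewrite lee_fin powR_ge0.
  rewrite integral_cst// (ge0_integralZl_EFin _ mD h3 mfr (powR_ge0 _ _)).
  apply: lte_add_pinfty; apply: lte_mul_pinfty => //; rewrite lee_fin ?powR_ge0//.
  by rewrite mulr_ge0 ?powR_ge0.
have I0 : (0 <= \int[mu]_x (G x `^ r)%:E)%E.
  by apply: integral_ge0 => x _; rewrite lee_fin powR_ge0.
exists G, (fine (\int[mu]_x (G x `^ r)%:E)); split.
- exact/(measurable_restrictT _ mD).
- by move=> x; rewrite /G patchE; case: ifP => // _; rewrite addr_ge0.
- by rewrite fineK// ge0_fin_numE.
- by move=> x Dx; rewrite /G patchE memNset.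
- by move=> x Dx; rewrite /G patchE mem_set.
Qed.

Lemma measurable_clip (c : R) (f : T -> R) : measurable_fun D f ->
  measurable_fun D (fun x => Num.max 0 (Num.min c (f x))).
Proof. by move=> mf; apply: measurable_maxr => //; exact: measurable_minr. Qed.

Lemma measurable_addM (c : R) (p q : T -> R) : measurable_fun D p ->
  measurable_fun D q -> measurable_fun D (fun x => p x + c * q x).
Proof. by move=> mp mq; apply: measurable_funD => //; exact: measurable_funM. Qed.

Lemma measurable_affine_abs_dir (lambda mu' : R) (p q w : T -> R) : measurable_fun D p ->
  measurable_fun D q -> measurable_fun D w ->
  measurable_fun D (fun x => (p x + lambda * q x) * w x + mu' * abs_dir (q x) (w x)).
Proof.
move=> mp mq mw; apply: measurable_addM; last exact: measurable_abs_dir.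
by apply: measurable_funM => //; exact: measurable_addM.
Qed.

Lemma Rintegral_wip (A' A f g : T -> R) : measurable_fun D A' -> measurable_fun D A ->
  measurable_fun D f -> measurable_fun D g ->
  {ae mu, forall x, D x -> A' x = A x} ->
  \int[mu]_(x in D) (A' x * f x * g x) = wip mu D A f g.
Proof.
move=> mA' mA mf mg AA; apply: ae_eq_Rintegral => //.
- by do 2 apply: measurable_funM => //.
- by do 2 apply: measurable_funM => //.
- by apply: ae_imply AA => x + Dx => /(_ Dx) ->; rewrite mulrAC mulrC mulrA mulrAC.
Qed.

Lemma Rintegral_second_variation (lambda : R) (L2 a2 p w f G : T -> R) :
  measurable_fun D L2 -> measurable_fun D a2 -> measurable_fun D p ->
  measurable_fun D G -> (forall x, D x -> 0 <= G x) ->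
  {ae mu, forall x, D x -> `|L2 x - p x * a2 x| <= G x} ->
  sq_int mu D (cst 1) w -> sq_int mu D G f ->
  \int[mu]_(x in D) (L2 x * f x ^+ 2 + lambda * w x ^+ 2 - p x * a2 x * f x ^+ 2) =
  lambda * fine (wsq mu D (cst 1) w) +
  \int[mu]_(x in D) (f x ^+ 2 * (L2 x - p x * a2 x)).
Proof.
move=> mL ma mp mG G0 gG sw sf.
have [mw wy] := sw.
have mg : measurable_fun D (fun x => L2 x - p x * a2 x).
  by apply: measurable_funB => //; exact: measurable_funM.
have Iw := wsq_integrable mD (measurable_cst (1 : R)) (fun _ _ => ler01) mw wy.
have Iq := quadratic_integrable mD mG G0 mg gG sf.
have Iz : mu.-integrable D (EFin \o (fun x => lambda * (w x ^+ 2 * cst 1 x))).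
  by apply: eq_integrable (integrableZl mD lambda Iw).
rewrite -[X in _ * X]/(\int[mu]_(x in D) (w x ^+ 2 * cst 1 x)) -(RintegralZl lambda mD Iw).
rewrite -(RintegralD mD Iz Iq); apply: eq_Rintegral => x _ /=; ring.
Qed.

Lemma sq_int1_neq0 (w : T -> R) : sq_int mu D (cst 1) w ->
  (fine (wsq mu D (cst 1) w) <> 0) <-> ~ {ae mu, forall x, D x -> w x = 0}.
Proof.
move=> sw; have [mw wy] := sw.
split=> nz h; apply: nz.
  rewrite (@wsq_ae _ _ _ mu D mD _ (measurable_cst (1 : R)) (fun _ _ => ler01) w (cst 0))//.
  by rewrite /wsq integral0_eq// => x _; rewrite expr0n mul0r.
apply: (wsq1_eq0 mD (measurable_cst (1 : R)) (fun _ _ => ltr01) mw).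
by rewrite -(fineK (sq_int_fin (fun _ _ => ler01) sw)) h.
Qed.

End weighted_data.

Section domain.
Context (R : realType) (d : nat) (Omega : set 'rV[R]_d).
Local Notation leb := (@lebesgue_rV R d).
Local Notation lebT := (caratheodory_type (borel_lebesgue R d)^*%mu).
Hypothesis mO : measurable (Omega : set lebT).
Local Notation L2O := (sq_int leb (Omega : set lebT) (cst 1)).
Local Notation n w := (fine (wsq leb (Omega : set lebT) (cst 1%R) w)).

Lemma leb_complete : measure_is_complete leb.
Proof. exact: measure_is_complete_caratheodory. Qed.

Lemma LpO2P (w : lebT -> R) : LpO Omega 2%:E w <-> L2O w.
Proof. exact: Lfun2_restrictP. Qed.

Lemma LpO_norm2_sqr (w : lebT -> R) : LpO_norm Omega 2%:E w ^+ 2 = n w.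
Proof. by rewrite -wsq_restrict -Lnorm2_sqr. Qed.

Lemma sqrt_LpO_norm2 (w : lebT -> R) : LpO_norm Omega 2%:E w = Num.sqrt (n w).
Proof. by rewrite -LpO_norm2_sqr sqrtr_sqr ger0_norm// fine_ge0// Lnorm_ge0. Qed.

(** The sign and the bound of the derivative of [a] hold almost everywhere only. This exchanges it
    for a function [A] that can have them at every point, as the weighted estimates ask. *)
Lemma linearized_stateP (s : R) (a : lebT -> R -> R) (u A w phi : lebT -> R) :
  measurable_fun (Omega : set lebT) (fun x => derive1 (a x) (u x)) ->
  measurable_fun (Omega : set lebT) A ->
  {ae leb, forall x, Omega x -> derive1 (a x) (u x) = A x} ->
  is_linearized_state Omega s a u w phi <-> linear_state s Omega A w phi.
Proof.
move=> ma mA aA.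
have E v : tildeHs s Omega phi -> tildeHs s Omega v ->
    calA s phi v + intO Omega (fun x => derive1 (a x) (u x) * phi x * v x) =
    intO Omega (fun x => w x * v x) <->
    cds d s / 2 * wip (leb \x leb)%E setT
      (fun z => frac_kernel s (z.1 : 'rV[R]_d) (z.2 : 'rV[R]_d)) (diffs phi) (diffs v) +
      wip leb (Omega : set lebT) A phi v = wip leb (Omega : set lebT) (cst 1) w v.
  move=> /tildeHs_measurable mphi /tildeHs_measurable mv.
  rewrite (_ : wip leb _ (cst 1) w v = intO Omega (fun x => w x * v x)); last first.
    by apply: eq_Rintegral => x _; rewrite mulr1.
  rewrite -calAE -(Rintegral_wip mO ma mA (measurable_funTS mphi) (measurable_funTS mv) aA).
  by [].
split=> -[Vp H]; split => // v Vv; exact/(E v Vp Vv)/H.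
Qed.

End domain.

(** * The first variation at a local minimum *)

Lemma closed_implication (T : topologicalType) (P : Prop) (A : set T) :
  closed A -> closed [set t | P -> A t].
Proof.
move=> cA; have [p|np] := pselect P.
  by rewrite (_ : [set t | _] = A)//; apply/seteqP; split=> t //= /(_ p).
by rewrite (_ : [set t | _] = setT); [exact: closedT|apply/seteqP; split=> // t _ /np].
Qed.

Section optimal_control.
Context (R : realType) (d : nat) (Omega : set 'rV[R]_d).
Context (s r lambda mu alpha beta : R) (a L : 'rV[R]_d -> R -> R).
Context (qbar ubar pbar etabar : 'rV[R]_d -> R).
Local Notation leb := (@lebesgue_rV R d).
Local Notation lebT := (caratheodory_type (borel_lebesgue R d)^*%mu).
Hypothesis mO : measurable (Omega : set lebT).
Hypothesis Oy : (leb Omega < +oo)%E.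
Local Notation mfun f := (measurable_fun (Omega : set lebT) (f : lebT -> R)).
Hypotheses (mp : mfun pbar) (mq : mfun qbar) (meta : mfun etabar).
Hypothesis mu0 : 0 < mu.
Hypothesis ab : alpha <= beta.
Context (Mp Me : R).
Hypothesis hp : aeO Omega (fun x => `|pbar x| <= Mp).
Hypothesis he : aeO Omega (fun x => `|etabar x| <= Me).
Hypothesis hq : aeO Omega (fun x => alpha <= qbar x <= beta).
Hypothesis lambda0 : 0 < lambda.
Hypothesis heta : aeO Omega (fun x => [/\ 0 < qbar x -> etabar x = 1,
  qbar x < 0 -> etabar x = -1 & qbar x = 0 -> -1 <= etabar x <= 1]).
Hypothesis hvar : forall q, Qad Omega alpha beta q ->
  0 <= intO Omega (fun x => (pbar x + lambda * qbar x + mu * etabar x) * (q x - qbar x)).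

(** The density of F'(qbar) w + mu j'(qbar; w), as a function of the value t of w at x. *)
Definition first_variation (x : lebT) (t : R) : R :=
  (pbar x + lambda * qbar x) * t + mu * abs_dir (qbar x) t.

Definition sign_cone (x : lebT) : set R :=
  [set t | (qbar x = alpha -> 0 <= t) /\ (qbar x = beta -> t <= 0)].

Let normq : aeO Omega (fun x => `|qbar x| <= `|alpha| + `|beta|).
Proof.
apply: ae_imply hq => x + Ox => /(_ Ox) /andP[q1 q2].
have := ler_norm beta; have := ler_norm (- alpha); rewrite normrN => h1 h2.
have := normr_ge0 alpha; have := normr_ge0 beta => h3 h4.
by rewrite ler_norml; apply/andP; split; lra.
Qed.

Lemma first_variation_le : {ae leb, forall x : lebT, Omega x -> forall t,
  `|first_variation x t| <= (Mp + lambda * (`|alpha| + `|beta|) + mu) * `|t|}.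
Proof.
apply: ae_imply (ae_and hp normq) => x [p1 q1] Ox t.
have {}p1 := p1 Ox; have {}q1 := ler_wpM2l (ltW lambda0) (q1 Ox).
apply: (le_trans (ler_normD _ _)); rewrite !normrM normr_abs_dir (gtr0_norm mu0) mulrDl lerD2r.
rewrite ler_wpM2r//; apply: (le_trans (ler_normD _ _)); rewrite normrM (gtr0_norm lambda0).
exact: lerD.
Qed.

(** The subgradient inequality bounds the density below by h t, with h the function of the
    variational inequality. Where h is nonzero, qbar sits at the bound whose sign condition gives t
    the sign of h. *)
Lemma first_variation_ge0 : {ae leb, forall x : lebT, Omega x -> forall t,
  sign_cone x t -> 0 <= first_variation x t}.
Proof.
pose h (x : lebT) := pbar x + lambda * qbar x + mu * etabar x.
have mh : mfun h.
  exact: (measurable_addM mu (measurable_addM lambda mp mq) meta).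
have hh : {ae leb, forall x : lebT, Omega x -> `|h x| <= Mp + lambda * (`|alpha| + `|beta|) + mu * Me}.
  apply: ae_imply (ae_and hp (ae_and normq he)) => x [p1 [q1 e1]] Ox.
  have {}p1 := p1 Ox; have {}q1 := ler_wpM2l (ltW lambda0) (q1 Ox).
  have {}e1 := ler_wpM2l (ltW mu0) (e1 Ox).
  apply: (le_trans (ler_normD _ _)); apply: lerD; last by rewrite normrM (gtr0_norm mu0).
  apply: (le_trans (ler_normD _ _)); apply: lerD => //.
  by rewrite normrM (gtr0_norm lambda0).
have bang := variational_sign mO Oy mh mq hh hq ab.
have {bang} bang : {ae leb, forall x : lebT, Omega x ->
    (0 < h x -> qbar x = alpha) /\ (h x < 0 -> qbar x = beta)}.
  apply: bang => q mq' hq'; apply: hvar; split=> //; apply/(LpO2P mO); split => //.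
  have In : leb.-integrable (Omega : set lebT) (EFin \o (fun x => q x ^+ 2)).
    apply: (ae_bounded_integrable mO Oy (measurable_funX 2 mq')
      (c := (`|alpha| + `|beta|) ^+ 2)).
    apply: ae_imply hq' => x + Ox => /(_ Ox) /andP[q1 q2].
    rewrite normrX lerXn2r ?nnegrE ?addr_ge0//.
    have := ler_norm beta; have := ler_norm (- alpha); rewrite normrN => h1 h2.
    have := normr_ge0 alpha; have := normr_ge0 beta => h3 h4.
    by rewrite ler_norml; apply/andP; split; lra.
  have /integrableP[_] := In; rewrite /wsq; congr (_ < _)%E; apply: eq_integral => x _ /=.
  by rewrite mulr1 ger0_norm ?sqr_ge0.
apply: ae_imply (ae_and bang heta) => x [b1 e1] Ox t [t1 t2].
have [{}b1 b2] := b1 Ox; have [e2 e3 e4] := e1 Ox.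
apply: (@le_trans _ _ (h x * t)); last first.
  rewrite /first_variation /h mulrDl lerD2l -mulrA ler_wpM2l ?(ltW mu0)//.
  exact: abs_dir_ge.
have [h0|h0|<-] := ltrgtP 0 (h x); last by rewrite mul0r.
- by rewrite pmulr_rge0//; exact/t1/b1.
- by rewrite nmulr_rge0//; exact/t2/b2.
Qed.

Lemma dF_djE (w : lebT -> R) : sq_int leb (Omega : set lebT) (cst 1) w ->
  dF Omega lambda pbar qbar w + mu * dj Omega qbar w = \int[leb]_(x in Omega) first_variation x (w x).
Proof.
move=> sw; have [mw _] := sw.
have Iw := sq_int1_integrable mO Oy sw.
have Ij : leb.-integrable (Omega : set lebT) (EFin \o (fun x => abs_dir (qbar x) (w x))).
  apply: (ae_le_integrable mO _ (integrable_norm Iw)); first exact: measurable_abs_dir.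
  by apply: aeW => x _ /=; rewrite normr_abs_dir.
have IP : leb.-integrable (Omega : set lebT)
    (EFin \o (fun x => (pbar x + lambda * qbar x) * w x)).
  have IZ : leb.-integrable (Omega : set lebT)
      (EFin \o (fun x => (Mp + lambda * (`|alpha| + `|beta|)) * `|w x|)).
    by apply: eq_integrable (integrableZl mO _ (integrable_norm Iw)).
  apply: (ae_le_integrable mO _ IZ).
    exact: (measurable_funM (measurable_addM lambda mp mq) mw).
  apply: ae_imply (ae_and hp normq) => x [p1 q1] Ox.
  have {}p1 := p1 Ox; have {}q1 := ler_wpM2l (ltW lambda0) (q1 Ox).
  rewrite normrM ler_wpM2r//; apply: (le_trans (ler_normD _ _)).
  by rewrite normrM (gtr0_norm lambda0); exact: lerD.
rewrite /dj (Rintegral_abs_dir mO mq Iw) /dF /intO -(RintegralZl mu mO Ij).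
rewrite -(RintegralD mO IP)//.
by apply: eq_integrable (integrableZl mO mu Ij).
Qed.

End optimal_control.

(** * Translation of the control problem into the linearized setting *)

Local Notation lebT R d := (caratheodory_type (borel_lebesgue R d)^*%mu).

Theorem theorem4p7 (R : realType) (d : nat) (Omega : set 'rV[R]_d)
    (s r lambda mu alpha beta : R) (a L : 'rV[R]_d -> R -> R)
    (qbar ubar pbar etabar : 'rV[R]_d -> R)
    (hd : (2 <= d)%N) (hOmega : lipschitz_domain Omega)
    (hs : 0 < s < 1) (hr : d%:R / (2 * s) < r)
    (hlambda : 0 < lambda) (hmu : 0 < mu) (halphabeta : alpha < 0 < beta)
    (hA1 : assumption_A1 Omega r a) (hA2 : assumption_A2 Omega a)
    (hA3 : assumption_A3 Omega a)
    (hB1 : assumption_B1 Omega L) (hB2 : assumption_B2 Omega r L)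
    (hmin : local_minimum Omega s lambda mu alpha beta a L qbar ubar)
    (hp : is_adjoint_state Omega s a L ubar pbar)
    (heta : subdiff_j Omega qbar etabar)
    (hvar : forall q, Qad Omega alpha beta q ->
      0 <= intO Omega (fun x =>
        (pbar x + lambda * qbar x + mu * etabar x) * (q x - qbar x))) :
  (forall w phi,
      critical_cone Omega lambda mu alpha beta pbar qbar w ->
      ~ aeO Omega (fun x => w x = 0) ->
      is_linearized_state Omega s a ubar w phi ->
      0 < d2F Omega lambda a L ubar pbar w phi)
  <->
  (exists tau delta : R, [/\ 0 < tau, 0 < delta &
    forall w phi,
      critical_cone_tau Omega lambda mu alpha beta tau pbar qbar w ->
      is_linearized_state Omega s a ubar w phi ->
      delta * LpO_norm Omega 2%:E w ^+ 2 <=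
        d2F Omega lambda a L ubar pbar w phi]).
Proof.
have [s0 s1] := andP hs; have [alpha0 beta0] := andP halphabeta.
have d0 : (0 < d)%N by exact: ltnW.
have [_ oO _ bO _] := hOmega.
have mO := borel_open oO.
have [B B0 OB] := bounded_coordinates bO.
have Om := leb_bounded mO B0 OB.
have Oy : (lebesgue_rV R d Omega < +oo)%E by apply: (le_lt_trans Om); rewrite ltry.
have r1 : 1 <= r.
  apply: ltW; apply: le_lt_trans hr; rewrite ler_pdivlMr ?mulr_gt0// mul1r.
  (* Here d >= 2 and s < 1 enter: 2s <= 2 <= d, so d/(2s) is at least 1 and r exceeds it. *)
  apply: (@le_trans _ _ 2); last by rewrite ler_nat.
  by rewrite ger_pMr// ltW.
have ck := cds_gt0 d hs.
have [[Lq qab] [Vu Lu _] _] := hmin.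
have [Vp Lp _] := hp.
have [Le sube] := heta.
have [m m0 um] := Lfun_infty_bounded Lu.
have [Mp Mp0 pm] := Lfun_infty_bounded Lp.
have [Me _ em] := Lfun_infty_bounded Le.
have [[ma _] C2a _ _] := hA1.
have [[mL _] C2L _] := hB1.
have [Ca Ca0 aC] := hA3 m m0.
have [psi1 [phi1 [_ Lphi Lm]]] := hB2 m m0.
have mub := measurable_funTS (tildeHs_measurable Vu) : measurable_fun (Omega : set (lebT R d)) ubar.
have mp := measurable_funTS (tildeHs_measurable Vp) : measurable_fun (Omega : set (lebT R d)) pbar.
have mq := Lfun_restrict_measurable mO Lq.
have meta := Lfun_restrict_measurable mO Le.
have ma1 := measurable_derive1 (@leb_complete R d) mO ma mub
  (ae_imply (fun x h Ox => let: And3 h1 _ _ := h Ox in h1) C2a).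
have ma2 := measurable_derive1n2 (@leb_complete R d) mO ma mub C2a.
have mL2 := measurable_derive1n2 (@leb_complete R d) mO mL mub C2L.
(* Clipping secures 0 <= A <= Ca at every point and changes the derivative only on a null set. *)
pose A x := Num.max 0 (Num.min Ca (derive1 (a x) (ubar x))).
have mA : measurable_fun (Omega : set (lebT R d)) A.
  exact: (measurable_clip Ca ma1).
have A0 x : Omega x -> 0 <= A x by rewrite le_max lexx.
have ACa x : Omega x -> A x <= Ca by rewrite ge_max (ltW Ca0) ge_min lexx.
have aA : {ae lebesgue_rV R d, forall x, Omega x -> derive1 (a x) (ubar x) = A x}.
  apply: ae_imply (ae_and hA2 (ae_and aC um)) => x [h1 [h2 h3]] Ox.
  have [h4 _] := h2 Ox; have := h4 _ (h3 Ox); have := h1 Ox (ubar x) => a0 le.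
  rewrite /A min_r ?max_r//; apply: le_trans le.
  by rewrite (le_trans (ler_norm _))// lerDl.
pose g x := derive1n 2 (L x) (ubar x) - pbar x * derive1n 2 (a x) (ubar x).
have mg : measurable_fun (Omega : set (lebT R d)) g.
  exact: (measurable_funB mL2 (measurable_funM mp ma2)).
have c0 : 0 <= Mp * Ca by rewrite mulr_ge0// ltW.
(* [phi1] bounds the second derivative of L along ubar, and [Mp * Ca] bounds pbar times that of
   a. *)
have [G [I [mG G0 GI GO GE]]] := dominating_weight mO Oy r1 c0 Lphi.
have gG : {ae lebesgue_rV R d, forall x, Omega x -> `|g x| <= G x}.
  apply: ae_imply (ae_and aC (ae_and Lm (ae_and um pm))) => x [h1 [h2 [h3 h4]]] Ox.
  have [h5 _] := h1 Ox; have [_ h6] := h2 Ox _ (h3 Ox).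
  rewrite GE//; apply: (le_trans (ler_normB _ _)); apply: lerD.
    by apply: (le_trans h6); exact: ler_norm.
  rewrite normrM; apply: ler_pM => //; first exact: h4.
  by apply: le_trans (h5 _ (h3 Ox)); rewrite lerDr.
have mGO := measurable_funTS mG : measurable_fun (Omega : set (lebT R d)) G.
pose K := sign_cone alpha beta qbar.
have KD x t t' : K x t -> K x t' -> K x (t + t').
  move=> [h1 h2] [h3 h4]; split=> h; first by rewrite addr_ge0 ?h1 ?h3.
  by rewrite -oppr_ge0 opprD addr_ge0// oppr_ge0 ?h2 ?h4.
have KZ c x t : 0 <= c -> K x t -> K x (c * t).
  move=> cc [h1 h2]; split=> h; first by rewrite mulr_ge0 ?h1.
  by rewrite mulr_ge0_le0 ?h2.
have Kclosed x : closed (K x).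
  by apply: closedI; apply: closed_implication; [exact: closed_ge|exact: closed_le].
have ab := ltW (lt_trans alpha0 beta0).
have psi_le := first_variation_le hmu pm qab hlambda.
have psi_ge0 := first_variation_ge0 mO Oy mp mq meta hmu ab pm em qab hlambda sube hvar.
have mpsi w : measurable_fun (Omega : set (lebT R d)) w ->
  measurable_fun (Omega : set (lebT R d))
    (fun x => first_variation lambda mu qbar pbar x (w x)).
  exact: measurable_affine_abs_dir.
have psiZ c x t : 0 <= c -> first_variation lambda mu qbar pbar x (c * t) =
    c * first_variation lambda mu qbar pbar x t.
  by move=> cc; rewrite /first_variation abs_dirZ//; ring.
have psiD x t t' : first_variation lambda mu qbar pbar x (t + t') <=
    first_variation lambda mu qbar pbar x t + first_variation lambda mu qbar pbar x t'.
  rewrite /first_variation mulrDr addrACA lerD2l -mulrDr ler_wpM2l ?(ltW hmu)//.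
  exact: abs_dirD.
have k0 : 0 <= Mp + lambda * (`|alpha| + `|beta|) + mu.
  by rewrite !addr_ge0 ?mulr_ge0 ?addr_ge0 ?(ltW Mp0) ?(ltW hlambda) ?(ltW hmu).
have U := uniform_positivity d0 s0 r1 hr ck mO Om OB mA A0 ACa mG G0 GI GO mg gG
  mpsi psiZ psiD k0 psi_le hlambda KD KZ Kclosed psi_ge0.
have [c _ HN] := N_bound d0 s0 r1 hr ck mO Om OB A0 mG G0 GI GO.
have linE w phi := linearized_stateP mO s w phi ma1 mA aA.
have d2FE w phi : LpO Omega 2%:E w -> is_linearized_state Omega s a ubar w phi ->
    d2F Omega lambda a L ubar pbar w phi =
    lambda * fine (wsq (lebesgue_rV R d) (Omega : set (lebT R d)) (cst 1) w) +
    \int[lebesgue_rV R d]_(x in Omega) (phi x ^+ 2 * g x).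
  move=> /(LpO2P mO) Lw /linE Sw; have [sG _] := HN _ _ Lw Sw.
  exact: (Rintegral_second_variation mO lambda mL2 ma2 mp mGO (fun x _ => G0 x) gG Lw sG).
split=> [pos|[tau [delta [tau0 delta0 H]]] w phi [Lw sw jw] nw Sw].
  have [|tau [delta [tau0 delta0 H]]] := U.
    move=> w phi Lw /linE Sw Kw jw nw.
    have Lw' := (LpO2P mO w).2 Lw.
    rewrite -d2FE//; apply: pos => //; last exact/(sq_int1_neq0 mO Lw).
    by split => //; rewrite (dF_djE mu mO Oy mp mq pm qab hlambda).
  exists tau, delta; split=> // w phi [Lw' sw jw] Sw.
  have Lw := (LpO2P mO w).1 Lw'.
  rewrite d2FE// LpO_norm2_sqr; apply: H => //; first exact/linE.
  by rewrite -sqrt_LpO_norm2 -(dF_djE mu mO Oy mp mq pm qab hlambda).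
have Lw' := (LpO2P mO w).1 Lw.
(* The critical cone lies in each enlarged one, as its first variation is 0; strictness comes from w
   being nonzero on a set of positive measure. *)
apply: (@lt_le_trans _ _ (delta * LpO_norm Omega 2%:E w ^+ 2)); last first.
  apply: H => //; split => //.
  by rewrite jw sqrt_LpO_norm2 mulr_ge0 ?sqrtr_ge0// ltW.
rewrite LpO_norm2_sqr mulr_gt0// lt_neqAle fine_ge0 ?wsq_ge0// andbT eq_sym.
by apply/eqP/(sq_int1_neq0 mO Lw').
Qed.
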